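(* Let $\mathfrak{U}$ be any family of finite-dimensional unitary groups equipped with bi-invariant submultiplicative norms. Then Thompson's groups $F$, $F'$, $T$ and $V$ are uniformly $\mathfrak{U}$-stable, with a linear estimate.
   Context: **Stability.** All groups are discrete and countable; $\omega$ is a fixed non-principal ultrafilter on $\mathbb{N}=\{0,1,2,\dots\}$. $\mathfrak{U}$ is a family of pairs $(U(k),\|\cdot\|)$, where $U(k)$ is the group of $k\times k$ unitary matrices and $\|\cdot\|$ is a norm on $k\times k$ complex matrices that is submultiplicative ($\|AB\|\le\|A\|\|B\|$) and bi-invariant ($\|uAv\|=\|A\|$ for $u,v\in U(k)$); the same $U(k)$ may occur several times with different norms. For maps $\phi,\psi:\Gamma\to U(k)$ put $\operatorname{def}(\phi)=\sup_{g,h\in\Gamma}\|\phi(gh)-\phi(g)\phi(h)\|$ and $\operatorname{dist}(\phi,\psi)=\sup_{g\in\Gamma}\|\phi(g)-\psi(g)\|$. A *uniform asymptotic homomorphism* $\phi:\Gamma\to\mathfrak{U}$ is a sequence of maps $\phi_n:\Gamma\to U(k_n)$, with $(U(k_n),\|\cdot\|)\in\mathfrak{U}$, such that $\operatorname{def}(\phi_n)\to 0$. $\Gamma$ is *uniformly $\mathfrak{U}$-stable* if for every uniform asymptotic homomorphism $(\phi_n)$ there are homomorphisms $\psi_n:\Gamma\to U(k_n)$ with $\operatorname{dist}(\phi_n,\psi_n)\to 0$. It is *uniformly $\mathfrak{U}$-stable with a linear estimate* if for every uniform asymptotic homomorphism $(\phi_n)$ there are homomorphisms $\psi_n:\Gamma\to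 U(k_n)$ with $\operatorname{dist}(\phi_n,\psi_n)=O_\omega(\operatorname{def}(\phi_n))$, i.e. there are $C\ge 0$ and $S\in\omega$ such that $\operatorname{dist}(\phi_n,\psi_n)\le C\operatorname{def}(\phi_n)$ for all $n\in S$. **Thompson's groups.** $F$ is the group of orientation-preserving piecewise linear homeomorphisms of $[0,1]$ with breakpoints in $\mathbb{Z}[1/2]$ and slopes in $2^{\mathbb{Z}}$; $F'$ is its derived (commutator) subgroup. $T$ is the group of orientation-preserving piecewise linear homeomorphisms of the circle $\mathbb{R}/\mathbb{Z}$ preserving $\mathbb{Z}[1/2]/\mathbb{Z}$, with breakpoints in $\mathbb{Z}[1/2]/\mathbb{Z}$ and slopes in $2^{\mathbb{Z}}$. $V$ is the following group of homeomorphisms of the Cantor set $X=2^{\mathbb{N}}$: a *dyadic brick* is a clopen set $X_\sigma$ of all infinite binary sequences with a given finite prefix $\sigma$; any two dyadic bricks are canonically homeomorphic via replacing the prefix, $X_\sigma\to X_\tau:\sigma x\mapsto\tau x$; an element of $V$ is a homeomorphism given by two finite partitions of $X$ of the same size into dyadic bricks, the bricks of the first being sent to those of the second (by some bijection) via the canonical homeomorphisms. *)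

(* Defs.v *)
From HB Require Import structures.
From mathcomp Require Import all_boot all_order all_algebra.
From mathcomp Require Import spectral complex.
From mathcomp Require Import all_classical all_reals all_analysis.

Set Implicit Arguments.
Unset Strict Implicit.
Unset Printing Implicit Defensive.

Import Order.TTheory GRing.Theory Num.Theory.
Import numFieldNormedType.Exports.

Local Open Scope classical_set_scope.
Local Open Scope ring_scope.

Definition is_subgroup (G : groupType) (S : set G) : Prop :=
  S 1%g /\ forall x y, S x -> S y -> S (x / y)%g.

Record subgroup (G : groupType) := Subgroup {
  subgroup_set :> set G;
  subgroupP : is_subgroup subgroup_set
}.

Definition subgroup_type (G : groupType) (H : subgroup G) : Type :=
  set_type H.

Lemma subgroup_group_closed (G : groupType) (H : subgroup G) :
  group_closed (mem (subgroup_set H)).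
Proof.
have [H1 HF] := subgroupP H; split=> [|x y]; rewrite !inE; [exact: H1|exact: HF].
Qed.

HB.instance Definition _ (G : groupType) (H : subgroup G) :=
  SubChoice.copy (subgroup_type H) (set_type H).
HB.instance Definition _ (G : groupType) (H : subgroup G) :=
  SubChoice_isSubGroup.Build G _ (subgroup_type H)
    (@subgroup_group_closed G H).

Definition generated (G : groupType) (A : set G) : set G :=
  smallest (@is_subgroup G) A.

Lemma generated_subgroup (G : groupType) (A : set G) :
  is_subgroup (generated A).
Proof.
split=> [S [[S1 _] _] //|x y Sx Sy S AS].
by have [[_ SF] _] := AS; apply: SF; [exact: Sx|exact: Sy].
Qed.

Definition derived_subgroup (G : groupType) : subgroup G :=
  Subgroup (generated_subgroup [set z : G | exists x y : G, z = [~ x, y]%g]).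

Record homeo (X : topologicalType) := Homeo {
  homeo_fun :> X -> X;
  homeo_inv : X -> X;
  homeo_funK : cancel homeo_fun homeo_inv;
  homeo_invK : cancel homeo_inv homeo_fun;
  homeo_fun_continuous : continuous homeo_fun;
  homeo_inv_continuous : continuous homeo_inv
}.

HB.instance Definition _ (X : topologicalType) := gen_eqMixin (homeo X).
HB.instance Definition _ (X : topologicalType) := gen_choiceMixin (homeo X).

Section HomeoGroup.
Variable X : topologicalType.
Implicit Types f g h : homeo X.

Lemma homeo_eq f g : f =1 g -> f = g.
Proof.
case: f g => [f fi fK fiK cf cfi] [g gi gK giK cg cgi] /= /funext fg.
subst g; have fgi : fi = gi by apply/funext => x; rewrite -[x in LHS]giK fK.
subst gi; congr Homeo; exact: Prop_irrelevance.
Qed.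

Definition homeo_one : homeo X :=
  @Homeo X id id (fun=> erefl) (fun=> erefl)
    (fun=> cvg_id) (fun=> cvg_id).

Definition homeo_opp f : homeo X :=
  Homeo (@homeo_invK _ f) (@homeo_funK _ f)
    (@homeo_inv_continuous _ f) (@homeo_fun_continuous _ f).

Definition homeo_comp f g : homeo X :=
  Homeo (can_comp (@homeo_funK _ f) (@homeo_funK _ g))
    (can_comp (@homeo_invK _ g) (@homeo_invK _ f))
    (fun x => continuous_comp (@homeo_fun_continuous _ g x)
                              (@homeo_fun_continuous _ f (g x)))
    (fun x => continuous_comp (@homeo_inv_continuous _ f x)
                              (@homeo_inv_continuous _ g (homeo_inv f x))).

Fact homeo_mulA : associative homeo_comp.
Proof. by move=> f g h; exact: homeo_eq. Qed.
Fact homeo_mul1g : left_id homeo_one homeo_comp.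
Proof. by move=> f; exact: homeo_eq. Qed.
Fact homeo_mulg1 : right_id homeo_one homeo_comp.
Proof. by move=> f; exact: homeo_eq. Qed.
Fact homeo_mulVg : left_inverse homeo_one homeo_opp homeo_comp.
Proof. by move=> f; apply: homeo_eq => x /=; rewrite homeo_funK. Qed.
Fact homeo_mulgV : right_inverse homeo_one homeo_opp homeo_comp.
Proof. by move=> f; apply: homeo_eq => x /=; rewrite homeo_invK. Qed.

HB.instance Definition _ := isGroup.Build (homeo X)
  homeo_mulA homeo_mul1g homeo_mulg1 homeo_mulVg homeo_mulgV.

Lemma homeo_subgroup (S : set (homeo X)) :
  S homeo_one -> (forall f g, S f -> S g -> S (homeo_comp f g)) ->
  (forall f, S f -> S (homeo_opp f)) -> is_subgroup S.
Proof. by move=> S1 SM SV; split=> // f g Sf Sg; apply: SM => //; exact: SV. Qed.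

End HomeoGroup.

Section Dyadic.
Variable R : realType.

Definition dyadic : set R :=
  [set x | exists (k : int) (n : nat), x = k%:~R / 2 ^+ n].

Lemma dyadic0 : dyadic 0.
Proof. by exists 0, 0%N; rewrite mul0r. Qed.

Lemma dyadicD x y : dyadic x -> dyadic y -> dyadic (x + y).
Proof.
move=> [k [n ->]] [l [m ->]]; exists (k * 2 ^+ m + l * 2 ^+ n), (n + m)%N.
rewrite rmorphD !rmorphM !rmorphXn /= exprD.
have u p : (2 : R) ^+ p != 0 by rewrite expf_neq0.
by rewrite addf_div ?u.
Qed.

Lemma dyadicN x : dyadic x -> dyadic (- x).
Proof. by move=> [k [n ->]]; exists (- k), n; rewrite rmorphN mulNr. Qed.

Lemma dyadicB x y : dyadic x -> dyadic y -> dyadic (x - y).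
Proof. by move=> dx dy; apply: dyadicD => //; exact: dyadicN. Qed.

Lemma dyadicZ (m : int) x : dyadic x -> dyadic (2 ^ m * x).
Proof.
move=> [k [n ->]]; case: m => m.
  by exists (2 ^+ m * k), n; rewrite rmorphM rmorphXn -mulrA.
exists k, (m.+1 + n)%N; by rewrite exprD invfM mulrCA.
Qed.

Lemma dyadicZE (m : int) x : dyadic (2 ^ m * x) <-> dyadic x.
Proof.
split; last exact: dyadicZ.
move=> /(dyadicZ (- m)); rewrite mulrA -expfzDr ?pnatr_eq0//.
by rewrite addNr expr0z mul1r.
Qed.

End Dyadic.

Section ThompsonF.
Variable R : realType.

Definition unit_interval : Type := set_type `[0%R : R, 1%R]%classic.

HB.instance Definition _ := Topological.copy unit_interval
  (set_type `[0%R : R, 1%R]%classic).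

Definition I01_val (x : unit_interval) : R := set_val x.

(* [B] contains all the breakpoints of [f] but need not be exactly that set. *)
Definition I01_PL_dyadic (f : unit_interval -> unit_interval) : Prop :=
  exists B : set unit_interval,
    [/\ finite_set B, forall c, B c -> dyadic (I01_val c) &
      forall a b : unit_interval, I01_val a < I01_val b ->
        (forall c, I01_val a < I01_val c < I01_val b -> ~ B c) ->
        exists m : int, forall x, I01_val a <= I01_val x <= I01_val b ->
          I01_val (f x) = I01_val (f a) + 2 ^ m * (I01_val x - I01_val a)].

Definition I01_increasing (f : unit_interval -> unit_interval) : Prop :=
  forall x y, I01_val x < I01_val y -> I01_val (f x) < I01_val (f y).

Definition thompsonF_set : set (homeo unit_interval) :=
  [set f | I01_increasing f /\ I01_PL_dyadic f].

Lemma I01_val_inj : injective I01_val.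
Proof. exact: val_inj. Qed.

Lemma I01_val_ge0 x : 0 <= I01_val x.
Proof. by have := set_valP x; rewrite /= in_itv /= => /andP[]. Qed.

Lemma I01_increasingE f : I01_increasing f ->
  forall x y, (I01_val (f x) < I01_val (f y)) = (I01_val x < I01_val y).
Proof.
move=> fi x y; apply/idP/idP => [fxy|]; last exact: fi.
rewrite ltNge; apply/negP; rewrite le_eqVlt => /orP[/eqP/I01_val_inj yx|/fi].
  by rewrite yx ltxx in fxy.
by move/(lt_trans fxy); rewrite ltxx.
Qed.

Lemma I01_increasing_leE f : I01_increasing f ->
  forall x y, (I01_val (f x) <= I01_val (f y)) = (I01_val x <= I01_val y).
Proof. by move=> fi x y; rewrite !leNgt I01_increasingE. Qed.

Lemma I01_increasing_inv (f : homeo unit_interval) :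
  I01_increasing f -> I01_increasing (homeo_inv f).
Proof.
by move=> fi x y xy; rewrite -(I01_increasingE fi) !homeo_invK.
Qed.

Fact I01_0_subproof : (0 : R) \in `[0%R : R, 1%R]%classic.
Proof. by rewrite inE /= in_itv /= lexx ler01. Qed.
Let I01_0 : unit_interval := exist _ 0 I01_0_subproof.

Lemma I01_increasing0 (f : homeo unit_interval) :
  I01_increasing f -> f I01_0 = I01_0.
Proof.
move=> fi; have : 0 <= I01_val (homeo_inv f I01_0) := I01_val_ge0 _.
rewrite le_eqVlt => /orP[/eqP e|].
  have /(congr1 f) : I01_0 = homeo_inv f I01_0 by exact: I01_val_inj.
  by rewrite homeo_invK.
rewrite -[X in X < _]/(I01_val I01_0) => /fi; rewrite homeo_invK.
by rewrite ltNge I01_val_ge0.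
Qed.

Let seq_max (p : pred unit_interval) (s : seq unit_interval) : has p s ->
  exists2 c, c \in s & p c /\ forall d, d \in s -> p d -> I01_val d <= I01_val c.
Proof.
elim: s => //= a s IH; case: (boolP (has p s)) => [ps _|nps].
  have [c cs [pc cmax]] := IH ps.
  have [ac|ca] := leP (I01_val a) (I01_val c).
    exists c; first by rewrite inE cs orbT.
    by split=> // d; rewrite inE => /orP[/eqP-> //|]; exact: cmax.
  case: (boolP (p a)) => pa.
    exists a; first by rewrite inE eqxx.
    split=> // d; rewrite inE => /orP[/eqP-> //|ds pd].
    by rewrite (le_trans (cmax d ds pd))// ltW.
  exists c; first by rewrite inE cs orbT.
  split=> // d; rewrite inE => /orP[/eqP->|]; last exact: cmax.
  by rewrite (negbTE pa).
rewrite orbF => pa; exists a; first by rewrite inE eqxx.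
split=> // d; rewrite inE => /orP[/eqP-> //|ds pd].
by case/hasP: nps; exists d.
Qed.

Lemma thompsonF_dyadic (f : homeo unit_interval) x : thompsonF_set f ->
  dyadic (I01_val (f x)) <-> dyadic (I01_val x).
Proof.
case=> fi [B [/finite_seqP[s Bs] Bd fB]].
pose p (y : unit_interval) := [pred d : unit_interval | 0 < I01_val d < I01_val y].
have [n] := ubnP (count (p x) s); elim: n x => // n IH x; rewrite ltnS => sxn.
have v0 : I01_val I01_0 = 0 by [].
have step (c : unit_interval) (m : int) :
    (dyadic (I01_val (f c)) <-> dyadic (I01_val c)) -> dyadic (I01_val c) ->
    I01_val (f x) = I01_val (f c) + 2 ^ m * (I01_val x - I01_val c) ->
    dyadic (I01_val (f x)) <-> dyadic (I01_val x).
  move=> fc dc ->; have dfc := fc.2 dc; split => [d|d].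
    rewrite -(subrK (I01_val c) (I01_val x)); apply: dyadicD => //.
    apply/(dyadicZE m); rewrite -[X in dyadic X](addKr (I01_val (f c))).
    by rewrite addrC; exact: dyadicB.
  by apply: dyadicD => //; apply: dyadicZ; exact: dyadicB.
have := I01_val_ge0 x; rewrite le_eqVlt => /orP[/eqP x0|x0].
  have -> : x = I01_0 by apply: I01_val_inj; rewrite v0.
  by rewrite I01_increasing0.
have [px|npx] := boolP (has (p x) s); last first.
  have [|c /andP[c0 cx] Bc|m fm] := fB I01_0 x; first by rewrite v0.
    case/hasP: npx; exists c => /=; first by move: Bc; rewrite Bs.
    by rewrite -v0 c0.
  apply: (@step I01_0 m); rewrite ?I01_increasing0//; first exact: dyadic0.
  by rewrite fm ?I01_increasing0// lexx v0 ltW.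
have [c cs [/= /andP[c0 cx] cmax]] := seq_max px.
have Bc : B c by rewrite Bs.
have [//|d /andP[cd dx] Bd'|m fm] := fB c x.
  have : I01_val d <= I01_val c.
    by apply: cmax => /=; [move: Bd'; rewrite Bs|rewrite (lt_trans c0)].
  by rewrite leNgt cd.
apply: (@step c m); [|exact: Bd|by rewrite fm// lexx ltW].
apply: IH; apply: leq_trans sxn; rewrite -addn1.
have cp : (0 < count (pred1 c) s)%N by rewrite -has_count has_pred1.
apply: leq_trans (leq_add (leqnn _) cp) _.
rewrite -count_predUI [X in (_ + X <= _)%N](eq_count (a2 := pred0)); last first.
  by move=> d /=; apply/negP => /andP[/andP[_ dc] /eqP dE]; rewrite dE ltxx in dc.
rewrite count_pred0 addn0; apply: sub_count => d /= /orP[/andP[-> dc]|/eqP->].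
  exact: lt_trans dc cx.
by rewrite c0.
Qed.

Lemma thompsonF_subgroup : is_subgroup thompsonF_set.
Proof.
apply: homeo_subgroup.
- split; first by move=> x y.
  exists set0; split=> // a b _ _; exists 0 => x _.
  by rewrite expr0z mul1r addrCA subrr addr0.
- move=> f g Ff Fg; have [fi [Bf [finf df fB]]] := Ff.
  have [gi [Bg [fing dg gB]]] := Fg; split.
    by move=> x y xy; apply: fi; exact: gi.
  exists (Bg `|` homeo_inv g @` Bf); split.
  + by rewrite finite_setU; split=> //; exact: finite_image.
  + move=> c [/dg //|[d /df dd <-]].
    by apply/(thompsonF_dyadic _ Fg); rewrite homeo_invK.
  + move=> a b ab abB.
    have [c cab Bc|m gm] := gB a b ab; first by apply: (abB c cab); left.
    have [|c /andP[ac cb] Bc|l fl] := fB (g a) (g b); first exact: gi.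
      apply: (abB (homeo_inv g c)); last by right; exists c.
      rewrite -(I01_increasingE gi a) -(I01_increasingE gi (homeo_inv g c)).
      by rewrite !homeo_invK ac.
    exists (l + m) => x abx /=.
    rewrite fl ?(I01_increasing_leE gi)// expfzDr ?pnatr_eq0// -mulrA.
    by rewrite gm// addrAC subrr add0r.
- move=> f Ff; have [fi [B [finB dB fB]]] := Ff.
  split; first exact: I01_increasing_inv.
  exists (f @` B); split; first exact: finite_image.
    by move=> _ [c Bc <-]; apply/(thompsonF_dyadic _ Ff); exact: dB.
  move=> a b ab abB.
  have [||m fm] := fB (homeo_inv f a) (homeo_inv f b).
  - by rewrite (I01_increasingE (I01_increasing_inv fi)).
  - move=> c; rewrite -(I01_increasingE fi (homeo_inv f a)).
    rewrite -(I01_increasingE fi c) !homeo_invK => cab Bc.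
    by apply: (abB _ cab); exists c.
  exists (- m) => x abx /=.
  have := fm (homeo_inv f x).
  rewrite !(I01_increasing_leE (I01_increasing_inv fi)) => /(_ abx).
  rewrite !homeo_invK => ->.
  rewrite [X in _ * X]addrAC subrr add0r mulrA -expfzDr ?pnatr_eq0//.
  by rewrite addNr expr0z mul1r addrC subrK.
Qed.

Definition thompsonF : subgroup (homeo unit_interval) :=
  Subgroup thompsonF_subgroup.

End ThompsonF.

Section ThompsonT.
Variable R : realType.

Definition circle_rel (x y : R) : bool := x - y \is a Num.int.

Fact circle_refl : reflexive circle_rel.
Proof. by move=> x; rewrite /circle_rel subrr int_num0. Qed.
Fact circle_sym : symmetric circle_rel.
Proof. by move=> x y; rewrite /circle_rel -opprB rpredN. Qed.
Fact circle_trans : transitive circle_rel.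
Proof.
by move=> y x z xy yz; rewrite /circle_rel -(subrK y x) -addrA rpredD.
Qed.

Definition circle_equiv :=
  EquivRel circle_rel circle_refl circle_sym circle_trans.

Definition circle : topologicalType :=
  quotient_topology {eq_quot circle_equiv}%qT.

Definition circle_proj (x : R) : circle :=
  (\pi_(quotient_topology {eq_quot circle_equiv}) x)%qT.

Definition dyadic_circle : set circle := circle_proj @` @dyadic R.

(* An increasing lift of a homeomorphism is onto, hence continuous. *)
Definition increasing_lift (f : circle -> circle) (phi : R -> R) : Prop :=
  [/\ forall x, circle_proj (phi x) = f (circle_proj x),
      forall x, phi (x + 1) = phi x + 1 &
      forall x y, x < y -> phi x < phi y].

(* As above, [B] contains the breakpoints, here as points of the circle. *)
Definition circle_PL_dyadic (phi : R -> R) : Prop :=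
  exists B : set circle,
    [/\ finite_set B, B `<=` dyadic_circle &
      forall a b : R, a < b ->
        (forall c, a < c < b -> ~ B (circle_proj c)) ->
        exists m : int, forall x, a <= x <= b ->
          phi x = phi a + 2 ^ m * (x - a)].

Definition thompsonT_set : set (homeo circle) :=
  [set f | f @` dyadic_circle = dyadic_circle /\
    exists2 phi, increasing_lift f phi & circle_PL_dyadic phi].

Lemma circle_projP x y :
  circle_proj x = circle_proj y <-> exists n : int, x = y + n%:~R.
Proof.
split=> [/eqquotP/= /intrP[n xy]|[n ->]].
  by exists n; rewrite -xy addrC subrK.
by apply/eqquotP; rewrite /= /circle_rel addrAC subrr add0r; apply/intrP; exists n.
Qed.

Lemma circle_proj_surj z : exists x, circle_proj x = z.
Proof. by exists (repr (z : {eq_quot circle_equiv}%qT)); exact: reprK. Qed.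

Section Lift.
Variables (f : homeo circle) (phi : R -> R).
Hypothesis fphi : increasing_lift f phi.

Lemma liftE x y : (phi x < phi y) = (x < y).
Proof.
have [_ _ inc] := fphi; apply/idP/idP => [pxy|]; last exact: inc.
rewrite ltNge; apply/negP; rewrite le_eqVlt => /orP[/eqP yx|/inc].
  by rewrite yx ltxx in pxy.
by move/(lt_trans pxy); rewrite ltxx.
Qed.

Lemma lift_leE x y : (phi x <= phi y) = (x <= y).
Proof. by rewrite !leNgt liftE. Qed.

Lemma lift_inj : injective phi.
Proof.
by move=> x y e; apply/eqP; rewrite eq_le -lift_leE -[X in _ && X]lift_leE e lexx.
Qed.

Lemma lift_int x (n : int) : phi (x + n%:~R) = phi x + n%:~R.
Proof.
have [_ ph1 _] := fphi.
have pos (k : nat) y : phi (y + k%:R) = phi y + k%:R.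
  by elim: k => [|k IH]; rewrite ?addr0// -natr1 !addrA ph1 IH.
case: n => k; first exact: pos.
rewrite NegzE rmorphN /= -[in RHS](subrK (k.+1%:R) x) pos.
by rewrite addrK.
Qed.

Lemma lift_surj y : exists x, phi x = y.
Proof.
have [pf _ _] := fphi.
have [x xE] := circle_proj_surj (homeo_inv f (circle_proj y)).
have /circle_projP[n yE] : circle_proj y = circle_proj (phi x).
  by rewrite pf xE homeo_invK.
by exists (x + n%:~R); rewrite lift_int.
Qed.

Definition lift_inv y := sval (cid (lift_surj y)).

Lemma lift_invK y : phi (lift_inv y) = y.
Proof. exact: svalP (cid (lift_surj y)). Qed.

Lemma lift_inv_lift : increasing_lift (homeo_inv f) lift_inv.
Proof.
have [pf ph1 _] := fphi; split=> [x|x|x y xy].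
- by rewrite -[in RHS](lift_invK x) pf homeo_funK.
- by apply: lift_inj; rewrite ph1 !lift_invK.
- by rewrite -liftE !lift_invK.
Qed.

End Lift.

Lemma thompsonT_subgroup : is_subgroup thompsonT_set.
Proof.
apply: homeo_subgroup.
- split; first by rewrite /= image_id.
  exists id; first by split.
  exists set0; split=> // a b _ _; exists 0 => x _.
  by rewrite expr0z mul1r addrCA subrr addr0.
- move=> f g [Df [phi fphi [Bf [finf df fB]]]].
  move=> [Dg [psi gpsi [Bg [fing dg gB]]]]; split.
    by rewrite -[RHS]Df -[in RHS]Dg -image_comp.
  have [pf pf1 fi] := fphi; have [pg pg1 gi] := gpsi.
  exists (phi \o psi).
    split=> [x|x|x y xy] /=; first by rewrite pf pg.
      by rewrite pg1 pf1.
    by apply: fi; exact: gi.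
  exists (Bg `|` homeo_inv g @` Bf); split.
  + by rewrite finite_setU; split=> //; exact: finite_image.
  + move=> c [/dg //|[d /df dd <-]].
    by move: dd; rewrite -{1}Dg => -[e de <-]; rewrite homeo_funK.
  + move=> a b ab abB.
    have [c cab Bc|m gm] := gB a b ab; first by apply: (abB c cab); left.
    have [|c /andP[ac cb] Bc|l fl] := fB (psi a) (psi b); first exact: gi.
      apply: (abB (lift_inv gpsi c)).
        by rewrite -(liftE gpsi a) -(liftE gpsi (lift_inv gpsi c)) !lift_invK ac.
      right; exists (circle_proj c) => //.
      by rewrite -(lift_invK gpsi c) pg homeo_funK lift_invK.
    exists (l + m) => x abx /=.
    rewrite fl ?(lift_leE gpsi)// expfzDr ?pnatr_eq0// -mulrA.
    by rewrite (gm x)// addrAC subrr add0r.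
- move=> f [Df [phi fphi [B [finB dB fB]]]]; split.
    rewrite -{1}Df image_comp (_ : _ \o _ = id) ?image_id//.
    by apply/funext => x /=; rewrite homeo_funK.
  have [pf pf1 fi] := fphi.
  exists (lift_inv fphi); first exact: lift_inv_lift.
  have li := lift_inv_lift fphi.
  exists (f @` B); split; first exact: finite_image.
    by rewrite -Df; exact: image_subset.
  move=> a b ab abB.
  have [||m fm] := fB (lift_inv fphi a) (lift_inv fphi b).
  - by rewrite -(liftE fphi) !lift_invK.
  - move=> c; rewrite -(liftE fphi (lift_inv fphi a)) -(liftE fphi c) !lift_invK.
    by move=> cab Bc; apply: (abB _ cab); exists (circle_proj c).
  exists (- m) => x abx.
  have := fm (lift_inv fphi x).
  rewrite !(@lift_leE (homeo_opp f) _ li) !lift_invK => /(_ abx) xE.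
  rewrite [in RHS]xE.
  rewrite [X in _ * X]addrAC subrr add0r mulrA -expfzDr ?pnatr_eq0//.
  by rewrite addNr expr0z mul1r addrC subrK.
Qed.

Definition thompsonT : subgroup (homeo circle) := Subgroup thompsonT_subgroup.

End ThompsonT.

Section ThompsonV.

Definition prepend (s : seq bool) (x : cantor_space) : cantor_space :=
  fun n => nth (x (n - size s)%N) s n.

Definition dyadic_brick (s : seq bool) : set cantor_space := range (prepend s).

(* The bijection between the two partitions is absorbed in the indexing. *)
Definition thompsonV_set : set (homeo cantor_space) :=
  [set f | exists (n : nat) (s t : 'I_n -> seq bool),
    [/\ partition setT (fun i => dyadic_brick (s i)) setT,
        partition setT (fun i => dyadic_brick (t i)) setT &
        forall i x, f (prepend (s i) x) = prepend (t i) x]].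

Lemma prepend_cat s t x : prepend (s ++ t) x = prepend s (prepend t x).
Proof.
apply/funext => n; rewrite /prepend nth_cat size_cat; case: ltnP => ns.
  by apply: set_nth_default.
by rewrite [RHS]nth_default// subnDA.
Qed.

Lemma prepend_mkseq (x : cantor_space) n : exists y, x = prepend (mkseq x n) y.
Proof.
exists (fun k => x (n + k)%N); apply/funext => k; rewrite /prepend size_mkseq.
have [kn|nk] := ltnP k n; first by rewrite nth_mkseq.
by rewrite nth_default ?size_mkseq// subnKC.
Qed.

Lemma prepend_take s t x y : (size s <= size t)%N ->
  prepend s x = prepend t y -> s = take (size s) t.
Proof.
move=> st /(congr1 (fun f : nat -> bool => f)) e.
apply: (@eq_from_nth _ false); first by rewrite size_takel.
move=> i si; have /(congr1 (fun f : nat -> bool => f i)) := e.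
rewrite /prepend nth_take// (set_nth_default false) => [->|//].
by rewrite (set_nth_default false)// (leq_trans si).
Qed.

Lemma prepend_size_eq s t x y : size s = size t ->
  prepend s x = prepend t y -> s = t.
Proof.
by move=> st /prepend_take; rewrite st leqnn take_size => /(_ isT).
Qed.

Lemma thompsonV_setP (f : homeo cantor_space) : thompsonV_set f <->
  exists N, forall w : seq bool, size w = N ->
    exists t, forall x, f (prepend w x) = prepend t x.
Proof.
split=> [[n [s [t [[cs _ _] _ fst]]]]|[N fN]].
  exists (\max_(i < n) size (s i)) => w wE.
  have : [set: cantor_space] (prepend w (fun=> false)) by [].
  rewrite -cs => -[i _ [z _ zE]].
  have siw : (size (s i) <= size w)%N.
    by rewrite wE; exact: (@leq_bigmax _ (fun i => size (s i)) i).
  exists (t i ++ drop (size (s i)) w) => x.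
  rewrite -[in LHS](cat_take_drop (size (s i)) w) -(prepend_take siw zE).
  by rewrite !prepend_cat fst.
pose W := {: N.-tuple bool}.
pose s (i : 'I_#|W|) : seq bool := (enum_val i : N.-tuple bool).
have [t tE] : {t : 'I_#|W| -> seq bool &
    forall i x, f (prepend (s i) x) = prepend (t i) x}.
  apply: (@choice _ _ (fun i t => forall x, f (prepend (s i) x) = prepend t x)).
  by move=> i; apply: fN; rewrite size_tuple.
have s_eq i j x y : prepend (s i) x = prepend (s j) y -> i = j.
  move=> e; apply: enum_val_inj; apply: val_inj.
  by apply: prepend_size_eq e; rewrite !size_tuple.
have s_cov (x : cantor_space) : exists i y, x = prepend (s i) y.
  have [y xE] := prepend_mkseq x N.
  have wN : size (mkseq x N) == N by rewrite size_mkseq.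
  by exists (enum_rank (Tuple wN)), y; rewrite /s enum_rankK.
have tinv i y : homeo_inv f (prepend (t i) y) = prepend (s i) y.
  by rewrite -tE homeo_funK.
exists #|W|, s, t; split=> //; split.
- by apply/seteqP; split=> // x _; have [i [y ->]] := s_cov x; exists i => //; exists y.
- by move=> i j _ _ [_ [[x _ <-] [y _ /esym]]]; exact: s_eq.
- by move=> i _; exists (prepend (s i) (fun=> false)), (fun=> false).
- apply/seteqP; split=> // x _; have [i [y xE]] := s_cov (homeo_inv f x).
  by exists i => //; exists y => //; rewrite -tE -xE homeo_invK.
- move=> i j _ _ [_ [[x _ <-] [y _ /(congr1 (homeo_inv f))/esym]]].
  by rewrite !tinv; exact: s_eq.
- by move=> i _; exists (prepend (t i) (fun=> false)), (fun=> false).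
Qed.

Lemma thompsonV_subgroup : is_subgroup thompsonV_set.
Proof.
apply: homeo_subgroup.
- by apply/thompsonV_setP; exists 0%N => w /size0nil ->; exists [::].
- move=> f g /thompsonV_setP[N fN] /thompsonV_setP[M gM].
  apply/thompsonV_setP; exists (M + N)%N => w wE.
  have [|t tE] := gM (take M w); first by rewrite size_takel// wE leq_addr.
  pose v := t ++ drop M w.
  have vN : (N <= size v)%N by rewrite size_cat size_drop wE addKn leq_addl.
  have [|u uE] := fN (take N v); first by rewrite size_takel.
  exists (u ++ drop N v) => x /=.
  rewrite -[in LHS](cat_take_drop M w) prepend_cat tE -prepend_cat -/v.
  by rewrite -[in LHS](cat_take_drop N v) !prepend_cat uE.
- move=> f [n [s [t [ps pt fE]]]]; exists n, t, s; split=> // i x /=.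
  by rewrite -fE homeo_funK.
Qed.

Definition thompsonV : subgroup (homeo cantor_space) :=
  Subgroup thompsonV_subgroup.

End ThompsonV.

Section UnitaryGroup.
Variables (R : realType) (k : nat).

Record unitary_group := Unitary {
  unitary_mx :> 'M[R[i]]_k;
  unitary_mxP : unitary_mx \is unitarymx
}.

HB.instance Definition _ := [isSub for unitary_mx].
HB.instance Definition _ := [Choice of unitary_group by <:].

Implicit Types u v w : unitary_group.

Fact unitary1_subproof : (1%:M : 'M[R[i]]_k) \is unitarymx.
Proof. by apply/unitarymxP; rewrite mul1mx trmx1 map_mx1. Qed.

Definition unitary_one : unitary_group := Unitary unitary1_subproof.
Definition unitary_mul u v : unitary_group :=
  Unitary (mul_unitarymx (unitary_mxP u) (unitary_mxP v)).
Fact unitaryV_subproof u : map_mx Num.conj (u : 'M[R[i]]_k)^T \is unitarymx.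
Proof. by rewrite trmxC_unitary; exact: unitary_mxP. Qed.
Definition unitary_inv u : unitary_group := Unitary (unitaryV_subproof u).

Fact unitary_mulA : associative unitary_mul.
Proof. by move=> u v w; apply: val_inj; exact: mulmxA. Qed.
Fact unitary_mul1g : left_id unitary_one unitary_mul.
Proof. by move=> u; apply: val_inj; exact: mul1mx. Qed.
Fact unitary_mulg1 : right_id unitary_one unitary_mul.
Proof. by move=> u; apply: val_inj; exact: mulmx1. Qed.
Fact unitary_mulgV : right_inverse unitary_one unitary_inv unitary_mul.
Proof. by move=> u; apply: val_inj; apply/unitarymxP; exact: (unitary_mxP u). Qed.
Fact unitary_mulVg : left_inverse unitary_one unitary_inv unitary_mul.
Proof.
move=> u; apply: val_inj => /=.
have uU := unitary_mxP u.
by rewrite -(invmx_unitary uU) mulVmx// unitarymx_unit.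
Qed.

HB.instance Definition _ := isGroup.Build unitary_group
  unitary_mulA unitary_mul1g unitary_mulg1 unitary_mulVg unitary_mulgV.

End UnitaryGroup.

Section Stability.
Variable R : realType.

Record normed_unitary_group := NormedUnitaryGroup {
  nu_dim : nat;
  nu_norm : 'M[R[i]]_nu_dim -> R;
  nu_norm0_eq0 : forall A, nu_norm A = 0 -> A = 0;
  nu_normZ : forall a A, nu_norm (a *: A) = Normc.normc a * nu_norm A;
  nu_normD : forall A B, nu_norm (A + B) <= nu_norm A + nu_norm B;
  nu_normM : forall A B, nu_norm (A *m B) <= nu_norm A * nu_norm B;
  nu_norm_unitary : forall A (u v : 'M[R[i]]_nu_dim),
    u \is unitarymx -> v \is unitarymx -> nu_norm (u *m A *m v) = nu_norm A
}.

Local Notation U G := (unitary_group R (nu_dim G)).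

(* Both suprema are of nonempty sets which are bounded by twice the norm of the
   identity, so that the real-valued [sup] is the genuine supremum. *)
Definition defect (Gamma : groupType) (G : normed_unitary_group)
    (phi : Gamma -> U G) : R :=
  sup [set r : R | exists g h : Gamma,
    r = nu_norm (unitary_mx (phi (g * h)%g) - phi g *m phi h)].

Definition dist (Gamma : groupType) (G : normed_unitary_group)
    (phi psi : Gamma -> U G) : R :=
  sup [set r : R | exists g : Gamma,
    r = nu_norm (unitary_mx (phi g) - unitary_mx (psi g))].

Definition uniform_asymptotic_hom (family : set normed_unitary_group)
    (Gamma : groupType) (G : nat -> normed_unitary_group)
    (phi : forall n, Gamma -> U (G n)) : Prop :=
  (forall n, family (G n)) /\ (defect (phi n) @[n --> \oo] --> (0 : R)).

Definition bigO_along (omega : set_system nat) (a b : nat -> R) : Prop :=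
  exists2 C : R, 0 <= C &
    exists2 S, omega S & forall n, S n -> a n <= C * b n.

Definition uniformly_stable_linear (omega : set_system nat)
    (family : set normed_unitary_group) (Gamma : groupType) : Prop :=
  forall (G : nat -> normed_unitary_group) (phi : forall n, Gamma -> U (G n)),
    uniform_asymptotic_hom family phi ->
    exists psi : forall n, {multiplicative Gamma -> U (G n)},
      bigO_along omega (fun n => dist (phi n) (psi n)) (fun n => defect (phi n)).

End Stability.

Definition nonprincipal (omega : set_system nat) : Prop :=
  forall n, omega <> principal_filter n.

(* Main.v *)
Require Import Defs.
From mathcomp Require Import all_boot all_order all_algebra.
From mathcomp Require Import all_classical all_reals all_analysis.
From HB Require Import structures.
From mathcomp Require Import spectral complex.
From mathcomp Require Import ring lra zify.

(* Let [l g] be the distance from [phi g] to the identity and [e] the defect of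
   [phi]. Up to multiples of [e], [l] is subadditive and invariant under
   conjugation and inversion, and compactness of U(k) provides, in any sequence
   [g_i], indices [i < j] with [l (g_i^-1 g_j)] at most about [e]. Suppose that the
   positive powers of [t] conjugate the group [P] into its centralizer. Any
   product of commutators of [P] telescopes into [D, t][A, B] with factors in a
   slightly larger group [Q], and [x, y] = [x, [c, y]] as soon as the conjugate of
   [y] by [c] commutes with [x]. If [Q] can be conjugated into [P], then [c] can be chosen
   conjugate to a power [t^(j - i)] with [l (t^(j - i)) = O(e)], so [l = O(e)] on the
   commutator subgroup of [P]. As V and F' are perfect, every element of V is a
   product of boundedly many conjugates of such elements, and every element of F'
   is a conjugate of one. In T, bounded products of conjugates of the image of F'
   exhaust the group. Hence V, F' and T are close to the trivial homomorphism. For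
   F it follows that [phi] is O(e)-close to a map on F/F' = Z^2, which is corrected
   to a homomorphism by averaging over the amenable group Z^2 followed by a
   Newton-Schulz step, iterated as in Kazhdan's theorem. *)

Set Implicit Arguments.
Unset Strict Implicit.
Unset Printing Implicit Defensive.

Import Order.TTheory GRing.Theory Num.Theory.
Import numFieldNormedType.Exports.

Local Open Scope classical_set_scope.
Local Open Scope ring_scope.

(** The difficulty is uniformity: the dimension and the norm vary along the sequence, and the norm
    of the identity is not normalised, so no constant may depend on them. Compactness of U(k) gives
    no uniform bounds, but the pigeonhole argument only selects an exponent, and this exponent never
    enters an estimate. Hence [quasi_length] records recurrence without a bound on the indices,
    while [near_trivial] asks for one constant that serves all quasi-lengths. From there on the work
    for V, F' and T is pure group theory in which bounded products and conjugates may be formed, but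
    not generated subgroups. F itself is out of reach of this method, since its quotient Z^2 has
    nontrivial unitary representations. Perfectness of V comes from transpositions of bricks; that
    of F' comes from self-similarity: a group element and its copies in smaller intervals have the
    same class, and the pentagon relation for [assocF] kills that class. In T, rotations make up for
    slopes at the end points: a copy of F in an arc starting at 0 is rotated away from 0. *)

Section SubgroupSets.
Local Open Scope group_scope.
Variables (G : groupType) (S : set G).
Hypothesis S_sub : is_subgroup S.

Lemma subgroup1 : S 1. Proof. by case: S_sub. Qed.

Lemma subgroupV x : S x -> S x^-1.
Proof. by move=> Sx; rewrite -[x^-1]mul1g; apply: S_sub.2 => //; exact: subgroup1. Qed.

Lemma subgroupM x y : S x -> S y -> S (x * y).
Proof. by move=> Sx Sy; rewrite -[y]invgK; apply: S_sub.2 => //; exact: subgroupV. Qed.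

Lemma subgroupJ x y : S x -> S y -> S (x ^ y).
Proof. by move=> Sx Sy; rewrite conjgE; do !apply: subgroupM => //; exact: subgroupV. Qed.

Lemma subgroupR x y : S x -> S y -> S [~ x, y].
Proof. by move=> Sx Sy; apply: subgroupM; [exact: subgroupV|exact: subgroupJ]. Qed.

End SubgroupSets.

Definition commutators (G : groupType) (P : set G) : set G :=
  [set z | exists x y, [/\ P x, P y & z = [~ x, y]%g]].

Lemma generated_sub (G : groupType) (A : set G) : A `<=` generated A.
Proof. by move=> x Ax S [_]; exact. Qed.

Lemma generated_min (G : groupType) (A S : set G) :
  is_subgroup S -> A `<=` S -> generated A `<=` S.
Proof. by move=> SS AS x; apply. Qed.

Lemma generatedS (G : groupType) (A B : set G) :
  A `<=` B -> generated A `<=` generated B.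
Proof.
move=> AB; apply: generated_min; first exact: generated_subgroup.
by apply: subset_trans AB _; exact: generated_sub.
Qed.

(** * Products of commutators as products of two commutators *)

Section CommutatorWidth.
Local Open Scope group_scope.
Variable G : groupType.
Implicit Types (P Q : set G) (ps : seq (G * G)).

Definition prod_commg ps : G := foldr (fun p x => [~ p.1, p.2] * x) 1 ps.

Lemma prod_commg_cat ps qs : prod_commg (ps ++ qs) = prod_commg ps * prod_commg qs.
Proof. by elim: ps => [|p ps IH]; rewrite /= ?mul1g// IH mulgA. Qed.

Definition in_pairs P ps := {in ps, forall p, P p.1 /\ P p.2}.

Lemma prod_commg_inv P ps : in_pairs P ps ->
  exists2 qs, in_pairs P qs & (prod_commg ps)^-1 = prod_commg qs.
Proof.
elim: ps => [|p ps IH] Pps; first by exists [::]; rewrite /= ?invg1.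
have [|qs Pqs qsE] := IH; first by move=> q qps; apply: Pps; rewrite inE qps orbT.
exists (qs ++ [:: (p.2, p.1)]); last first.
  by rewrite prod_commg_cat -qsE /= invgM invgR mulg1.
move=> q; rewrite mem_cat inE => /orP[/Pqs//|/eqP->].
by have [] := Pps p (mem_head _ _).
Qed.

Lemma generated_commutators P x : generated (commutators P) x ->
  exists2 ps, in_pairs P ps & x = prod_commg ps.
Proof.
move=> /(generated_min (S := [set x | exists2 ps, in_pairs P ps & x = prod_commg ps])).
apply.
  split; first by exists [::].
  move=> _ _ [ps Pps ->] [qs Pqs ->].
  have [rs Prs ->] := prod_commg_inv Pqs.
  exists (ps ++ rs); last by rewrite prod_commg_cat.
  by move=> q; rewrite mem_cat => /orP[/Pps|/Prs].
move=> _ [a [b [Pa Pb ->]]]; exists [:: (a, b)]; rewrite /= ?mulg1//.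
by move=> q; rewrite inE => /eqP->.
Qed.

Lemma commute_conj (x y z : G) : commute x y -> commute (x ^ z) (y ^ z).
Proof. by move=> xy; rewrite /commute -!conjMg xy. Qed.

(* The telescoping trick: spreading the factors of a product of commutators
   over the disjoint translates of [P] by [t] turns it into two commutators. *)
Lemma two_commutators P Q t : is_subgroup P -> is_subgroup Q -> P `<=` Q -> Q t ->
  (forall k x y, P x -> P y -> commute (x ^ (t ^+ k.+1)) y) ->
  forall ps, in_pairs P ps ->
  exists A B D, [/\ Q A, Q B, Q D & prod_commg ps = [~ D, t] * [~ A, B]].
Proof.
move=> PS QS PQ Qt Pt ps Pps.
(* [W] consists of the elements of [Q] that commute with [P] after conjugation by every nonnegative
   power of [t]. It is stable under conjugation by [t], contains the conjugate of [P] by [t], and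
   stores the factors already placed. *)
pose W := [set w | Q w /\ forall k y, P y -> commute (w ^ (t ^+ k)) y].
have WS : is_subgroup W.
  split; first by split; [exact: subgroup1|move=> k y _; rewrite conj1g; exact/commute_sym/commute1].
  move=> x y [Qx Wx] [Qy Wy]; split; first exact: QS.2.
  move=> k z Pz; rewrite conjMg conjVg; apply/commute_sym/commuteM.
    exact/commute_sym/Wx.
  by apply: commuteV; exact/commute_sym/Wy.
have Wt w : W w -> W (w ^ t).
  move=> [Qw Ww]; split; first exact: subgroupJ.
  by move=> k y Py; rewrite -conjgM -expgS; exact: Ww.
have PW p : P p -> W (p ^ t).
  move=> Pp; split; first by apply: subgroupJ => //; exact: PQ.
  by move=> k y Py; rewrite -conjgM -expgS; exact: Pt.
have WP w p : W w -> P p -> commute w p by move=> [_ /(_ 0%N)] + Pp => /(_ _ Pp); rewrite conjg1.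
(* The induction needs the precise shape of [D]: the inverse of the product so far, times an element
   [E] of [W]. *)
suff [A [B [E [WA WB WE xE Px]]]] : exists A B E, [/\ W A, W B, W E,
    prod_commg ps = [~ (prod_commg ps)^-1 * E, t] * [~ A, B] & P (prod_commg ps)].
  exists A, B, ((prod_commg ps)^-1 * E); split=> //; [by case: WA|by case: WB|].
  by apply: subgroupM => //; [apply: subgroupV => //; exact: PQ|case: WE].
elim: ps Pps => [|[a b] ps IH] Pps.
  exists 1, 1, 1; rewrite /= invg1 mulg1 comm1g commg1 mulg1; split=> //;
  exact: subgroup1.
have [/= Pa Pb] := Pps (a, b) (mem_head _ _).
have [|A [B [E [WA WB WE xE Px]]]] := IH.
  by move=> q qps; apply: Pps; rewrite inE qps orbT.
rewrite /=; set c := [~ a, b]; set x := prod_commg ps in xE Px *.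
have Pc : P c by exact: subgroupR.
have Pcx : P (c * x) by exact: subgroupM.
(* The pair [(a, b)] is put in front, where it commutes with [A] and [B]; one conjugation by [t]
   then clears [P] for the next pair. *)
exists ((a * A) ^ t), ((b * B) ^ t), ((x^-1 * E) ^ t); split=> //.
- by rewrite conjMg; apply: subgroupM => //; [exact: PW|exact: Wt].
- by rewrite conjMg; apply: subgroupM => //; [exact: PW|exact: Wt].
- by rewrite conjMg; apply: subgroupM => //; [apply: PW; exact: subgroupV|exact: Wt].
have WD : W ((x^-1 * E) ^ t).
  by rewrite conjMg; apply: subgroupM => //; [apply: PW; exact: subgroupV|exact: Wt].
have -> : [~ (a * A) ^ t, (b * B) ^ t] = (c * [~ A, B]) ^ t.
  rewrite -conjRg; congr (_ ^ t).
  have aA := WP _ _ WA Pa; have aB := WP _ _ WB Pa.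
  have bA := WP _ _ WA Pb; have bB := WP _ _ WB Pb.
  have mE (u v U V : G) : commute U v -> (u * U) * (v * V) = (u * v) * (U * V).
    by move=> Uv; rewrite -!mulgA [U * (v * V)]mulgA Uv !mulgA.
  have RE (u v : G) : [~ u, v] = (v * u)^-1 * (u * v) by rewrite commgEl conjgE invgM !mulgA.
  have /commuteV cBA : commute c (B * A).
    by apply/commute_sym/WP => //; exact: subgroupM.
  by rewrite [LHS]RE [[~ A, B]]RE (mE a b A B)// (mE b a B A)// invgM [RHS]mulgA cBA /c RE !mulgA.
set y := c * x; set F := (x^-1 * E) ^ t.
have yF : commute y F by apply/commute_sym/WP.
have cF : commute c F by apply/commute_sym/WP.
have cE : commute c E by apply/commute_sym/WP.
have xEc : commute (x^-1 * E) x.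
  apply/commute_sym/commuteM; first by apply: commuteV; exact: commute_refl.
  exact/commute_sym/WP.
have : F * [~ A, B] = (x^-1 * E) * x.
  rewrite [X in _ = _ * X]xE commgEl -/F; set D := x^-1 * E.
  by rewrite -(mulgA D^-1) mulVKg.
move=> FAB.
have yE : c * x = y by [].
have FE : (x^-1 * E) ^ t = F by [].
clearbody F y; set C := [~ A, B] in FAB *.
rewrite commgEl -mulgA -conjMg -[y^-1 * F * _]mulgA (mulgA F) -cF -(mulgA c) FAB xEc.
by rewrite (mulgA c) yE mulKg FE invgM invgK -mulgA yF mulKg.
Qed.

(** Since [[~ c, y]] is the inverse of [y ^ c] times [y], and [y ^ c] centralizes [x], conjugating
    [x] by [[~ c, y]] has the same effect as conjugating by [y]. The right-hand side is a product of
    four conjugates of [c] and its inverse, hence small as soon as [c] is. *)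
Lemma commg_displaced (c x y : G) : commute (y ^ c) x -> [~ x, y] = [~ x, [~ c, y]].
Proof.
move=> ycx; rewrite [[~ c, y]]commgEr conjVg !commgEl conjgM.
congr (_ * _ ^ _); apply/esym/conjg_fixP/commgP/commuteV.
exact: commute_sym.
Qed.

End CommutatorWidth.

(** * Quasi-lengths and the sets on which all of them are small *)

Section QuasiLength.
Variable R : realType.

(* The properties of [l x = ||phi x - 1||] for [phi] of defect at most [e] into
   a finite-dimensional unitary group; the last one is a pigeonhole principle. *)
Record quasi_length (G : groupType) (e : R) (l : G -> R) : Prop := QuasiLength {
  qlM : forall x y, l (x * y)%g <= l x + l y + e;
  qlV : forall x, l (x^-1)%g <= l x + 2 * e;
  qlJ : forall x y, l (x ^ y)%g <= l x + 4 * e;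
  ql_recurrent : forall (g : nat -> G) eta, 0 < eta ->
    exists i k, l ((g i)^-1 * g (i + k.+1)%N)%g <= eta + 3 * e
}.

(** [C] is chosen before [e] and [l], which makes it independent of dimension, norm and map. The
    property survives bounded products and conjugation, but not the passage to a generated subgroup;
    this is why products of bounded length matter throughout. *)
Definition near_trivial (G : groupType) (S : set G) : Prop :=
  exists C : R, forall e l, 0 <= e -> quasi_length e l -> forall x : G, S x -> l x <= C * e.

Section NearTrivial.
Variable G : groupType.
Implicit Types S T P Q : set G.

Lemma near_trivialS S T : S `<=` T -> near_trivial T -> near_trivial S.
Proof. by move=> ST [C CT]; exists C => e l e0 ql x /ST; exact: CT. Qed.

Lemma near_trivialM S T U : near_trivial S -> near_trivial T ->
  (forall z, U z -> exists x y, [/\ S x, T y & z = (x * y)%g]) -> near_trivial U.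
Proof.
move=> [C CS] [D DT] UST; exists (C + D + 1) => e l e0 ql z /UST[x [y [Sx Ty ->]]].
have := qlM ql x y; have := CS _ _ e0 ql _ Sx; have := DT _ _ e0 ql _ Ty; lra.
Qed.

Lemma near_trivialJ S U : near_trivial S ->
  (forall z, U z -> exists x y, [/\ S x & z = (x ^ y)%g]) -> near_trivial U.
Proof.
move=> [C CS] US; exists (C + 4) => e l e0 ql z /US[x [y [Sx ->]]].
have := qlJ ql x y; have := CS _ _ e0 ql _ Sx; lra.
Qed.

(** Every element of [Q] is displaced by a conjugate of a power of [t], because [h] brings [Q] into
    [P]. So both commutators from [two_commutators] can be treated with [commg_displaced], each at
    the price of [49 e]; their product costs one more [e], whence [99]. *)
Lemma near_trivial_displaced P Q t h : is_subgroup P -> is_subgroup Q ->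
  P `<=` Q -> Q t ->
  (forall k x y, P x -> P y -> commute (x ^ (t ^+ k.+1)) y)%g ->
  (forall x, Q x -> P (x ^ h)%g) ->
  near_trivial (generated (commutators P)).
Proof.
move=> PS QS PQ Qt Pt Qh; exists 99 => e l e0 ql x /generated_commutators[ps Pps ->].
have [A [B [D [QA QB QD ->]]]] := two_commutators PS QS PQ Qt Pt Pps.
apply/ler_addgt0Pl => eta eta0.
(* The two commutators together contain eight conjugates of the short element or its inverse. *)
have eta8 : 0 < eta / 8 by rewrite divr_gt0.
(* The quotient of two powers of [t] is again a power: recurrence produces a short [t ^+ k.+1], a
   positive power as the hypothesis on [P] demands. *)
have [i [k lc]] := ql_recurrent ql (fun i => t ^+ i)%g eta8.
have comm y z : Q y -> Q z -> l [~ y, z]%g <= eta / 2 + 49 * e.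
  move=> Qy Qz; move: lc; rewrite expgnDr mulKg => lc.
  set c := (t ^+ k.+1 ^ h^-1)%g; have lch := qlJ ql (t ^+ k.+1)%g h^-1%g.
  rewrite (commg_displaced (c := c)); last first.
    have -> : (z ^ c = ((z ^ h) ^ (t ^+ k.+1)) ^ h^-1)%g.
      by rewrite -!conjgM; congr (_ ^ _)%g; rewrite /c conjgE invgK mulgA.
    by rewrite -[y](conjgK h); apply: commute_conj; apply: Pt; exact: Qh.
  have l1 : l [~ c, z]%g <= eta / 4 + 21 * e.
    rewrite commgEl; apply: le_trans (qlM ql _ _) _.
    have := qlV ql c; have := qlJ ql c z; lra.
  set d := [~ c, z]%g in l1 *.
  have -> : [~ y, d]%g = ((d^-1) ^ y * d)%g by rewrite commgEl !conjgE !mulgA.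
  apply: le_trans (qlM ql _ _) _.
  have := qlV ql d; have := qlJ ql (d^-1)%g y; lra.
apply: le_trans (qlM ql _ _) _.
have := comm _ _ QA QB; have := comm _ _ QD Qt; lra.
Qed.

End NearTrivial.

(** A quasi-length on [H] pulls back along [f] to a quasi-length on [G] with the same [e]. *)
Lemma near_trivial_image (G H : groupType) (f : G -> H) (S : set G) :
  {morph f : x y / (x * y)%g} -> near_trivial S -> near_trivial (f @` S).
Proof.
move=> fM [C CS]; exists C => e l e0 ql _ [x Sx <-].
have f1 : f 1%g = 1%g by apply: (@mulgI _ (f 1%g)); rewrite -fM !mulg1.
have fV y : f (y^-1)%g = ((f y)^-1)%g.
  by apply: (@mulgI _ (f y)); rewrite -fM !mulgV.
apply: (CS e (l \o f)) => //; split=> [y z|y|y z|g eta eta0] /=.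
- by rewrite fM; exact: (qlM ql).
- by rewrite fV; exact: (qlV ql).
- by rewrite conjgE !fM fV -conjgE; exact: (qlJ ql).
- by have [i [k]] := ql_recurrent ql (f \o g) eta0; exists i, k; rewrite fM fV.
Qed.

End QuasiLength.

(** * Matrix norms and limits along an ultrafilter *)

Lemma normc_le_ReIm (R : realType) (z : R[i]) :
  Normc.normc z <= `|complex.Re z| + `|complex.Im z|.
Proof.
case: z => a b /=; rewrite -[leRHS]ger0_norm ?addr_ge0// -sqrtr_sqr ler_sqrt ?sqr_ge0//.
rewrite sqrrD !real_normK ?num_real// lerD2r lerDl mulrn_wge0// mulr_ge0.
Qed.

Lemma ReIm_le_normc (R : realType) (z : R[i]) :
  `|complex.Re z| <= Normc.normc z /\ `|complex.Im z| <= Normc.normc z.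
Proof.
case: z => a b /=; rewrite -!sqrtr_sqr; split; rewrite ler_sqrt ?addr_ge0 ?sqr_ge0//.
  by rewrite lerDl sqr_ge0.
by rewrite lerDr sqr_ge0.
Qed.

Lemma normc_real (R : realType) (a : R) : Normc.normc (a%:C)%C = `|a|.
Proof. by rewrite /= expr0n addr0 sqrtr_sqr. Qed.

Section Adjoint.
Variables (R : realType) (k : nat).
Local Notation M := 'M[R[i]]_k.

Definition ctrmx (A : M) : M := map_mx Num.conj A^T.

Lemma ctrmxK A : ctrmx (ctrmx A) = A.
Proof. exact: trmxCK. Qed.

Lemma ctrmxM A B : ctrmx (A *m B) = ctrmx B *m ctrmx A.
Proof. by rewrite /ctrmx trmx_mul map_mxM. Qed.

Lemma ctrmxD A B : ctrmx (A + B) = ctrmx A + ctrmx B.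
Proof. by rewrite /ctrmx linearD /= map_mxD. Qed.

Lemma ctrmxN A : ctrmx (- A) = - ctrmx A.
Proof. by rewrite /ctrmx linearN /= map_mxN. Qed.

Lemma ctrmxB A B : ctrmx (A - B) = ctrmx A - ctrmx B.
Proof. by rewrite ctrmxD ctrmxN. Qed.

Lemma ctrmx1 : ctrmx 1%:M = 1%:M.
Proof. by rewrite /ctrmx trmx1 map_mx1. Qed.

Lemma ctrmxZ (a : R) A : ctrmx ((a%:C)%C *: A) = (a%:C)%C *: ctrmx A.
Proof.
apply/matrixP => i j; rewrite !mxE rmorphM /=; congr (_ * _).
by apply/eqP; rewrite eq_complex /= oppr0 !eqxx.
Qed.

Lemma unitary_ctrmx (u : M) : u \is unitarymx -> u *m ctrmx u = 1%:M.
Proof. by move/unitarymxP. Qed.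

Lemma ctrmx_unitary (u : M) : u \is unitarymx -> ctrmx u *m u = 1%:M.
Proof. by move/unitary_ctrmx/mulmx1C. Qed.

Lemma ctrmx_is_unitary (u : M) : u \is unitarymx -> ctrmx u \is unitarymx.
Proof. by move=> uU; rewrite /ctrmx trmxC_unitary. Qed.

End Adjoint.

Section StarNorm.
Variables (R : realType) (k : nat).
Local Notation M := 'M[R[i]]_k.

(** Adjoint invariance turns left unitary invariance into right invariance ([snUr]). The norm of the
    identity is left arbitrary. *)
Record star_norm (N : M -> R) : Prop := StarNorm {
  sn_eq0 : forall A, N A = 0 -> A = 0;
  snZ : forall a A, N (a *: A) = Normc.normc a * N A;
  snD : forall A B, N (A + B) <= N A + N B;
  snM : forall A B, N (A *m B) <= N A * N B;
  snU : forall u A, u \is unitarymx -> N (u *m A) = N A;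
  snS : forall A, N (ctrmx A) = N A
}.

Variable N : M -> R.
Hypothesis NP : star_norm N.

Lemma sn0 : N 0 = 0.
Proof. by rewrite -(scale0r (0 : M)) (snZ NP) Normc.normc0 mul0r. Qed.

Lemma snN A : N (- A) = N A.
Proof. by rewrite -scaleN1r (snZ NP) normcN Normc.normc1 mul1r. Qed.

Lemma sn_ge0 A : 0 <= N A.
Proof.
have := snD NP A (- A); rewrite subrr sn0 snN -mulr2n -mulr_natl.
by rewrite pmulr_rge0.
Qed.

Lemma snB A B : N (A - B) = N (B - A).
Proof. by rewrite -snN opprB. Qed.

Lemma sn_triangle B A C : N (A - C) <= N (A - B) + N (B - C).
Proof. by rewrite -(subrK B A) -addrA; apply: le_trans (snD NP _ _) _; rewrite addrK. Qed.

Lemma snDB A B : N (A - B) <= N A + N B.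
Proof. by rewrite -[N B]snN; exact: snD. Qed.

Lemma snD_le A B a b : N A <= a -> N B <= b -> N (A + B) <= a + b.
Proof. by move=> Aa Bb; apply: le_trans (snD NP _ _) _; exact: lerD. Qed.

Lemma snB_le A B a b : N A <= a -> N B <= b -> N (A - B) <= a + b.
Proof. by move=> Aa Bb; apply: snD_le => //; rewrite snN. Qed.

Lemma snUr u A : u \is unitarymx -> N (A *m u) = N A.
Proof. by move=> uU; rewrite -(snS NP) ctrmxM (snU NP _ (ctrmx_is_unitary uU)) (snS NP). Qed.

Lemma snZr (a : R) A : N ((a%:C)%C *: A) = `|a| * N A.
Proof. by rewrite (snZ NP) normc_real. Qed.

Lemma sn_sum (I : Type) (r : seq I) (F : I -> M) :
  N (\sum_(i <- r) F i) <= \sum_(i <- r) N (F i).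
Proof.
elim: r => [|i r IH]; first by rewrite !big_nil sn0.
by rewrite !big_cons; apply: le_trans (snD NP _ _) _; rewrite lerD2l.
Qed.

(** The entry times its matrix unit is the compression of [A] by two diagonal matrix units, so
    submultiplicativity applies. The constant depends on the norm, which is harmless: it only serves
    the existence of limits. *)
Lemma sn_entry i j : exists2 c, 0 <= c & forall A : M, Normc.normc (A i j) <= c * N A.
Proof.
have E0 : 0 < N (delta_mx i j).
  rewrite lt_neqAle sn_ge0 andbT eq_sym; apply/eqP => /(sn_eq0 NP)/matrixP/(_ i j).
  by rewrite !mxE !eqxx => /eqP; rewrite oner_eq0.
exists (N (delta_mx i i) * N (delta_mx j j) / N (delta_mx i j)).
  by rewrite divr_ge0 ?mulr_ge0 ?sn_ge0.
move=> A; rewrite mulrAC ler_pdivlMr// -(snZ NP).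
have -> : A i j *: delta_mx i j = delta_mx i i *m A *m delta_mx j j.
  apply/matrixP => a b; rewrite !mxE (bigD1 j)//= big1 ?addr0 => [|c cj]; last first.
    by rewrite [delta_mx j j c b]mxE (negbTE cj) mulr0.
  rewrite !mxE (bigD1 i)//= big1 ?addr0 => [|c ci]; last first.
    by rewrite [delta_mx i i a c]mxE (negbTE ci) andbF mul0r.
  rewrite !mxE !eqxx /= andbT.
  by case: (a == i); case: (b == j); rewrite ?(mulr1, mulr0, mul1r, mul0r).
apply: le_trans (snM NP _ _) _; rewrite [leRHS]mulrAC.
by rewrite ler_wpM2r ?sn_ge0//; exact: (snM NP).
Qed.

End StarNorm.

Section UltraLimit.
Variables (R : realType) (omega : set_system nat).
Hypothesis oU : UltraFilter omega.

Lemma ultra_limit_real (u : nat -> R) B : (forall n, `|u n| <= B) ->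
  exists l, forall e, 0 < e -> omega [set n | `|u n - l| < e].
Proof.
move=> uB.
(* The limit is the supremum of the levels that [u] attains or exceeds on a set of [omega]. *)
pose E := [set x | omega [set n | x <= u n]].
have EB : has_sup E.
  split; first by exists (- B); apply: filterS filterT => n _ /=; have := uB n; rewrite ler_norml => /andP[].
  exists B => x Ex; have /filter_ex[n /= xn] := Ex.
  by apply: le_trans xn _; apply: le_trans (uB n); exact: ler_norm.
exists (sup E) => e e0.
have [x Ex xe] := sup_adherent e0 EB.
have [le|le] := in_ultra_setVsetC [set n | sup E + e <= u n] oU.
  have := ub_le_sup EB.2 le; lra.
apply: filterS (filterI Ex le) => n [/= xn /negP]; rewrite -ltNge => ne.
by rewrite ltr_norml; apply/andP; split; lra.
Qed.

Variables (k : nat).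
Local Notation M := 'M[R[i]]_k.
Variable N : M -> R.
Hypothesis NP : star_norm N.

Definition ulim (u : nat -> M) (L : M) : Prop :=
  forall e, 0 < e -> omega [set n | N (u n - L) < e].

(** Entries are bounded by [sn_entry], hence converge along [omega]; expanding the error in matrix
    units turns entrywise convergence into convergence in norm. *)
Lemma ulim_ex (u : nat -> M) B : (forall n, N (u n) <= B) -> exists L, ulim u L.
Proof.
move=> uB.
have entry i j : exists l : R[i], forall e, 0 < e ->
    omega [set n | Normc.normc (u n i j - l) < e].
  have [c c0 cN] := sn_entry NP i j.
  have ucB n : Normc.normc (u n i j) <= c * B by rewrite (le_trans (cN _))// ler_wpM2l.
  have [a aP] := @ultra_limit_real (fun n => complex.Re (u n i j)) (c * B)
    (fun n => le_trans (ReIm_le_normc _).1 (ucB n)).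
  have [b bP] := @ultra_limit_real (fun n => complex.Im (u n i j)) (c * B)
    (fun n => le_trans (ReIm_le_normc _).2 (ucB n)).
  exists (Complex a b) => e e0.
  have e2 : 0 < e / 2 by rewrite divr_gt0.
  apply: filterS (filterI (aP _ e2) (bP _ e2)) => n [/= ha hb].
  apply: le_lt_trans (normc_le_ReIm _) _.
  by case: (u n i j) ha hb => x y /=; lra.
pose L : M := \matrix_(i, j) sval (cid (entry i j)).
exists L => e e0.
pose S := \sum_i \sum_j N (delta_mx i j : M).
have S0 : 0 <= S by apply: sumr_ge0 => i _; apply: sumr_ge0 => j _; exact: sn_ge0.
have e1 : 0 < e / (S + 1) by rewrite divr_gt0 ?ltr_wpDl.
have : \forall n \near omega, forall p : 'I_k * 'I_k,
    Normc.normc (u n p.1 p.2 - L p.1 p.2) < e / (S + 1).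
  apply: filter_forall => -[i j] /=.
  by have := svalP (cid (entry i j)) _ e1; apply: filterS => n /=; rewrite /L mxE.
apply: filterS => n /= nP.
have : N (u n - L) <= e / (S + 1) * S.
  rewrite [u n - L]matrix_sum_delta /S mulr_sumr.
  apply: le_trans (sn_sum NP _ _) _; apply: ler_sum => i _; rewrite mulr_sumr.
  apply: le_trans (sn_sum NP _ _) _; apply: ler_sum => j _.
  rewrite (snZ NP) ler_wpM2r ?(sn_ge0 NP)//.
  by have /ltW := nP (i, j); rewrite !mxE.
move/le_lt_trans; apply; rewrite mulrAC ltr_pdivrMr ?ltr_wpDl//.
by rewrite ltr_pM2l// ltrDl.
Qed.

Hypothesis onp : nonprincipal omega.

Lemma ultra_cofinite m : omega [set n | (m <= n)%N].
Proof.
have ne (x : nat) : omega (~` [set x]).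
  have [ox|//] := in_ultra_setVsetC [set x] oU.
  case: (onp (n := x)); apply/seteqP; split=> A.
    move=> oA; apply/principal_filterP.
    have oxA : omega ([set x] `&` A) by exact: filterI.
    by have /filter_ex[y [/= <-]] := oxA.
  by move=> /principal_filterP Ax; apply: filterS ox => y ->.
elim: m => [|m IH]; first exact: filterS filterT.
apply: filterS (filterI IH (ne m)) => n /= [mn /eqP nm].
by rewrite ltn_neqAle mn andbT eq_sym.
Qed.

Lemma ulim_cvg0 (u : nat -> R) : u n @[n --> \oo] --> 0 ->
  forall e, 0 < e -> omega [set n | u n < e].
Proof.
move=> /cvgrPdist_lt u0 e /u0[m _ mP]; apply: filterS (ultra_cofinite m) => n /mP /=.
by rewrite sub0r normrN => /(le_lt_trans (ler_norm _)).
Qed.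

(** Two terms close to the same limit are close to each other, and nonprincipality lets the second
    index be taken beyond the first. *)
Lemma ulim_recurrent (u : nat -> M) B e : (forall n, N (u n) <= B) -> 0 < e ->
  exists i j, N (u i - u (i + j.+1)%N) < e.
Proof.
move=> /ulim_ex[L uL] e0.
have e2 : 0 < e / 2 by rewrite divr_gt0.
have /filter_ex[i ui] := uL _ e2.
have ujL : omega ([set n | N (u n - L) < e / 2] `&` [set n | (i < n)%N]).
  by apply: filterI; [exact: uL|exact: ultra_cofinite].
have /filter_ex[j [/= uj ij]] := ujL.
exists i, (j - i.+1)%N; rewrite addnS -addSn subnKC//.
apply: le_lt_trans (sn_triangle NP L _ _) _.
by rewrite /= in ui; rewrite (snB NP L) (splitr e) ltrD.
Qed.

End UltraLimit.

(** * Averaging over Z^2 and correction to a homomorphism *)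

Fact addmx_entry (R : pzRingType) m n (A B : 'M[R]_(m, n)) i j : (A + B) i j = A i j + B i j.
Proof. by rewrite mxE. Qed.
Fact oppmx_entry (R : pzRingType) m n (A : 'M[R]_(m, n)) i j : (- A) i j = - A i j.
Proof. by rewrite mxE. Qed.
(** Noncommutative identities are proved in two stages: [mx_expand] multiplies out, then [mx_abel]
    compares the sums entrywise, the entries of each product being atoms for [ring]. *)
Ltac mx_abel := apply/matrixP => ? ?; rewrite !(addmx_entry, oppmx_entry); ring.
Ltac mx_expand := rewrite !(mulmxDl, mulmxDr, mulmxN, mulNmx, mul1mx, mulmx1, mulmxA).

Section NewtonSchulz.
Variables (R : realType) (k : nat).
Local Notation M := 'M[R[i]]_k.
Variable N : M -> R.
Hypothesis NP : star_norm N.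

(** With [G = 1 - 2h] the linear terms cancel and [3 h^2 + 2 h^3] remains. As [N h] is at most
    [q / 2] and at most [1 / 2], this is bounded by [3/4 + 1/4] times [q ^+ 2]. *)
Lemma newton_schulz_defect (G h : M) q : 1%:M - G = h + h -> N h <= q / 2 -> q <= 1 ->
  N (1%:M - (1%:M + h) *m G *m (1%:M + h)) <= q ^+ 2.
Proof.
move=> hE hq q1; have h0 := sn_ge0 NP h.
have -> : G = 1%:M - (h + h) by rewrite -hE opprB addrC subrK.
have -> : 1%:M - (1%:M + h) *m (1%:M - (h + h)) *m (1%:M + h)
   = (h *m h) + (h *m h) + (h *m h) + (h *m h *m h + h *m h *m h).
  by mx_expand; mx_abel.
have hh : N (h *m h) <= (q / 2) ^+ 2.
  by apply: le_trans (snM NP _ _) _; rewrite -expr2 ler_pXn2r// nnegrE ?divr_ge0//; lra.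
have hhh : N (h *m h *m h) <= (q / 2) ^+ 2 / 2.
  apply: le_trans (snM NP _ _) _; apply: ler_pM => //; first exact: sn_ge0.
  lra.
have := snD NP (h *m h + h *m h + h *m h) (h *m h *m h + h *m h *m h).
have := snD NP (h *m h + h *m h) (h *m h); have := snD NP (h *m h) (h *m h).
have := snD NP (h *m h *m h) (h *m h *m h); lra.
Qed.

End NewtonSchulz.

Section BoxAverage.
Variables (R : realType) (k : nat).
Local Notation M := 'M[R[i]]_k.
Local Notation A := (int * int)%type.
Implicit Types (F G : A -> M) (X : M).

Definition box_sum n F : M :=
  \sum_(0 <= i < n.+1) \sum_(0 <= j < n.+1) F (Posz i, Posz j).

Definition box_avg n F : M := (((n.+1%:R ^+ 2)^-1 : R)%:C)%C *: box_sum n F.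

Lemma box_avgD n F G : box_avg n (fun x => F x + G x) = box_avg n F + box_avg n G.
Proof.
rewrite /box_avg -scalerDr /box_sum -big_split; congr (_ *: _).
by apply: eq_bigr => i _; rewrite -big_split.
Qed.

Lemma box_avg_linear n (f : M -> M) F : {morph f : X Y / X + Y} ->
  (forall (a : R) X, f ((a%:C)%C *: X) = (a%:C)%C *: f X) ->
  box_avg n (f \o F) = f (box_avg n F).
Proof.
move=> fD fZ; have f0 : f 0 = 0 by apply: (@addrI _ (f 0)); rewrite -fD !addr0.
rewrite /box_avg fZ /box_sum (big_morph f fD f0); congr (_ *: _).
by apply: eq_bigr => i _; rewrite (big_morph f fD f0).
Qed.

Lemma box_avg_cst n X : box_avg n (fun=> X) = X.
Proof.
rewrite /box_avg /box_sum !sumr_const_nat !subn0 -mulrnA mulnn.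
rewrite -[X *+ _]scaler_nat scalerA natrX.
set c := (_ * _ : R[i]); suff -> : c = 1 by rewrite scale1r.
have nE : (n.+1%:R ^+ 2 : R[i]) = ((n.+1%:R ^+ 2 : R)%:C)%C.
  by rewrite rmorphXn /= rmorph_nat.
by rewrite /c nE -rmorphM mulVf ?rmorph1// expf_neq0// pnatr_eq0.
Qed.

Variable N : M -> R.
Hypothesis NP : star_norm N.

Lemma box_avg_le n F B : (forall x, N (F x) <= B) -> N (box_avg n F) <= B.
Proof.
move=> FB; rewrite /box_avg (snZr NP) ger0_norm ?invr_ge0 ?exprn_ge0//.
rewrite mulrC ler_pdivrMr ?exprn_gt0//.
apply: le_trans (sn_sum NP _ _) _.
have -> : B * n.+1%:R ^+ 2 = \sum_(0 <= i < n.+1) \sum_(0 <= j < n.+1) B.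
  by rewrite !sumr_const_nat !subn0 -mulrnA mulnn -natrX mulr_natr.
apply: ler_sum => i _; apply: le_trans (sn_sum NP _ _) _; exact: ler_sum.
Qed.

(** The factor [n.+1%:R] in the denominator is the share of the boundary in a square of side
    [n + 1]. With [c] existential, the shifts having this property form a group, so one generator
    and the symmetry of the square suffice. *)
Definition almost_invariant (b : A) := exists c : R, forall n F B,
  (forall x, N (F x) <= B) ->
  N (box_avg n (fun x => F (b + x)) - box_avg n F) <= c * B / n.+1%:R.

Lemma almost_invariantD b b' :
  almost_invariant b -> almost_invariant b' -> almost_invariant (b + b').
Proof.
move=> [c cP] [c' cP']; exists (c + c') => n F B FB.
have h := cP n F B FB.
have h' := cP' n (fun x => F (b + x)) B (fun x => FB _).
rewrite /= in h'; under [X in box_avg n X]eq_fun do rewrite -addrA.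
apply: le_trans (sn_triangle NP (box_avg n (fun x => F (b + x))) _ _) _.
by rewrite mulrDl mulrDl [leRHS]addrC; apply: lerD.
Qed.

Lemma almost_invariantN b : almost_invariant b -> almost_invariant (- b).
Proof.
move=> [c cP]; exists c => n F B FB.
have := cP n (fun x => F (- b + x)) B (fun x => FB _).
by rewrite /= (snB NP); under [X in _ - box_avg n X]eq_fun do rewrite addKr.
Qed.

(** The difference telescopes over the rows: only the row that enters and the row that leaves
    survive, each of [n + 1] terms out of [(n + 1)^2]. Hence the constant [2]. *)
Lemma almost_invariant10 : almost_invariant (1, 0).
Proof.
exists 2 => n F B FB; rewrite /box_avg -scalerBr (snZr NP) ger0_norm ?invr_ge0 ?exprn_ge0//.
rewrite mulrC ler_pdivrMr ?exprn_gt0// expr2 mulrA mulfVK ?pnatr_eq0//.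
rewrite /box_sum -sumrB (telescope_sumr_eq
  (fun i => \sum_(0 <= j < n.+1) F (Posz i, Posz j)))//.
have row i : N (\sum_(0 <= j < n.+1) F (Posz i, Posz j)) <= B * n.+1%:R.
  apply: le_trans (sn_sum NP _ _) _.
  have -> : B * n.+1%:R = \sum_(0 <= j < n.+1) B by rewrite sumr_const_nat subn0 mulr_natr.
  exact: ler_sum.
by apply: le_trans (snDB NP _ _) _; rewrite -mulrA mulr_natl mulr2n lerD.
Qed.

Lemma box_avg_swap n F : box_avg n (fun x => F (x.2, x.1)) = box_avg n F.
Proof. by rewrite /box_avg /box_sum exchange_big. Qed.

Lemma almost_invariant_swap b : almost_invariant b -> almost_invariant (b.2, b.1).
Proof.
move=> [c cP]; exists c => n F B FB.
by have := cP n (fun x => F (x.2, x.1)) B (fun x => FB _); rewrite box_avg_swap -(box_avg_swap n (fun x => F (_ + x))).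
Qed.

Lemma almost_invariant_all b : almost_invariant b.
Proof.
have nat_inv (n : nat) : almost_invariant (Posz n, 0).
  elim: n => [|n IH].
    exists 0 => m F B FB; rewrite !mul0r.
    by under [X in box_avg m X - _]eq_fun do rewrite add0r; rewrite subrr sn0.
  exact: (almost_invariantD almost_invariant10 IH).
have int_inv (m : int) : almost_invariant (m, 0).
  case: m => n; first exact: nat_inv.
  exact: (almost_invariantN (nat_inv n.+1)).
case: b => b1 b2; have -> : (b1, b2) = (b1, 0) + (0, b2) :> A by congr pair; rewrite /= ?addr0 ?add0r.
by apply: almost_invariantD; [|apply: (@almost_invariant_swap (_, _))]; exact: int_inv.
Qed.

End BoxAverage.

Section Mean.
Variables (R : realType) (omega : set_system nat).
Hypothesis oU : UltraFilter omega.
Hypothesis onp : nonprincipal omega.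
Variable k : nat.
Local Notation M := 'M[R[i]]_k.
Local Notation A := (int * int)%type.
Variable N : M -> R.
Hypothesis NP : star_norm N.
Implicit Types (F G : A -> M) (X L : M).

(** An invariant mean built from squares. Written as a relation, it obeys linear rules without any
    boundedness assumption on [F]. *)
Definition is_mean F L := ulim omega N (fun n => box_avg n F) L.

Lemma is_mean_ex F B : (forall x, N (F x) <= B) -> exists L, is_mean F L.
Proof. by move=> FB; apply: (ulim_ex oU NP) => n; exact: box_avg_le. Qed.

Lemma is_mean_le F L B : is_mean F L -> (forall x, N (F x) <= B) -> N L <= B.
Proof.
move=> FL FB; apply/ler_addgt0Pl => e e0.
have /filter_ex[n /= nL] := FL _ e0.
have := box_avg_le NP n FB; have := sn_triangle NP (box_avg n F) L 0.
by rewrite !subr0 (snB NP L); lra.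
Qed.

Lemma is_meanD F G L X : is_mean F L -> is_mean G X -> is_mean (fun x => F x + G x) (L + X).
Proof.
move=> FL GX e e0; have e2 : 0 < e / 2 by rewrite divr_gt0.
apply: filterS (filterI (FL _ e2) (GX _ e2)) => n /= [h1 h2].
rewrite box_avgD opprD addrACA; have := snD NP (box_avg n F - L) (box_avg n G - X); lra.
Qed.

Lemma is_mean_cst X : is_mean (fun=> X) X.
Proof. by move=> e e0; apply: filterS filterT => n _ /=; rewrite box_avg_cst subrr sn0. Qed.

(** Only real scalars have to commute with [f], so that the conjugate-linear adjoint is covered. *)
Lemma is_mean_linear (f : M -> M) c F L : is_mean F L -> {morph f : X Y / X + Y} ->
  (forall (a : R) X, f ((a%:C)%C *: X) = (a%:C)%C *: f X) ->
  (forall X, N (f X) <= c * N X) -> is_mean (fun x => f (F x)) (f L).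
Proof.
move=> FL fD fZ fc e e0.
have c0 : 0 < `|c| + 1 by rewrite ltr_wpDl.
have e1 : 0 < e / (`|c| + 1) by rewrite divr_gt0.
apply: filterS (FL _ e1) => n /= h.
have -> : box_avg n (fun x => f (F x)) = f (box_avg n F) by rewrite -(box_avg_linear n F fD fZ).
have fN X : f (- X) = - f X.
  by apply: (@addrI _ (f X)); rewrite -fD !subrr; apply: (@addrI _ (f 0)); rewrite -fD !addr0.
rewrite -fN -fD; apply: le_lt_trans (fc _) _; rewrite ltr_pdivlMr// mulrC in h.
apply: le_lt_trans h; rewrite ler_wpM2r ?(sn_ge0 NP)//.
by apply: le_trans (ler_norm c) _; rewrite lerDl.
Qed.

Lemma is_meanMl X F L : is_mean F L -> is_mean (fun x => X *m F x) (X *m L).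
Proof.
move=> FL; apply: (@is_mean_linear (fun Y => X *m Y) (N X)) => //.
- by move=> Y Z; rewrite mulmxDr.
- by move=> a Y; rewrite -scalemxAr.
- by move=> Y; exact: (snM NP).
Qed.

Lemma is_meanMr X F L : is_mean F L -> is_mean (fun x => F x *m X) (L *m X).
Proof.
move=> FL; apply: (@is_mean_linear (fun Y => Y *m X) (N X)) => //.
- by move=> Y Z; rewrite mulmxDl.
- by move=> a Y; rewrite -scalemxAl.
- by move=> Y; rewrite mulrC; exact: (snM NP).
Qed.

Lemma is_mean_ctrmx F L : is_mean F L -> is_mean (fun x => ctrmx (F x)) (ctrmx L).
Proof.
move=> FL; apply: (@is_mean_linear (@ctrmx R k) 1) => //; [exact: ctrmxD|exact: ctrmxZ|].
by move=> Y; rewrite mul1r (snS NP).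
Qed.

Lemma is_meanN F L : is_mean F L -> is_mean (fun x => - F x) (- L).
Proof.
move=> FL; apply: (@is_mean_linear (fun X => - X) 1) => //.
- by move=> X Y; rewrite opprD.
- by move=> a X; rewrite scalerN.
- by move=> X; rewrite mul1r snN.
Qed.

Lemma is_mean_shift F B L b : (forall x, N (F x) <= B) -> is_mean F L ->
  is_mean (fun x => F (b + x)) L.
Proof.
move=> FB FL e e0; have [c cP] := almost_invariant_all NP b.
have e2 : 0 < e / 2 by rewrite divr_gt0.
have [m mP] : exists m : nat, 2 * (c * B) / e < m%:R.
  exists (Num.bound `|2 * (c * B) / e|); apply: le_lt_trans (ler_norm _) _; exact: archi_boundP.
have mo : omega [set n | (m <= n)%N] by exact: (ultra_cofinite oU onp).
apply: filterS (filterI (FL _ e2) mo) => n /= [h mn].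
have := sn_triangle NP (box_avg n F) (box_avg n (fun x => F (b + x))) L.
have : c * B / n.+1%:R < e / 2.
  have : 2 * (c * B) / e < n.+1%:R by apply: lt_trans mP _; rewrite ltr_nat.
  by rewrite ltr_pdivrMr// ltr_pdivrMr ?ltr0n//; lra.
move=> cB /le_lt_trans; apply; rewrite [ltRHS]splitr; apply: ltrD => //.
exact: le_lt_trans (cP n F B FB) cB.
Qed.

End Mean.

Section Kazhdan.
Variables (R : realType) (omega : set_system nat).
Hypothesis oU : UltraFilter omega.
Hypothesis onp : nonprincipal omega.
Variable k : nat.
Local Notation M := 'M[R[i]]_k.
Local Notation A := (int * int)%type.
Variable N : M -> R.
Hypothesis NP : star_norm N.
Implicit Types (phi : A -> M) (X Y : M) (d : R).

Let mean := is_mean omega N.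

(** A substitute for the operator norm. A unitary is a multiplier with constant 1, while its norm
    equals that of the identity and may be large; plain submultiplicativity would let this number
    into the constants. *)
Definition multiplier c X := forall Y, N (X *m Y) <= c * N Y /\ N (Y *m X) <= c * N Y.

Lemma multiplier_ctrmx c X : multiplier c X -> multiplier c (ctrmx X).
Proof.
move=> Xc Y; have [h1 h2] := Xc (ctrmx Y); rewrite (snS NP) in h1 h2.
by split; rewrite -(snS NP) ctrmxM ctrmxK.
Qed.

Lemma multiplier_unitary X : X \is unitarymx -> multiplier 1 X.
Proof. by move=> XU Y; rewrite (snU NP)// (snUr NP)// mul1r. Qed.

Lemma multiplier_near c c' X Y : multiplier c X -> N (Y - X) <= c' -> multiplier (c + c') Y.
Proof.
move=> Xc XY Z; have [h1 h2] := Xc Z; rewrite -(subrK X Y) mulrDl; move: (Y - X) XY => D XY.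
split; rewrite ?mulmxDl ?mulmxDr; apply: le_trans (snD NP _ _) _; rewrite [leLHS]addrC; apply: lerD => //.
  by apply: le_trans (snM NP _ _) _; rewrite ler_wpM2r ?(sn_ge0 NP).
by apply: le_trans (snM NP _ _) _; rewrite mulrC ler_wpM2r ?(sn_ge0 NP).
Qed.

(** The unitarity error is kept a factor 500 below [d] because it enters the new error [q] linearly,
    whereas [d] itself enters squared. *)
Record almost_rep phi d : Prop := AlmostRep {
  arM : forall a b, N (phi (a + b) - phi a *m phi b) <= d;
  arU : forall a, N (1%:M - ctrmx (phi a) *m phi a) <= d / 500;
  arU' : forall a, N (1%:M - phi a *m ctrmx (phi a)) <= d / 500
}.

Section Step.
Variables (phi : A -> M) (d : R).
Hypothesis d0 : 0 <= d.
Hypothesis d1 : d <= 1 / 2000.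
Hypothesis phiP : almost_rep phi d.
Hypothesis phi2 : forall a, multiplier 2 (phi a).

(* Averaging [P a x] over [x] makes the failure of multiplicativity quadratic in
   [d], up to the failure of unitarity; a Newton-Schulz step, from [psi] to
   [phi'], then makes the failure of unitarity quadratically small as well. *)
Let P a x := phi (a + x) *m ctrmx (phi x).

Lemma phi2c a : multiplier 2 (ctrmx (phi a)).
Proof. exact: multiplier_ctrmx. Qed.

Lemma P_multiplier a x : multiplier 4 (P a x).
Proof.
move=> X; rewrite /P; split; first rewrite -mulmxA; last rewrite mulmxA.
  have [+ _] := phi2 (a + x) (ctrmx (phi x) *m X); have [+ _] := phi2c x X; have := d0; have := d1; lra.
have [_] := phi2c x (X *m phi (a + x)); have [_] := phi2 (a + x) X; have := d0; have := d1; lra.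
Qed.

Lemma P_mean a : exists L, mean (P a) L.
Proof.
apply: (is_mean_ex oU NP (B := 4 * N 1%:M)) => x.
by have [+ _] := P_multiplier a x 1%:M; rewrite mulmx1.
Qed.

Let psi a := sval (cid (P_mean a)).

Lemma psiP a : mean (P a) (psi a).
Proof. exact: svalP (cid (P_mean a)). Qed.

Lemma psiP_shift a b : mean (fun x => P a (b + x)) (psi a).
Proof.
apply: (is_mean_shift oU onp NP (B := 4 * N 1%:M)) (psiP a) => x.
by have [+ _] := P_multiplier a x 1%:M; rewrite mulmx1.
Qed.

Lemma mean_le F L B : mean F L -> (forall x, N (F x) <= B) -> N L <= B.
Proof. exact: (is_mean_le oU NP). Qed.

Lemma psi_multiplier a : multiplier 4 (psi a).
Proof.
move=> X; split.
  apply: mean_le (is_meanMr oU NP X (psiP a)) _ => x.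
  exact: (P_multiplier a x X).1.
apply: mean_le (is_meanMl oU NP X (psiP a)) _ => x.
exact: (P_multiplier a x X).2.
Qed.

Lemma P_phi a x : N (P a x - phi a) <= 2 * d + 2 * (d / 500).
Proof.
have -> : P a x - phi a = (phi (a + x) - phi a *m phi x) *m ctrmx (phi x)
    - phi a *m (1%:M - phi x *m ctrmx (phi x)).
  by rewrite /P; mx_expand; mx_abel.
apply: (snB_le NP).
  by apply: le_trans (phi2c x _).2 _; rewrite ler_pM2l//; exact: arM phiP a x.
by apply: le_trans (phi2 a _).1 _; rewrite ler_pM2l//; exact: arU' phiP x.
Qed.

Lemma psi_phi a : N (psi a - phi a) <= 2 * d + 2 * (d / 500).
Proof. exact: mean_le (is_meanD oU NP (psiP a) (is_mean_cst oU NP (- phi a))) (P_phi a). Qed.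

Lemma P_psi a x : N (P a x - psi a) <= 5 * d.
Proof.
have := sn_triangle NP (phi a) (P a x) (psi a).
by have := P_phi a x; have := psi_phi a; rewrite [N (psi a - _)](snB NP); have := d0; have := d1; lra.
Qed.

(** The first term is the product of two deviations of [P] from its mean, each at most [5 * d]. In
    the second, [5 = 1 + 4] counts one bare unitarity error and one between two multipliers of
    constant 2. *)
Let q := 25 * d ^+ 2 + 5 * (d / 500).

Lemma mulP_psi X Y : N X <= 5 * d -> N Y <= 5 * d -> N (X *m Y) <= 25 * d ^+ 2.
Proof.
move=> X5 Y5; apply: le_trans (snM NP _ _) _.
have -> : 25 * d ^+ 2 = (5 * d) * (5 * d) by ring.
by apply: ler_pM => //; exact: sn_ge0.
Qed.

Lemma sandwich_le u v X : multiplier 2 u -> multiplier 2 v -> N (u *m X *m v) <= 4 * N X.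
Proof. by move=> u2 v2; have [_] := v2 (u *m X); have [+ _] := u2 X; have := d0; have := d1; lra. Qed.

(** A covariance argument. The mean over [x] of the product of the deviations of [P a (b + x)] and
    [P b x] has vanishing linear terms, by shift invariance, and so compares [psi a *m psi b] with
    the mean of [P a (b + x) *m P b x]. Up to the unitarity of [phi (b + x)], the latter product is
    [P (a + b) x]. *)
Lemma psiM a b : N (psi (a + b) - psi a *m psi b) <= q.
Proof.
have m := is_meanD oU NP (is_meanD oU NP (is_meanD oU NP (psiP (a + b))
  (is_meanN oU NP (is_meanMl oU NP (psi a) (psiP b))))
  (is_meanN oU NP (is_meanMr oU NP (psi b) (psiP_shift a b))))
  (is_mean_cst oU NP (psi a *m psi b)).
have -> : psi (a + b) - psi a *m psi b =
  psi (a + b) - psi a *m psi b - psi a *m psi b + psi a *m psi b by mx_abel.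
apply: mean_le m _ => x.
set G := (X in N X); have -> : G = (P a (b + x) - psi a) *m (P b x - psi b)
  + phi (a + b + x) *m (1%:M - ctrmx (phi (b + x)) *m phi (b + x)) *m ctrmx (phi x).
  by rewrite /G /P addrA; mx_expand; mx_abel.
apply: le_trans (snD NP _ _) _.
have := mulP_psi (P_psi a (b + x)) (P_psi b x).
have := sandwich_le (1%:M - ctrmx (phi (b + x)) *m phi (b + x)) (phi2 (a + b + x)) (phi2c x).
have := arU phiP (b + x); rewrite /q; have := d0; have := d1; lra.
Qed.

(** The same covariance argument with [P a x] and its adjoint, whose product is close to the
    identity up to two unitarity errors. *)
Lemma psiU a : N (1%:M - ctrmx (psi a) *m psi a) <= q.
Proof.
have m := is_meanD oU NP (is_meanD oU NP (is_mean_cst oU NP (1%:M + ctrmx (psi a) *m psi a))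
  (is_meanN oU NP (is_meanMl oU NP (ctrmx (psi a)) (psiP a))))
  (is_meanN oU NP (is_meanMr oU NP (psi a) (is_mean_ctrmx oU NP (psiP a)))).
have -> : 1%:M - ctrmx (psi a) *m psi a =
  1%:M + ctrmx (psi a) *m psi a - ctrmx (psi a) *m psi a - ctrmx (psi a) *m psi a by mx_abel.
apply: mean_le m _ => x.
set G := (X in N X); have -> : G = ctrmx (P a x - psi a) *m (P a x - psi a)
  + ((1%:M - phi x *m ctrmx (phi x))
  + phi x *m (1%:M - ctrmx (phi (a + x)) *m phi (a + x)) *m ctrmx (phi x)).
  by rewrite /G /P ctrmxB !ctrmxM ctrmxK; mx_expand; mx_abel.
apply: le_trans (snD NP _ _) _.
have := P_psi a x; rewrite -(snS NP) => P5.
have := mulP_psi P5 (P_psi a x).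
have := sandwich_le (1%:M - ctrmx (phi (a + x)) *m phi (a + x)) (phi2 x) (phi2c x).
have := snD NP (1%:M - phi x *m ctrmx (phi x))
  (phi x *m (1%:M - ctrmx (phi (a + x)) *m phi (a + x)) *m ctrmx (phi x)).
have := arU phiP (a + x); have := arU' phiP x; rewrite /q; have := d0; have := d1; lra.
Qed.

Lemma psiU' a : N (1%:M - psi a *m ctrmx (psi a)) <= q.
Proof.
have m := is_meanD oU NP (is_meanD oU NP (is_mean_cst oU NP (1%:M + psi a *m ctrmx (psi a)))
  (is_meanN oU NP (is_meanMr oU NP (ctrmx (psi a)) (psiP a))))
  (is_meanN oU NP (is_meanMl oU NP (psi a) (is_mean_ctrmx oU NP (psiP a)))).
have -> : 1%:M - psi a *m ctrmx (psi a) =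
  1%:M + psi a *m ctrmx (psi a) - psi a *m ctrmx (psi a) - psi a *m ctrmx (psi a) by mx_abel.
apply: mean_le m _ => x.
set G := (X in N X); have -> : G = (P a x - psi a) *m ctrmx (P a x - psi a)
  + ((1%:M - phi (a + x) *m ctrmx (phi (a + x)))
  + phi (a + x) *m (1%:M - ctrmx (phi x) *m phi x) *m ctrmx (phi (a + x))).
  by rewrite /G /P ctrmxB !ctrmxM ctrmxK; mx_expand; mx_abel.
apply: le_trans (snD NP _ _) _.
have := P_psi a x; rewrite -(snS NP) => P5.
have := mulP_psi (P_psi a x) P5.
have := sandwich_le (1%:M - ctrmx (phi x) *m phi x) (phi2 (a + x)) (phi2c (a + x)).
have := snD NP (1%:M - phi (a + x) *m ctrmx (phi (a + x)))
  (phi (a + x) *m (1%:M - ctrmx (phi x) *m phi x) *m ctrmx (phi (a + x))).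
have := arU phiP x; have := arU' phiP (a + x); rewrite /q; have := d0; have := d1; lra.
Qed.

(** Since [d <= 1 / 2000], the quadratic term is at most [d / 80], and the linear one equals
    [d / 100]. *)
Lemma q_small : 0 <= q /\ q <= d / 40.
Proof.
have : d ^+ 2 <= d / 2000 by rewrite expr2 ler_wpM2l//; have := d0; have := d1; lra.
have := sqr_ge0 d; rewrite /q; have := d0; have := d1; lra.
Qed.

Let half X : M := ((2^-1 : R)%:C)%C *: X.

Lemma half_add X : X = half X + half X.
Proof.
rewrite -scalerDl -rmorphD /=.
by rewrite (_ : 2^-1 + 2^-1 = 1 :> R) ?scale1r//; have := d0; have := d1; lra.
Qed.

Lemma half_le X : N X <= q -> N (half X) <= q / 2.
Proof. by move=> Xq; rewrite (snZr NP) ger0_norm ?invr_ge0// mulrC ler_wpM2r ?invr_ge0. Qed.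

(** [1%:M + h a] is the first-order approximation to the inverse square root of the Gram matrix of
    [psi a], so [phi'] approximates the unitary factor of the polar decomposition. *)
Let h a := half (1%:M - ctrmx (psi a) *m psi a).
Let h' a := half (1%:M - psi a *m ctrmx (psi a)).
Let phi' a := psi a *m (1%:M + h a).

(** Multiplying [psi a] by its Gram matrix on the right or by the opposite one on the left gives the
    same triple product. Thus one correction improves unitarity on both sides. *)
Lemma phi'E a : phi' a = (1%:M + h' a) *m psi a.
Proof.
rewrite /phi' /h /h' /half mulmxDr mulmxDl mulmx1 mul1mx -scalemxAr -scalemxAl.
by congr (_ + _ *: _); mx_expand.
Qed.

Lemma ctrmx_h a : ctrmx (h a) = h a.
Proof. by rewrite /h /half ctrmxZ ctrmxB ctrmxM ctrmxK ctrmx1. Qed.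

Lemma ctrmx_h' a : ctrmx (h' a) = h' a.
Proof. by rewrite /h' /half ctrmxZ ctrmxB ctrmxM ctrmxK ctrmx1. Qed.

Lemma phi'_psi a : N (phi' a - psi a) <= 2 * q.
Proof.
have -> : phi' a - psi a = psi a *m h a by rewrite /phi' mulmxDr mulmx1 addrAC subrr add0r.
have [+ _] := psi_multiplier a (h a); have := half_le (psiU a); rewrite -/(h a).
by have [q0 _] := q_small; have := d0; have := d1; lra.
Qed.

Lemma step : exists2 f, almost_rep f (d / 2) & forall a, N (f a - phi a) <= 3 * d.
Proof.
have [q0 qd] := q_small.
have q2 : q ^+ 2 <= q / 1000 by rewrite expr2 ler_wpM2l//; have := d0; have := d1; lra.
exists phi'; last first.
  move=> a; have := sn_triangle NP (psi a) (phi' a) (phi a).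
  by have := phi'_psi a; have := psi_phi a; have := d0; have := d1; lra.
split=> [a b|a|a].
- have -> : phi' (a + b) - phi' a *m phi' b = (phi' (a + b) - psi (a + b))
    + (psi (a + b) - psi a *m psi b)
    - (psi a *m (phi' b - psi b) + (phi' a - psi a) *m psi b
       + (phi' a - psi a) *m (phi' b - psi b)).
    by mx_expand; mx_abel.
  have q8 : 8 * q = 4 * (2 * q) by rewrite mulrA -natrM.
  have n3 : N (psi a *m (phi' b - psi b)) <= 8 * q.
    by rewrite q8; apply: le_trans (psi_multiplier a _).1 _; rewrite ler_pM2l//; exact: phi'_psi.
  have n4 : N ((phi' a - psi a) *m psi b) <= 8 * q.
    by rewrite q8; apply: le_trans (psi_multiplier b _).2 _; rewrite ler_pM2l//; exact: phi'_psi.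
  have n5 : N ((phi' a - psi a) *m (phi' b - psi b)) <= 4 * q ^+ 2.
    apply: le_trans (snM NP _ _) _; have -> : 4 * q ^+ 2 = 2 * q * (2 * q) by ring.
    by apply: ler_pM; rewrite ?(sn_ge0 NP)//; exact: phi'_psi.
  (* The terms add up to [19 q + 4 q^2], which is below [d / 2] because [q <= d / 40]. *)
  apply: le_trans (snB_le NP (snD_le NP (phi'_psi (a + b)) (psiM a b)) (snD_le NP (snD_le NP n3 n4) n5)) _.
  by move: q0 qd q2; move: q => q'; lra.
- have := newton_schulz_defect NP (half_add _) (half_le (psiU a)); rewrite -/(h a).
  have -> : ctrmx (phi' a) *m phi' a = (1%:M + h a) *m (ctrmx (psi a) *m psi a) *m (1%:M + h a).
    by rewrite /phi' ctrmxM ctrmxD ctrmx1 ctrmx_h !mulmxA.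
  by move=> H; apply: le_trans (H _) _; move: q0 qd q2; move: q => q'; have := d0; have := d1; lra.
- have := newton_schulz_defect NP (half_add _) (half_le (psiU' a)); rewrite -/(h' a).
  have -> : phi' a *m ctrmx (phi' a) = (1%:M + h' a) *m (psi a *m ctrmx (psi a)) *m (1%:M + h' a).
    by rewrite phi'E ctrmxM ctrmxD ctrmx1 ctrmx_h' !mulmxA.
  by move=> H; apply: le_trans (H _) _; move: q0 qd q2; move: q => q'; have := d0; have := d1; lra.
Qed.

End Step.

(** Iterating [step] halves the error each time and moves the map by three times the current error,
    in total by at most [6 * d]. Multiplicativity and unitarity become exact in the limit along
    [omega]. *)
Lemma almost_rep_stable phi d : 0 <= d -> d <= 1 / 2000 ->
  (forall a, phi a \is unitarymx) ->
  (forall a b, N (phi (a + b) - phi a *m phi b) <= d) ->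
  exists f : A -> M, [/\ forall a, f a \is unitarymx,
    forall a b, f (a + b) = f a *m f b & forall a, N (f a - phi a) <= 6 * d].
Proof.
move=> d0 d1 phiU phiM.
(* The bound on the drift is the sum of [3 * d / 2 ^+ i] over [i < n]. *)
pose good n f := almost_rep f (d / 2 ^+ n) /\ forall a, N (f a - phi a) <= 6 * (d - d / 2 ^+ n).
have dn n : 0 <= d / 2 ^+ n <= d.
  apply/andP; split; first by rewrite divr_ge0 ?exprn_ge0.
  by rewrite ler_pdivrMr ?exprn_gt0// ler_peMr// exprn_ege1// ler1n.
have dS n : d / 2 ^+ n.+1 = d / 2 ^+ n / 2 by rewrite exprS invfM mulrCA mulrC.
have next n f : good n f -> exists f', good n.+1 f'.
  move=> [fR fphi]; have /andP[dn0 dnd] := dn n.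
  have fd1 : d / 2 ^+ n <= 1 / 2000 by exact: le_trans d1.
  (* The drift is at most [6 * d], hence less than 1, so every iterate stays within 1 of the unitary
     [phi a]. *)
  have f2 a : multiplier 2 (f a).
    apply: (@multiplier_near 1 1 (phi a)); first exact: multiplier_unitary.
    apply: le_trans (fphi a) _; have := d1; lra.
  have [f' f'R f'f] := step dn0 fd1 fR f2; exists f'; split; rewrite dS// => a.
  have := sn_triangle NP (f a) (f' a) (phi a); have := f'f a; have := fphi a; lra.
have good0 : good 0%N phi.
  rewrite /good expr0 divr1; split; last by move=> a; rewrite !subrr sn0// mulr0.
  have d500 : 0 <= d / 500 by have := d0; lra.
  by split=> // a; rewrite ?unitary_ctrmx// ?ctrmx_unitary// subrr sn0.
have [F F0] : exists F : nat -> A -> M, forall n, good n (F n).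
  (* [good] depends on the index, so the iteration runs over pairs of an index and a map that is
     good for it. *)
  pose T := {p : nat * (A -> M) | good p.1 p.2}.
  pose nxt (p : T) : T := exist _ ((sval p).1.+1, sval (cid (next _ _ (svalP p))))
    (svalP (cid (next _ _ (svalP p)))).
  pose p0 : T := exist _ (0%N, phi) good0.
  have it n : (sval (iter n nxt p0)).1 = n by elim: n => //= n ->.
  exists (fun n => (sval (iter n nxt p0)).2) => n.
  by have := svalP (iter n nxt p0); rewrite it.
have Fphi n a : N (F n a - phi a) <= 6 * d.
  by apply: le_trans ((F0 n).2 a) _; have /andP[] := dn n; lra.
have Flim a : exists L, ulim omega N (fun n => F n a) L.
  apply: (ulim_ex oU NP (B := N (phi a) + 6 * d)) => n.
  by have := snD NP (F n a - phi a) (phi a); rewrite subrK; have := Fphi n a; lra.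
pose f a := sval (cid (Flim a)).
have fP a : ulim omega N (fun n => F n a) (f a) := svalP (cid (Flim a)).
have fphi a : N (f a - phi a) <= 6 * d.
  apply/ler_addgt0Pl => e e0; have /filter_ex[n /= nL] := fP a _ e0.
  have := sn_triangle NP (F n a) (f a) (phi a); rewrite [N (f a - F n a)](snB NP).
  by have := Fphi n a; lra.
have f2 a : multiplier 2 (f a).
  apply: (@multiplier_near 1 1 (phi a)); first exact: multiplier_unitary.
  apply: le_trans (fphi a) _; have := d1; lra.
have F2 n a : multiplier 2 (F n a).
  apply: (@multiplier_near 1 1 (phi a)); first exact: multiplier_unitary.
  apply: le_trans (Fphi n a) _; have := d1; lra.
have small e : 0 < e -> omega [set n | d / 2 ^+ n < e].
  move=> e0; apply: (ulim_cvg0 oU onp) => //.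
  have : (2^-1 : R) ^+ n @[n --> \oo] --> 0 by apply: cvg_expr; rewrite ger0_norm ?invr_ge0//; lra.
  move=> h2; rewrite -[X in _ --> X](mulr0 d); under eq_fun do rewrite -exprVn.
  by apply: cvgM => //; exact: cvg_cst.
have eq_lim X Y : (forall e, 0 < e -> N (X - Y) <= e) -> X = Y.
  move=> XY; apply/eqP; rewrite -subr_eq0; apply/eqP/(sn_eq0 NP)/eqP.
  rewrite eq_le (sn_ge0 NP) andbT; apply/ler_addgt0Pl => e e0; rewrite addr0; exact: XY.
exists f; split=> // [a|a b].
  apply/unitarymxP; rewrite -/(ctrmx (f a)); apply/esym/eq_lim => e e0.
  have e8 : 0 < e / 8 by rewrite divr_gt0.
  have /filter_ex[n /= [nd nf]] : omega ([set n | d / 2 ^+ n < e / 8] `&` [set n | N (F n a - f a) < e / 8]).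
    by apply: filterI; [exact: small|exact: fP].
  have -> : 1%:M - f a *m ctrmx (f a) = (1%:M - F n a *m ctrmx (F n a))
    + ((F n a - f a) *m ctrmx (F n a) + f a *m ctrmx (F n a - f a)).
    by rewrite ctrmxB; mx_expand; mx_abel.
  have := snD NP (1%:M - F n a *m ctrmx (F n a))
    ((F n a - f a) *m ctrmx (F n a) + f a *m ctrmx (F n a - f a)).
  have := snD NP ((F n a - f a) *m ctrmx (F n a)) (f a *m ctrmx (F n a - f a)).
  have := arU' (F0 n).1 a.
  have [_] := multiplier_ctrmx (F2 n a) (F n a - f a).
  have [+ _] := f2 a (ctrmx (F n a - f a)); rewrite (snS NP).
  have /andP[] := dn n; lra.
apply: eq_lim => e e0.
have e8 : 0 < e / 8 by rewrite divr_gt0.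
have /filter_ex[n /= [[nd nab] [na nb]]] : omega (([set n | d / 2 ^+ n < e / 8]
    `&` [set n | N (F n (a + b) - f (a + b)) < e / 8])
    `&` ([set n | N (F n a - f a) < e / 8] `&` [set n | N (F n b - f b) < e / 8])).
  by do 2?apply: filterI; [exact: small|exact: fP|exact: fP|exact: fP].
have -> : f (a + b) - f a *m f b = (F n (a + b) - F n a *m F n b)
    - (F n (a + b) - f (a + b)) + ((F n a - f a) *m F n b + f a *m (F n b - f b)).
  by mx_expand; mx_abel.
have := snD NP ((F n (a + b) - F n a *m F n b) - (F n (a + b) - f (a + b)))
  ((F n a - f a) *m F n b + f a *m (F n b - f b)).
have := snD NP ((F n a - f a) *m F n b) (f a *m (F n b - f b)).
have := snDB NP (F n (a + b) - F n a *m F n b) (F n (a + b) - f (a + b)).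
have := arM (F0 n).1 a b.
have [_] := F2 n b (F n a - f a).
have [+ _] := f2 a (F n b - f b).
have /andP[] := dn n; lra.
Qed.

End Kazhdan.

(** * From maps of small defect to quasi-lengths *)

Section UnitaryNorm.
Variables (R : realType) (G : normed_unitary_group R).
Local Notation M := 'M[R[i]]_(nu_dim G).
Local Notation U := (unitary_group R (nu_dim G)).

(* Bi-invariance makes the norm invariant under the adjoint on differences of
   unitaries, so there [sym_norm] agrees with [nu_norm]. *)
Definition sym_norm (A : M) : R := Num.max (nu_norm A) (nu_norm (ctrmx A)).

Lemma nu_normU (A u : M) : u \is unitarymx -> nu_norm (u *m A) = nu_norm A.
Proof.
by move=> uU; rewrite -(mulmx1 (u *m A)) (nu_norm_unitary A uU (unitary1_subproof R _)).
Qed.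

Lemma nu_normUr (A u : M) : u \is unitarymx -> nu_norm (A *m u) = nu_norm A.
Proof.
move=> uU; have := nu_norm_unitary A (unitary1_subproof R _) uU.
by rewrite mul1mx.
Qed.

Lemma nu_norm_ge0 (A : M) : 0 <= nu_norm A.
Proof.
have n0 : nu_norm (0 : M) = 0 by rewrite -(scale0r (0 : M)) nu_normZ Normc.normc0 mul0r.
have nN (B : M) : nu_norm (- B) = nu_norm B.
  by rewrite -scaleN1r nu_normZ normcN Normc.normc1 mul1r.
have := nu_normD A (- A); rewrite subrr n0 nN -mulr2n -mulr_natl.
by rewrite pmulr_rge0.
Qed.

Lemma sym_norm_star : star_norm sym_norm.
Proof.
split; rewrite /sym_norm.
- move=> A /eqP A0; apply: nu_norm0_eq0; apply/eqP; rewrite eq_le nu_norm_ge0 andbT.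
  by rewrite -(eqP A0) le_max lexx.
- move=> a A; have -> : ctrmx (a *: A) = Num.conj a *: ctrmx A.
    by apply/matrixP => i j; rewrite !mxE rmorphM.
  rewrite !nu_normZ; have -> : Normc.normc (Num.conj a) = Normc.normc a.
    by case: a => x y /=; rewrite sqrrN.
  rewrite maxr_pMr//; case: a => x y; exact: sqrtr_ge0.
- move=> A B; rewrite ctrmxD ge_max; apply/andP; split;
  by apply: le_trans (nu_normD _ _) _; apply: lerD; rewrite le_max lexx ?orbT.
- move=> A B; rewrite ctrmxM ge_max; apply/andP; split; apply: le_trans (nu_normM _ _) _; last rewrite mulrC;
  by apply: ler_pM; rewrite ?nu_norm_ge0// le_max lexx ?orbT.
- by move=> u A uU; rewrite ctrmxM (nu_normU _ uU) (nu_normUr _ (ctrmx_is_unitary uU)).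
- by move=> A; rewrite ctrmxK maxC.
Qed.

Lemma sym_norm_diff (u v : M) : u \is unitarymx -> v \is unitarymx ->
  sym_norm (u - v) = nu_norm (u - v).
Proof.
move=> uU vU; rewrite /sym_norm; have -> : ctrmx (u - v) = - (ctrmx u *m (u - v) *m ctrmx v).
  rewrite mulmxBr mulmxBl (ctrmx_unitary uU) mul1mx -mulmxA (unitary_ctrmx vU) mulmx1.
  by rewrite opprB ctrmxB.
have nN (B : M) : nu_norm (- B) = nu_norm B.
  by rewrite -scaleN1r nu_normZ normcN Normc.normc1 mul1r.
by rewrite nN (nu_norm_unitary _ (ctrmx_is_unitary uU) (ctrmx_is_unitary vU)) maxxx.
Qed.

Definition unitary_dist (u v : U) : R := nu_norm (unitary_mx u - unitary_mx v).

Lemma unitary_distE (u v : U) : unitary_dist u v = sym_norm (unitary_mx u - unitary_mx v).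
Proof. by rewrite sym_norm_diff//; exact: unitary_mxP. Qed.

Lemma unitary_distC u v : unitary_dist u v = unitary_dist v u.
Proof. by rewrite !unitary_distE (snB sym_norm_star). Qed.

Lemma unitary_dist_ge0 u v : 0 <= unitary_dist u v. Proof. exact: nu_norm_ge0. Qed.

Lemma unitary_dist_triangle v u w : unitary_dist u w <= unitary_dist u v + unitary_dist v w.
Proof. by rewrite !unitary_distE; exact: (sn_triangle sym_norm_star). Qed.

Lemma unitary_distMl w u v : unitary_dist (w * u)%g (w * v)%g = unitary_dist u v.
Proof. by rewrite /unitary_dist /= -mulmxBr nu_normU//; exact: unitary_mxP. Qed.

Lemma unitary_distMr w u v : unitary_dist (u * w)%g (v * w)%g = unitary_dist u v.
Proof. by rewrite /unitary_dist /= -mulmxBl nu_normUr//; exact: unitary_mxP. Qed.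

Lemma unitary_dist_le u v : unitary_dist u v <= nu_norm (1%:M : M) + nu_norm (1%:M : M).
Proof.
have nU (w : U) : nu_norm (unitary_mx w) = nu_norm (1%:M : M).
  by rewrite -[unitary_mx w]mulmx1 nu_normU//; exact: unitary_mxP.
have nN (B : M) : nu_norm (- B) = nu_norm B.
  by rewrite -scaleN1r nu_normZ normcN Normc.normc1 mul1r.
by apply: le_trans (nu_normD _ _) _; rewrite nN !nU.
Qed.

Section Maps.
Variable Gamma : groupType.
Implicit Types phi psi : Gamma -> U.

Lemma defect_ge phi g h : unitary_dist (phi (g * h)%g) (phi g * phi h)%g <= defect phi.
Proof.
apply: ub_le_sup; last by exists g, h.
exists (nu_norm (1%:M : M) + nu_norm (1%:M : M)) => _ [x [y ->]].
exact: (unitary_dist_le (phi (x * y)%g) (phi x * phi y)%g).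
Qed.

Lemma defect_ge0 phi : 0 <= defect phi.
Proof. by apply: le_trans (defect_ge phi 1%g 1%g); exact: unitary_dist_ge0. Qed.

Lemma dist_le phi psi B : (forall g, unitary_dist (phi g) (psi g) <= B) -> dist phi psi <= B.
Proof.
move=> pB; apply: ge_sup => [|_ [g ->]]; last exact: pB.
by exists (unitary_dist (phi 1%g) (psi 1%g)), 1%g.
Qed.

Variables (omega : set_system nat) (oU : UltraFilter omega) (onp : nonprincipal omega).
Variables (phi : Gamma -> U).

Let e := defect phi.
Local Notation D := unitary_dist.

Lemma defect1 : D (phi 1%g) 1%g <= e.
Proof.
have := defect_ge phi 1%g 1%g; rewrite mulg1 unitary_distC.
by rewrite -[X in D _ X <= _](mulg1 (phi 1%g)) unitary_distMl.
Qed.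

Lemma defectV x : D (phi x^-1)%g ((phi x)^-1)%g <= 2 * e.
Proof.
rewrite -(unitary_distMl (phi x)) mulgV.
apply: le_trans (unitary_dist_triangle (phi 1%g) _ _) _.
rewrite mulr_natl mulr2n lerD ?defect1// unitary_distC -(mulgV x); exact: defect_ge.
Qed.

Lemma unitary_dist1M u v : D (u * v)%g 1%g <= D u 1%g + D v 1%g.
Proof.
apply: le_trans (unitary_dist_triangle u _ _) _; rewrite addrC lerD//.
by rewrite -[X in D _ X <= _](mulg1 u) unitary_distMl.
Qed.

Lemma unitary_dist1V u : D u^-1%g 1%g = D u 1%g.
Proof. by rewrite -(unitary_distMl u) mulgV mulg1 unitary_distC. Qed.

(** An inverse costs [2 e] by [defectV] and a product costs [e]: conjugation uses two products and
    one inverse, recurrence one of each. Recurrence itself is applied to matrices under [sym_norm],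
    which agrees with the given norm on differences of unitaries. *)
Lemma defect_quasi_length : quasi_length e (fun g => D (phi g) 1%g).
Proof.
split=> [x y|x|x y|g eta eta0].
- apply: le_trans (unitary_dist_triangle (phi x * phi y)%g _ _) _.
  by rewrite addrC lerD ?unitary_dist1M//; exact: defect_ge.
- apply: le_trans (unitary_dist_triangle ((phi x)^-1)%g _ _) _.
  by rewrite unitary_dist1V addrC lerD2l; exact: defectV.
- have h1 : D (phi (x ^ y)%g) (phi y^-1 * phi (x * y))%g <= e by exact: defect_ge.
  have h2 : D (phi y^-1 * phi (x * y))%g (phi y^-1 * (phi x * phi y))%g <= e.
    by rewrite unitary_distMl; exact: defect_ge.
  have h3 : D (phi y^-1 * (phi x * phi y))%g ((phi y)^-1 * (phi x * phi y))%g <= 2 * e.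
    by rewrite unitary_distMr; exact: defectV.
  have h4 : D ((phi y)^-1 * (phi x * phi y))%g 1%g = D (phi x) 1%g.
    by rewrite -(unitary_distMl (phi y)) mulVKg mulg1 -[X in D _ X](mul1g (phi y)) unitary_distMr.
  rewrite -h4.
  apply: le_trans (unitary_dist_triangle (phi y^-1 * phi (x * y))%g _ _) _.
  apply: le_trans (lerD h1 (unitary_dist_triangle (phi y^-1 * (phi x * phi y))%g _ _)) _.
  apply: le_trans (lerD (lexx _) (lerD h2 (unitary_dist_triangle ((phi y)^-1 * (phi x * phi y))%g _ _))) _.
  by move: h3 (D _ 1%g) => + d; lra.
- have gB n : sym_norm (unitary_mx (phi (g n))) <= sym_norm 1%:M.
    by rewrite -[unitary_mx _]mulmx1 (snU sym_norm_star)//; exact: unitary_mxP.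
  have [i [j ij]] := ulim_recurrent oU sym_norm_star onp gB eta0.
  exists i, j; move/ltW: ij; rewrite -unitary_distE => ij.
  have h1 : D (phi ((g i)^-1 * g (i + j.+1)%N)%g) (phi (g i)^-1 * phi (g (i + j.+1)%N))%g <= e.
    exact: defect_ge.
  have h2 : D (phi (g i)^-1 * phi (g (i + j.+1)%N))%g ((phi (g i))^-1 * phi (g (i + j.+1)%N))%g <= 2 * e.
    by rewrite unitary_distMr; exact: defectV.
  have h3 : D ((phi (g i))^-1 * phi (g (i + j.+1)%N))%g 1%g <= eta.
    by rewrite -(unitary_distMl (phi (g i))) mulVKg mulg1 unitary_distC.
  apply: le_trans (unitary_dist_triangle (phi (g i)^-1 * phi (g (i + j.+1)%N))%g _ _) _.
  apply: le_trans (lerD h1 (unitary_dist_triangle ((phi (g i))^-1 * phi (g (i + j.+1)%N))%g _ _)) _.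
  by have := lerD h2 h3; lra.
Qed.

End Maps.
End UnitaryNorm.

(** * Stability from near-triviality *)

Section Stability.
Variables (R : realType) (omega : set_system nat).
Hypotheses (oU : UltraFilter omega) (onp : nonprincipal omega).
Variables (family : set (normed_unitary_group R)) (Gamma : groupType).
Local Notation U G := (unitary_group R (nu_dim G)).

Lemma multiplicative_ex (G : normed_unitary_group R) (f : Gamma -> U G) :
  {morph f : x y / (x * y)%g} -> exists f' : {multiplicative Gamma -> U G}, f' =1 f.
Proof.
move=> fM; pose m := isMultiplicative.Build _ _ f fM.
by exists (HB.pack_for {multiplicative Gamma -> U G} f m).
Qed.

(** The trivial homomorphism serves for every [n]. The absolute value is taken because
    [near_trivial] does not make [C] nonnegative. *)
Lemma near_trivial_stable : near_trivial R [set: Gamma] ->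
  uniformly_stable_linear omega family Gamma.
Proof.
move=> [C CP] G phi _.
have one n : exists f : {multiplicative Gamma -> U (G n)}, f =1 (fun=> 1%g).
  by apply: multiplicative_ex => x y; rewrite mulg1.
exists (fun n => sval (cid (one n))); exists `|C| => //; exists setT; first exact: filterT.
move=> n _; apply: dist_le => g; rewrite (svalP (cid (one n))).
apply: (@le_trans _ _ (C * defect (phi n))); last by rewrite ler_wpM2r ?defect_ge0// ler_norm.
by apply: (CP _ _ (defect_ge0 _) (defect_quasi_length oU onp (phi n))).
Qed.

(** On a fibre of [sigma] the map varies by at most [1 + C] times the defect: one product, and one
    element of [K]. Composing with a section of [sigma] therefore gives an almost representation of
    Z^2 with error [2 + C] times the defect, to which [almost_rep_stable] applies. *)
Lemma abelianization_stable (K : set Gamma) (sigma : Gamma -> int * int) :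
  near_trivial R K -> (forall x y, sigma (x * y)%g = sigma x + sigma y) ->
  (forall a, exists x, sigma x = a) -> (forall x, sigma x = 0 -> K x) ->
  uniformly_stable_linear omega family Gamma.
Proof.
move=> [C0 C0P] sM sS sK G phi [_ phi0].
pose C := `|C0|.
have CP n x : K x -> unitary_dist (phi n x) 1%g <= C * defect (phi n).
  move=> Kx; apply: le_trans (C0P _ _ (defect_ge0 _) (defect_quasi_length oU onp (phi n)) _ Kx) _.
  by rewrite ler_wpM2r ?defect_ge0// ler_norm.
pose sec a := sval (cid (sS a)).
have secK a : sigma (sec a) = a := svalP (cid (sS a)).
have s1 : sigma 1%g = 0 by apply: (@addrI _ (sigma 1%g)); rewrite -sM mulg1 addr0.
have sV x : sigma x^-1%g = - sigma x.
  by apply: (@addrI _ (sigma x)); rewrite -sM mulgV s1 subrr.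
have near n x y : sigma x = sigma y -> unitary_dist (phi n x) (phi n y) <= (1 + C) * defect (phi n).
  move=> xy; have Kxy : K (y^-1 * x)%g by apply: sK; rewrite sM sV xy addNr.
  have := defect_ge (phi n) y (y^-1 * x)%g; rewrite mulVKg => h1.
  have h2 := CP n _ Kxy; rewrite -(unitary_distMl (phi n y)) mulg1 in h2.
  apply: le_trans (unitary_dist_triangle (phi n y * phi n (y^-1 * x))%g _ _) _.
  by rewrite mulrDl mul1r; apply: lerD.
have C0' : 0 <= C by exact: normr_ge0.
have ex n : exists f : {multiplicative Gamma -> U (G n)},
    (2 + C) * defect (phi n) <= 1 / 2000 ->
    forall g, unitary_dist (phi n g) (f g) <= (1 + C + 6 * (2 + C)) * defect (phi n).
  (* Where the defect is too large for [almost_rep_stable], any homomorphism will do: since the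
     defects tend to 0, those [n] lie outside a set of [omega]. *)
  have [le|nle] := pselect ((2 + C) * defect (phi n) <= 1 / 2000); last first.
    have [f _] := @multiplicative_ex (G n) (fun=> 1%g) (fun _ _ => esym (mulg1 _)).
    by exists f => /nle.
  have d0 : 0 <= (2 + C) * defect (phi n) by rewrite mulr_ge0 ?addr_ge0 ?defect_ge0.
  have secM a b : sym_norm (unitary_mx (phi n (sec (a + b)))
      - unitary_mx (phi n (sec a)) *m unitary_mx (phi n (sec b))) <= (2 + C) * defect (phi n).
    rewrite -(unitary_distE (phi n (sec (a + b))) (phi n (sec a) * phi n (sec b))%g).
    apply: le_trans (unitary_dist_triangle (phi n (sec a * sec b)%g) _ _) _.
    have -> : 2 + C = (1 + C) + 1 by ring.
    rewrite [X in _ <= X]mulrDl mul1r; apply: lerD; last exact: defect_ge.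
    by apply: near; rewrite sM !secK.
  have [f [fU fM fphi]] := almost_rep_stable oU onp (@sym_norm_star _ (G n))
    d0 le (fun a => unitary_mxP (phi n (sec a))) secM.
  pose F a : U (G n) := Unitary (fU a).
  have FM : {morph (fun x => F (sigma x)) : x y / (x * y)%g}.
    by move=> x y; apply: val_inj; rewrite /= sM fM.
  have [g gE] := multiplicative_ex FM.
  exists g => _ x; rewrite gE.
  apply: le_trans (unitary_dist_triangle (phi n (sec (sigma x))) _ _) _.
  rewrite [X in _ <= X]mulrDl; apply: lerD; first by apply: near; rewrite secK.
  by rewrite -mulrA unitary_distE (snB (@sym_norm_star _ _)); exact: fphi.
exists (fun n => sval (cid (ex n))).
exists (1 + C + 6 * (2 + C)); first by rewrite !addr_ge0// mulr_ge0// addr_ge0.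
exists [set n | (2 + C) * defect (phi n) <= 1 / 2000].
  have C2 : 0 < 2 + C by rewrite ltr_wpDr.
  have t1 : 0 < 1 / 2000 :> R by lra.
  have t0 : 0 < 1 / 2000 / (2 + C) := divr_gt0 t1 C2.
  apply: filterS (ulim_cvg0 oU onp phi0 t0) => n.
  rewrite /mkset ltr_pdivlMr; last exact: C2.
  by rewrite mulrC; exact: ltW.
by move=> n /= le; apply: dist_le => g; exact: (svalP (cid (ex n))).
Qed.

End Stability.

Local Close Scope ring_scope.
Local Open Scope group_scope.

(** * Words, bricks and the action of V on Cantor space *)

Section CantorWords.
Local Notation W := (seq bool).
Implicit Types (x y : cantor_space) (u v w : W).

Definition cantor_drop n x : cantor_space := fun k => x (n + k)%N.

Definition begins w x : bool := mkseq x (size w) == w.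

Lemma prepend_drop w x : begins w x -> prepend w (cantor_drop (size w) x) = x.
Proof.
move=> /eqP wx; apply/funext => n; rewrite /prepend /cantor_drop.
have [nw|wn] := ltnP n (size w); last by rewrite nth_default// subnKC.
by rewrite -[in LHS]wx nth_mkseq.
Qed.

Lemma cantor_drop_prepend w x : cantor_drop (size w) (prepend w x) = x.
Proof.
apply/funext => n; rewrite /prepend /cantor_drop nth_default ?leq_addr//.
by rewrite addKn.
Qed.

Lemma begins_prepend w x : begins w (prepend w x).
Proof.
apply/eqP/(@eq_from_nth _ false); first by rewrite size_mkseq.
move=> n; rewrite size_mkseq => nw; rewrite nth_mkseq// /prepend.
exact: set_nth_default.
Qed.

Lemma beginsP w x : reflect (exists y, x = prepend w y) (begins w x).
Proof.
apply: (iffP idP) => [wx|[y ->]]; last exact: begins_prepend.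
by exists (cantor_drop (size w) x); rewrite prepend_drop.
Qed.

Lemma prepend_inj w : injective (prepend w).
Proof. exact: can_inj (cantor_drop_prepend w). Qed.

Lemma prepend_nil x : prepend [::] x = x.
Proof. by apply/funext => n; rewrite /prepend nth_nil subn0. Qed.

Lemma prepend_rcons u b x : prepend (rcons u b) x = prepend u (prepend [:: b] x).
Proof. by rewrite -cats1 prepend_cat. Qed.

Lemma cantor_split u x : exists b y, prepend u x = prepend (rcons u b) y.
Proof.
exists (x 0%N), (cantor_drop 1 x); rewrite prepend_rcons; congr prepend.
by apply/esym/(@prepend_drop [:: x 0%N]); rewrite /begins.
Qed.

Definition incomp u v := forall x y, prepend u x <> prepend v y.

Lemma incompC u v : incomp u v -> incomp v u.
Proof. by move=> uv x y e; exact: (uv y x). Qed.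

Lemma incomp_catl u v w : incomp u v -> incomp (u ++ w) v.
Proof. by move=> uv x y; rewrite prepend_cat; exact: uv. Qed.

Lemma incomp_catr u v w : incomp u v -> incomp u (v ++ w).
Proof. by move=> /incompC vu; apply: incompC; exact: incomp_catl. Qed.

Lemma incomp_nth n u v : (n < size u)%N -> (n < size v)%N ->
  nth false u n != nth false v n -> incomp u v.
Proof.
move=> nu nv /eqP uv x y /(congr1 (fun f : nat -> bool => f n)).
by rewrite /prepend (set_nth_default false)// [RHS](set_nth_default false).
Qed.

(** The criterion of [thompsonV_setP], for maps not yet known to be homeomorphisms. *)
Definition local (p : cantor_space -> cantor_space) :=
  exists N, forall w, size w = N -> exists t, forall x, p (prepend w x) = prepend t x.

Lemma cantor_nbhs_take x n : nbhs x [set y | mkseq y n = mkseq x n].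
Proof.
elim: n => [|n IH]; first exact: filterS filterT.
have xn : nbhs x [set y | y n = x n].
  have /(_ [set x n]) := @proj_continuous nat (fun=> bool : topologicalType) n x; apply.
  exact: discrete_set1.
apply: filterS (filterI IH xn) => y [/= h1 h2].
by rewrite /mkseq -addn1 iotaD !map_cat -!/(mkseq _ n) h1 /= h2.
Qed.

Lemma local_continuous p : local p -> continuous p.
Proof.
move=> [N pN] x; apply/cvg_sup => k U [V [[S oS <-]] /= Spx VU].
have [t tE] := pN (mkseq x N) (size_mkseq _ _).
(* After the first [N] letters, [k.+1] more suffice: letter [k] of the output is a letter of [t] or
   the letter [k - size t] of the remaining input. *)
apply: filterS (cantor_nbhs_take x (N + k.+1)) => y /= yx; apply: VU => /=.
suff -> : p y k = p x k by [].
have split z : mkseq z (N + k.+1) = mkseq x (N + k.+1) ->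
    exists z', [/\ z = prepend (mkseq x N) z' & forall i, (i <= k)%N -> z' i = z (N + i)%N].
  move=> zx; exists (cantor_drop N z); split=> //.
  rewrite -[X in cantor_drop X](size_mkseq x N) prepend_drop//.
  rewrite /begins size_mkseq; apply/eqP.
  by move/(congr1 (take N)): zx; rewrite /mkseq -!map_take !take_iota (minn_idPl _) ?leq_addr.
have [y' [yE y'E]] := split y yx; have [x' [xE x'E]] := split x erefl.
have -> : p y = prepend t y' by rewrite yE tE.
have -> : p x = prepend t x' by rewrite [in LHS]xE tE.
rewrite /prepend; have [kt|tk] := ltnP k (size t).
  exact: set_nth_default.
rewrite !nth_default// y'E ?leq_subr// x'E ?leq_subr//.
move/(congr1 (fun s => nth false s (N + (k - size t)))): yx.
by rewrite !nth_mkseq ?ltn_add2l ?ltnS ?leq_subr.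
Qed.

End CantorWords.

Local Notation thompsonV_type := (subgroup_type thompsonV).

Section ThompsonVAction.
Local Notation VT := thompsonV_type.
Implicit Types (f g h s : VT) (x y : cantor_space) (u v w : seq bool).

Definition actV f x : cantor_space := homeo_fun (val f) x.

Lemma actV1 x : actV 1 x = x. Proof. by []. Qed.
Lemma actVM f g x : actV (f * g) x = actV f (actV g x). Proof. by []. Qed.
Lemma actVK f x : actV f^-1 (actV f x) = x.
Proof. by rewrite -actVM mulVg. Qed.
Lemma actVKV f x : actV f (actV f^-1 x) = x.
Proof. by rewrite -actVM mulgV. Qed.

Lemma actV_inj f : injective (actV f).
Proof. exact: can_inj (actVK f). Qed.

Lemma actV_ext f g : actV f =1 actV g -> f = g.
Proof. by move=> fg; apply: val_inj; apply: homeo_eq. Qed.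

Lemma actV_local f : local (actV f).
Proof. by have /thompsonV_setP := set_valP f. Qed.

Lemma thompsonV_build (p q : cantor_space -> cantor_space) :
  cancel p q -> cancel q p -> local p -> local q -> exists f, actV f =1 p.
Proof.
move=> pK qK lp lq.
pose h := Homeo pK qK (local_continuous lp) (local_continuous lq).
have hV : h \in (thompsonV : set _) by rewrite inE; apply/thompsonV_setP.
by exists (exist _ h hV).
Qed.

Lemma actV_begins f x n : exists2 m, (n <= m)%N &
  exists t, forall y, actV f (prepend (mkseq x m) y) = prepend t y.
Proof.
have [N fN] := actV_local f; exists (maxn N n); first exact: leq_maxr.
have [t tE] := fN (mkseq x N) (size_mkseq _ _).
exists (t ++ mkseq (cantor_drop N x) (maxn N n - N)) => y.
rewrite prepend_cat -tE -prepend_cat; congr (actV f (prepend _ y)).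
rewrite -[maxn N n in LHS](subnKC (leq_maxl N n)) /mkseq iotaD map_cat add0n; congr cat.
by move: (_ - _)%N => k; rewrite -[N in LHS]addn0 iotaDl -map_comp.
Qed.

Definition is_swap u v s := [/\ forall x, actV s (prepend u x) = prepend v x,
  forall x, actV s (prepend v x) = prepend u x &
  forall x, ~~ begins u x -> ~~ begins v x -> actV s x = x].

Lemma begins_incomp u v x : incomp u v -> ~~ begins u (prepend v x).
Proof. by move=> uv; apply/beginsP => -[y /esym]; exact: uv. Qed.

Lemma begins_take u w x : (size u <= size w)%N -> begins u (prepend w x) = (take (size u) w == u).
Proof.
move=> uw; apply/beginsP/eqP => [[y] /esym/(prepend_take uw)/esym//|<-].
by exists (prepend (drop (size u) w) x); rewrite -prepend_cat cat_take_drop.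
Qed.

Lemma swap_ex u v : incomp u v -> exists s, is_swap u v s.
Proof.
move=> uv; have vu := incompC uv.
pose p x := if begins u x then prepend v (cantor_drop (size u) x)
  else if begins v x then prepend u (cantor_drop (size v) x) else x.
have pu x : p (prepend u x) = prepend v x.
  by rewrite /p begins_prepend cantor_drop_prepend.
have pv x : p (prepend v x) = prepend u x.
  by rewrite /p begins_prepend cantor_drop_prepend (negbTE (begins_incomp _ uv)).
have pn x : ~~ begins u x -> ~~ begins v x -> p x = x.
  by rewrite /p => /negbTE -> /negbTE ->.
have pK : cancel p p.
  move=> x; have [/beginsP[y ->]|ux] := boolP (begins u x); first by rewrite pu pv.
  have [/beginsP[y ->]|vx] := boolP (begins v x); first by rewrite pv pu.
  by rewrite !pn.
have lp : local p.
  exists (size u + size v)%N => w wE.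
  have uw : (size u <= size w)%N by rewrite wE leq_addr.
  have vw : (size v <= size w)%N by rewrite wE leq_addl.
  have [uE|un] := eqVneq (take (size u) w) u.
    exists (v ++ drop (size u) w) => x.
    by rewrite -[w in LHS](cat_take_drop (size u)) uE !prepend_cat pu.
  have [vE|vn] := eqVneq (take (size v) w) v.
    exists (u ++ drop (size v) w) => x.
    by rewrite -[w in LHS](cat_take_drop (size v)) vE !prepend_cat pv.
  by exists w => x; rewrite pn// begins_take.
have [s sE] := thompsonV_build pK pK lp lp.
by exists s; split=> x; rewrite sE//; exact: pn.
Qed.

Lemma swapV u v s : is_swap u v s -> s^-1 = s.
Proof.
move=> [su sv sn]; suff ss : s * s = 1 by rewrite -[s in RHS](mulKg s) ss mulg1.
apply: actV_ext => x; rewrite actVM actV1.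
have [/beginsP[y ->]|ux] := boolP (begins u x); first by rewrite su sv.
have [/beginsP[y ->]|vx] := boolP (begins v x); first by rewrite sv su.
by rewrite !sn.
Qed.

Lemma insert_ex w f : exists g, (forall x, actV g (prepend w x) = prepend w (actV f x)) /\
  forall x, ~~ begins w x -> actV g x = x.
Proof.
pose p h x := if begins w x then prepend w (actV h (cantor_drop (size w) x)) else x.
have pw h x : p h (prepend w x) = prepend w (actV h x).
  by rewrite /p begins_prepend cantor_drop_prepend.
have pn h x : ~~ begins w x -> p h x = x by rewrite /p => /negbTE ->.
have pK h h' : cancel (actV h) (actV h') -> cancel (p h) (p h').
  move=> hK x; have [/beginsP[y ->]|wx] := boolP (begins w x); first by rewrite !pw hK.
  by rewrite !pn.
have lp h : local (p h).
  have [N hN] := actV_local h; exists (size w + N)%N => v vE.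
  have wv : (size w <= size v)%N by rewrite vE leq_addr.
  have [wE|wn] := eqVneq (take (size w) v) w; last first.
    by exists v => x; rewrite pn// begins_take.
  have [|t tE] := hN (drop (size w) v); first by rewrite size_drop vE addKn.
  exists (w ++ t) => x.
  by rewrite -[v in LHS](cat_take_drop (size w)) wE !prepend_cat pw tE.
have [g gE] := thompsonV_build (pK _ _ (actVK f)) (pK _ _ (actVKV f)) (lp _) (lp _).
by exists g; split=> x; rewrite gE//; exact: pn.
Qed.

(** An embedding of V onto the elements supported in the brick of [w]; that all of them are reached
    is [supported_insert]. *)
Definition insert w f : VT := sval (cid (insert_ex w f)).

Lemma insertE w f x : actV (insert w f) (prepend w x) = prepend w (actV f x).
Proof. exact: (svalP (cid (insert_ex w f))).1. Qed.

Lemma insert_out w f x : ~~ begins w x -> actV (insert w f) x = x.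
Proof. exact: (svalP (cid (insert_ex w f))).2. Qed.

Lemma insertM w : {morph insert w : f g / f * g}.
Proof.
move=> f g; apply: actV_ext => x; rewrite actVM.
have [/beginsP[y ->]|wx] := boolP (begins w x); first by rewrite !insertE.
by rewrite !insert_out.
Qed.

Definition supported w : set VT := [set f | forall x, ~~ begins w x -> actV f x = x].

Lemma supported_subgroup w : is_subgroup (supported w).
Proof.
split=> [x _//|f g fw gw x wx].
rewrite actVM; suff -> : actV g^-1 x = x by exact: fw.
by apply: (@actV_inj g); rewrite actVKV gw.
Qed.

Lemma supported_stable w f x : supported w f -> begins w x -> begins w (actV f x).
Proof.
move=> fw wx; apply/negPn/negP => wfx; have := fw _ wfx => /actV_inj fx.
by rewrite fx wx in wfx.
Qed.

Lemma supported_insert w f : supported w f -> exists g, f = insert w g.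
Proof.
move=> fw.
pose p h x := cantor_drop (size w) (actV h (prepend w x)).
have pE h x : supported w h -> actV h (prepend w x) = prepend w (p h x).
  move=> hw; rewrite /p prepend_drop//; apply: supported_stable => //; exact: begins_prepend.
have pK h h' : supported w h -> supported w h' -> cancel (actV h) (actV h') -> cancel (p h) (p h').
  move=> hw h'w hK x; apply: (@prepend_inj w).
  by rewrite -pE// -pE// hK.
have lp h : supported w h -> local (p h).
  move=> hw; have [N hN] := actV_local h; exists N => v vE.
  have [|t tE] := hN (take N (w ++ v)).
    by rewrite size_takel// size_cat vE leq_addl.
  have htE x : actV h (prepend (w ++ v) x) = prepend (t ++ drop N (w ++ v)) x.
    by rewrite -[in LHS](cat_take_drop N (w ++ v)) !prepend_cat tE.
  set t' := t ++ _ in htE.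
  have wt x : begins w (prepend t' x).
    rewrite -htE; apply: supported_stable => //; rewrite prepend_cat; exact: begins_prepend.
  (* If [t'] were shorter than [w], the letter of the image right after [t'] could be chosen freely,
     although [w] prescribes it. *)
  have wt' : (size w <= size t')%N.
    rewrite leqNgt; apply/negP => tw.
    have n0 b : nth false w (size t') = b.
      have /eqP/(congr1 (nth false ^~ (size t'))) := wt (fun=> b).
      by rewrite nth_mkseq// /prepend nth_default.
    by have := n0 true; rewrite (n0 false).
  exists (drop (size w) t') => x; apply: (@prepend_inj w).
  rewrite -pE// -prepend_cat htE -prepend_cat; congr prepend.
  have := wt (fun=> false); rewrite begins_take// => /eqP tw.
  by rewrite -[X in X ++ _]tw cat_take_drop.
have fVw : supported w f^-1 by exact: (subgroupV (supported_subgroup w) fw).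
have [g gE] := thompsonV_build (pK _ _ fw fVw (actVK f)) (pK _ _ fVw fw (actVKV f)) (lp _ fw) (lp _ fVw).
exists g; apply: actV_ext => x.
have [/beginsP[y ->]|wx] := boolP (begins w x); first by rewrite insertE gE pE.
by rewrite insert_out// fw.
Qed.

Lemma commute_supported u v f g : incomp u v -> supported u f -> supported v g -> commute f g.
Proof.
move=> uv fu gv; apply: actV_ext => x; rewrite !actVM.
have [ux|ux] := boolP (begins u x).
  have vx : ~~ begins v x by case/beginsP: ux => y ->; exact/begins_incomp/incompC.
  have vfx : ~~ begins v (actV f x).
    by have /beginsP[y ->] := supported_stable fu ux; exact/begins_incomp/incompC.
  by rewrite (gv x)// (gv (actV f x)).
have [vx|vx] := boolP (begins v x); last by rewrite (gv x)// (fu x)// (gv x).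
have ugx : ~~ begins u (actV g x).
  by have /beginsP[y ->] := supported_stable gv vx; exact/begins_incomp.
by rewrite (fu (actV g x))// (fu x).
Qed.

Lemma supported_conj u v f h : supported u f ->
  (forall x, actV h (prepend u x) = prepend v x) -> supported v (f ^ h^-1).
Proof.
move=> fu hE x vx; rewrite conjgE invgK !actVM fu ?actVKV//.
apply/beginsP => -[y /(congr1 (actV h))]; rewrite actVKV hE => xE.
by rewrite xE begins_prepend in vx.
Qed.

End ThompsonVAction.

(** * V is generated by swaps and is perfect *)

Section SwapsGenerate.
Local Notation VT := thompsonV_type.
Local Notation W := (seq bool).
Implicit Types (f g h s : VT) (x y : cantor_space) (u v w : W).

Definition swaps : set VT := [set s | exists u v, incomp u v /\ is_swap u v s].

Lemma incomp_rcons u v b c : incomp u v -> incomp (rcons u b) (rcons v c).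
Proof. by move=> uv; rewrite -!cats1; apply: incomp_catl; exact: incomp_catr. Qed.

Lemma incomp_rcons2 u : incomp (rcons u false) (rcons u true).
Proof.
apply: (@incomp_nth (size u)); rewrite ?size_rcons//.
by rewrite !nth_rcons ltnn eqxx.
Qed.

Lemma begins_rcons u b x : begins (rcons u b) x -> begins u x.
Proof. by move=> /beginsP[y ->]; rewrite prepend_rcons begins_prepend. Qed.

(** Let [t] swap the first halves of the two bricks, and let [g] exchange the two halves within each
    brick. Then [t ^ g] swaps the second halves, and since [t] is an involution, [s = t * t ^ g =
    [~ t, g]]. *)
Lemma swap_commutator s : swaps s -> commutators [set: VT] s.
Proof.
move=> [u [v [uv [su sv sn]]]].
have vu := incompC uv.
have [t [tu tv tn]] := swap_ex (incomp_rcons (b := false) (c := false) uv).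
have [a [au av an]] := swap_ex (@incomp_rcons2 u).
have [b [bu bv bn]] := swap_ex (@incomp_rcons2 v).
have out u' v' d e x : incomp u' v' -> ~~ begins (rcons u' d) (prepend (rcons v' e) x).
  by move=> uv'; apply: begins_incomp; exact: incomp_rcons.
pose g := a * b.
have gu d x : actV g (prepend (rcons u d) x) = prepend (rcons u (~~ d)) x.
  by rewrite actVM bn ?out//; case: d.
have gv d x : actV g (prepend (rcons v d) x) = prepend (rcons v (~~ d)) x.
  by rewrite actVM; case: d; rewrite ?bu ?bv an ?out.
have gVu d x : actV g^-1 (prepend (rcons u d) x) = prepend (rcons u (~~ d)) x.
  by rewrite -[d in LHS]negbK -gu actVK.
have gVv d x : actV g^-1 (prepend (rcons v d) x) = prepend (rcons v (~~ d)) x.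
  by rewrite -[d in LHS]negbK -gv actVK.
have gn x : ~~ begins u x -> ~~ begins v x -> actV g x = x.
  move=> ux vx; have nb w e : ~~ begins w x -> ~~ begins (rcons w e) x.
    by apply: contra; exact: begins_rcons.
  by rewrite actVM bn ?an ?nb.
have tu1 x : actV t (prepend (rcons u true) x) = prepend (rcons u true) x.
  by apply: tn; [apply/begins_incomp/incomp_rcons2|exact: out].
have tv1 x : actV t (prepend (rcons v true) x) = prepend (rcons v true) x.
  by apply: tn; [exact: out|apply/begins_incomp/incomp_rcons2].
have tV : t^-1 = t by apply: (@swapV (rcons u false) (rcons v false)); split.
clearbody g; exists t, g; split=> //; apply: actV_ext => x; rewrite commgEl conjgE tV !actVM.
have [/beginsP[y ->]|ux] := boolP (begins u x).
  have [d [z ->]] := cantor_split u y; rewrite [in LHS]prepend_rcons su -prepend_rcons gu.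
  by case: d => /=; rewrite ?tu ?tu1 ?gVv ?gVu /= ?tv1 ?tu.
have [/beginsP[y ->]|vx] := boolP (begins v x).
  have [d [z ->]] := cantor_split v y; rewrite [in LHS]prepend_rcons sv -prepend_rcons gv.
  by case: d => /=; rewrite ?tv ?tv1 ?gVu ?gVv /= ?tu1 ?tv.
have nb w e : ~~ begins w x -> ~~ begins (rcons w e) x by apply: contra; exact: begins_rcons.
have gVx : actV g^-1 x = x by apply: (@actV_inj g); rewrite actVKV gn.
by rewrite sn// gn// (tn x) ?nb// gVx tn ?nb.
Qed.

Definition code (C : seq W) : Prop := [/\ uniq C,
  {in C &, forall u v, u != v -> incomp u v} & forall x, exists2 w, w \in C & begins w x].

(** Take a longest word and flip its last letter. The resulting brick meets the brick of some code
    word; were that word shorter, it would also be a proper prefix of the longest word. *)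
Lemma code_sibling C : code C -> (1 < size C)%N ->
  exists u, rcons u false \in C /\ rcons u true \in C.
Proof.
move=> [uC iC cC] C1.
have [m mC mmax] : exists2 m, m \in C & forall w, w \in C -> (size w <= size m)%N.
  have C0 : has predT C by case: (C) C1.
  case: (C) C0 => // c C' _; elim: C' c => [|d C' IH] c.
    by exists c; rewrite ?mem_head// => w; rewrite inE => /eqP->.
  have [m mI mM] := IH d; have [cm|/ltnW mc] := leqP (size c) (size m).
    exists m; first by rewrite in_cons mI orbT.
    by move=> w; rewrite in_cons => /orP[/eqP->//|/mM].
  exists c; rewrite ?mem_head// => w; rewrite in_cons => /orP[/eqP->//|/mM wm].
  exact: leq_trans mc.
have m0 : m != [::].
  apply/eqP => mE; subst m.
  have [w wC wn] : exists2 w, w \in C & w != [::].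
    case: C uC C1 {iC cC mmax mC} => [|a [|b C]]//= /andP[+ _] _.
    rewrite inE negb_or => /andP[ab _]; have [aE|] := eqVneq a [::].
      by exists b; rewrite ?inE ?eqxx ?orbT// -aE eq_sym.
    by exists a; rewrite ?inE ?eqxx.
  have := iC _ _ wC mC wn (fun=> false) (prepend w (fun=> false)).
  by rewrite prepend_nil.
case/lastP: m m0 mC mmax => // u b _ mC mmax.
have [r rC /beginsP[y rE]] := cC (prepend (rcons u (~~ b)) (fun=> false)).
have rsz : (size r <= size (rcons u (~~ b)))%N by have := mmax _ rC; rewrite !size_rcons.
have rT := prepend_take rsz (esym rE).
have rub : r = rcons u (~~ b).
  have [ru|ur] := leqP (size r) (size u).
    have ne : r != rcons u b by apply/eqP => e; rewrite e size_rcons ltnn in ru.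
    have rb : r = take (size r) (rcons u b) by rewrite {1}rT -!cats1 !takel_cat.
    have := iC _ _ rC mC ne (prepend (drop (size r) (rcons u b)) y) y.
    by rewrite -prepend_cat {1}rb cat_take_drop.
  by rewrite rT take_oversize// size_rcons.
rewrite rub in rC.
by exists u; case: b mC rC {rE mmax rsz rT rub} => /= ? ?.
Qed.

(** A tree pair for [f], as a list of source and target words. Only the sources are required to form
    a code; for the targets this follows from [f] being bijective ([table_target]). *)
Definition table f (P : seq (W * W)) : Prop := [/\ uniq P,
  {in P &, forall p q, p != q -> incomp p.1 q.1},
  forall x, exists2 p, p \in P & begins p.1 x &
  forall p, p \in P -> forall x, actV f (prepend p.1 x) = prepend p.2 x].

Lemma table_source f P : table f P -> code [seq p.1 | p <- P].
Proof.
move=> [uP iP cP _]; split.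
- rewrite map_inj_in_uniq// => p q pP qP e; apply/eqP; apply: contraT => pq.
  by have := iP _ _ pP qP pq (fun=> false) (fun=> false); rewrite e.
- move=> _ _ /mapP[p pP ->] /mapP[q qP ->] pq; apply: iP => //.
  by apply: contraNneq pq => ->.
- by move=> x; have [p pP px] := cP x; exists p.1 => //; exact: map_f.
Qed.

Lemma table_target_incomp f P : table f P -> {in P &, forall p q, p != q -> incomp p.2 q.2}.
Proof.
move=> [uP iP cP fP] p q pP qP pq x y; rewrite -fP// -fP// => /actV_inj.
exact: iP.
Qed.

Lemma table_target f P : table f P -> code [seq p.2 | p <- P].
Proof.
move=> T; have iT := table_target_incomp T; have [uP iP cP fP] := T; split.
- rewrite map_inj_in_uniq// => p q pP qP e; apply/eqP; apply: contraT => pq.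
  by have := iT _ _ pP qP pq (fun=> false) (fun=> false); rewrite e.
- move=> _ _ /mapP[p pP ->] /mapP[q qP ->] pq; apply: iT => //.
  by apply: contraNneq pq => ->.
- move=> x; have [p pP /beginsP[y xE]] := cP (actV f^-1 x); exists p.2; first exact: map_f.
  by apply/beginsP; exists y; rewrite -fP// -xE actVKV.
Qed.

Definition swap_word u v w := if w == u then v else if w == v then u else w.

Lemma swap_word_inj u v : injective (swap_word u v).
Proof.
apply: (can_inj (g := swap_word u v)) => w; rewrite /swap_word.
have [->|wu] := eqVneq w u; first by rewrite eqxx; case: eqVneq.
have [->|wv] := eqVneq w v; first by rewrite eqxx.
by rewrite (negbTE wu) (negbTE wv).
Qed.

Lemma table_swap f P u v : table f P -> u \in [seq p.2 | p <- P] -> v \in [seq p.2 | p <- P] ->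
  exists2 g, generated swaps g & table (g * f) [seq (p.1, swap_word u v p.2) | p <- P].
Proof.
move=> T uP vP; have [_ iT _] := table_target T; have [UP iP cP fP] := T.
have injP : injective (fun p : W * W => (p.1, swap_word u v p.2)).
  by move=> [a b] [c d] [-> /swap_word_inj->].
suff [g gS gE] : exists2 g, generated swaps g &
    forall w, w \in [seq p.2 | p <- P] -> forall x, actV g (prepend w x) = prepend (swap_word u v w) x.
  exists g => //; split.
  - by rewrite map_inj_uniq.
  - move=> _ _ /mapP[p pP ->] /mapP[q qP ->] /= pq; apply: iP => //.
    by apply: contraNneq pq => ->.
  - by move=> x; have [p pP px] := cP x; exists (p.1, swap_word u v p.2) => //; exact: map_f.
  - move=> _ /mapP[p pP ->] x /=; rewrite actVM fP// gE//; exact: map_f.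
have [->|uv] := eqVneq u v.
  exists 1; first exact: subgroup1 (generated_subgroup _).
  by move=> w _ x; rewrite /swap_word; case: eqVneq => [->|].
have uvi := iT _ _ uP vP uv.
have [g [gu gv gn]] := swap_ex uvi; exists g.
  by apply: generated_sub; exists u, v.
move=> w wP x; rewrite /swap_word; case: eqVneq => [->//|wu]; case: eqVneq => [->//|wv].
by apply: gn; apply: begins_incomp; apply: iT; rewrite // eq_sym.
Qed.

(** Cancellation of a common caret: two sibling sources sent to sibling targets in the same order
    are replaced by their parents. *)
Lemma table_merge f P u v : table f P ->
  (rcons u false, rcons v false) \in P -> (rcons u true, rcons v true) \in P ->
  table f ((u, v) :: rem (rcons u true, rcons v true) (rem (rcons u false, rcons v false) P)).
Proof.
set p0 := (_, _) => T p0P; set p1 := (_, _) => p1P.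
have [uP iP cP fP] := T.
have p01 : p1 != p0 by apply/eqP => -[/rcons_inj[]].
have memP q : q \in rem p1 (rem p0 P) = [&& q != p1, q != p0 & q \in P].
  by rewrite mem_rem_uniq ?rem_uniq// !inE mem_rem_uniq// !inE.
have iu q : q != p0 -> q != p1 -> q \in P -> incomp u q.1.
  move=> q0 q1 qP x y; have [b [z ->]] := cantor_split u x.
  case: b; [apply: (iP p1)|apply: (iP p0)] => //; by rewrite eq_sym.
split.
- rewrite /= !rem_uniq// andbT memP; apply/and3P => -[e1 e0 uvP].
  have := iu _ e0 e1 uvP (fun=> false) (fun=> false); exact.
- move=> p q; rewrite !inE !memP.
  case/predU1P => [->|/and3P[pp1 pp0 pP]]; case/predU1P => [->|/and3P[qp1 qp0 qP]] pq.
  + by rewrite eqxx in pq.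
  + exact: iu.
  + exact/incompC/iu.
  + exact: iP.
- move=> x; have [p pP px] := cP x.
  have [p0E|pp0] := eqVneq p p0.
    by exists (u, v); rewrite ?mem_head//; rewrite p0E in px; exact: begins_rcons px.
  have [p1E|pp1] := eqVneq p p1.
    by exists (u, v); rewrite ?mem_head//; rewrite p1E in px; exact: begins_rcons px.
  by exists p; rewrite // inE memP pp0 pp1 pP orbT.
- move=> p; rewrite inE memP => /predU1P[->|/and3P[_ _ /fP//]] x /=.
  have [b [z]] := cantor_split u x; rewrite prepend_rcons => /prepend_inj ->.
  rewrite -!prepend_rcons; case: b; [exact: (fP p1)|exact: (fP p0)].
Qed.

(** Induction on the number of bricks. Both sides contain a pair of siblings; two swaps of target
    words make the source pair go to the target pair in order, and merging removes one brick. A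
    single brick must be the whole space, where [f = 1]. *)
Lemma table_generated n f P : size P = n.+1 -> table f P -> generated swaps f.
Proof.
elim: n f P => [|n IH] f P sP T.
  case: P sP T => [|[u v] []]// _ T; suff -> : f = 1 by exact: subgroup1 (generated_subgroup _).
  have nil_of (w : W) : (forall x, begins w x) -> w = [::].
    case: w => // b w /(_ (fun=> ~~ b)) /eqP[]; by case: b.
  have [_ _ cu] := table_source T; have [_ _ cv] := table_target T.
  have uE : u = [::] by apply: nil_of => x; have [w] := cu x; rewrite inE => /eqP->.
  have vE : v = [::] by apply: nil_of => x; have [w] := cv x; rewrite inE => /eqP->.
  have [_ _ _ fP] := T; apply: actV_ext => x.
  by have := fP _ (mem_head _ _) x; rewrite uE vE !prepend_nil.
have s2 (F : W * W -> W) : (1 < size [seq F p | p <- P])%N by rewrite size_map sP.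
have [u [/mapP[a aP aE] /mapP[b bP bE]]] := code_sibling (table_source T) (s2 _).
have [v [v0 v1]] := code_sibling (table_target T) (s2 _).
have ab : a != b by apply/eqP => ab; rewrite -ab -aE in bE; case/rcons_inj: bE.
have [g1 g1S T1] := table_swap T (map_f _ aP) v0.
set P1 := map _ P in T1.
have aP1 : (rcons u false, rcons v false) \in P1.
  by apply/mapP; exists a => //; rewrite /swap_word eqxx aE.
pose b' := swap_word a.2 (rcons v false) b.2.
have bP1 : (rcons u true, b') \in P1 by apply/mapP; exists b => //; rewrite bE.
(* If the first swap displaced [rcons v true], it did so by exchanging it with [rcons v false], so
   it is still a target, of another brick. *)
have v1' : rcons v true \in [seq p.2 | p <- P1].
  have /mapP[p pP pE] := v1.
  have v01 : rcons v true != rcons v false by apply/eqP => /rcons_inj[].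
  have [pa|pa] := eqVneq p.2 a.2.
    have v0a : swap_word a.2 (rcons v false) (rcons v false) = a.2.
      by rewrite /swap_word eqxx; case: eqVneq.
    have /mapP[q qP qE] := v0; apply/mapP.
    exists (q.1, swap_word a.2 (rcons v false) q.2); first exact: map_f.
    by rewrite /= -qE v0a -pa.
  apply/mapP; exists (p.1, swap_word a.2 (rcons v false) p.2); first exact: map_f.
  by rewrite /= /swap_word (negbTE pa) -pE (negbTE v01).
have [g2 g2S T2] := table_swap T1 (map_f _ bP1) v1'.
set P2 := map _ P1 in T2.
have b'v : b' != rcons v false.
  apply/eqP => b'v; have [_ iP1 _ _] := T1; have := table_target_incomp T1 aP1 bP1.
  rewrite b'v /= => /(_ _ (fun=> false) (fun=> false)) H; apply: H => //.
  by apply/eqP => -[] /rcons_inj[].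
have bP2 : (rcons u true, rcons v true) \in P2.
  by apply/mapP; exists (rcons u true, b') => //=; rewrite /swap_word eqxx.
have aP2 : (rcons u false, rcons v false) \in P2.
  apply/mapP; exists (rcons u false, rcons v false) => //=; rewrite /swap_word.
  by rewrite eq_sym (negbTE b'v); case: eqVneq => // /rcons_inj[].
have := IH _ _ _ (table_merge T2 aP2 bP2).
have ba2 : (rcons u true, rcons v true) \in rem (rcons u false, rcons v false) P2.
  have [UP2 _ _ _] := T2; rewrite mem_rem_uniq// !inE bP2 andbT.
  by apply/eqP => -[] /rcons_inj[].
rewrite /= !size_rem// !size_map sP /= => /(_ erefl) gS.
have GS := generated_subgroup swaps.
rewrite -[f](mulKg g1) -[g1 * f](mulKg g2).
apply: (subgroupM GS); first exact: (subgroupV GS g1S).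
by apply: (subgroupM GS) gS; exact: (subgroupV GS g2S).
Qed.

Lemma generated_swaps f : generated swaps f.
Proof.
have [N fN] := actV_local f.
have [t tE] : {t : N.-tuple bool -> W & forall (w : N.-tuple bool) x, actV f (prepend w x) = prepend (t w) x}.
  apply: (@choice _ _ (fun (w : N.-tuple bool) t => forall x, actV f (prepend w x) = prepend t x)).
  by move=> w; apply: fN; rewrite size_tuple.
have inj : injective (fun w : N.-tuple bool => (tval w, t w)) by move=> a b [/val_inj].
pose P := [seq (tval z, t z) | z <- enum {: N.-tuple bool}].
have T : table f P.
  split.
  - by rewrite map_inj_uniq// enum_uniq.
  - move=> _ _ /mapP[p _ ->] /mapP[q _ ->] /= pq x y e; move/negP: pq; apply.
    have -> // : p = q by apply: val_inj; apply: prepend_size_eq e; rewrite !size_tuple.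
  - move=> x; have [y xE] := prepend_mkseq x N.
    have wN : size (mkseq x N) == N by rewrite size_mkseq.
    exists (tval (Tuple wN), t (Tuple wN)); last by rewrite [X in begins _ X]xE begins_prepend.
    by apply: map_f; rewrite mem_enum.
  - by move=> _ /mapP[w _ ->] x; exact: tE.
apply: (@table_generated (size P).-1 _ P) => //.
by rewrite prednK// size_map -cardE card_tuple card_bool expn_gt0.
Qed.

Lemma thompsonV_perfect f : generated (commutators [set: VT]) f.
Proof.
by apply: (generatedS _ (generated_swaps f)) => s; exact: swap_commutator.
Qed.

End SwapsGenerate.

(** * Near-triviality of V *)

Section ThompsonVNearTrivial.
Variable R : realType.
Local Notation VT := thompsonV_type.
Implicit Types (f g h s : VT) (x y : cantor_space) (u v w : seq bool).

Definition fixes w : set VT := [set f | forall x, actV f (prepend w x) = prepend w x].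

Lemma fixes_conj u v f h : fixes u f -> (forall x, actV h (prepend u x) = prepend v x) ->
  fixes v (f ^ h^-1).
Proof.
by move=> fu hE x; rewrite conjgE invgK !actVM -hE actVK fu.
Qed.

Let P := supported [:: false; false; true].
Let Q := supported [:: false].

Lemma supported_cat u w : supported (u ++ w) `<=` supported u.
Proof.
move=> f fuw x ux; apply: fuw; apply: contra ux => /beginsP[y ->].
by rewrite prepend_cat begins_prepend.
Qed.

Lemma swap_supported u v w s : is_swap (w ++ u) (w ++ v) s -> supported w s.
Proof.
move=> [_ _ sn] x wx; have nb z : ~~ begins (w ++ z) x.
  by apply: contra wx => /beginsP[y ->]; rewrite prepend_cat begins_prepend.
exact: sn.
Qed.

(** [t] acts on the brick 0 as a standard generator of F: it maps 000 to 00, 001 to 010 and 01 to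
    011. The images of 001 under its positive powers lie inside the brick 01, each disjoint from
    001. *)
Lemma shift_ex : exists t, Q t /\ forall k x, actV (t ^+ k.+1)
  (prepend [:: false; false; true] x) = prepend ([:: false; true] ++ nseq k true ++ [:: false]) x.
Proof.
have i1 : incomp [:: false; false; false] [:: false; true] by exact: (@incomp_nth 1).
have i2 : incomp [:: false; false] [:: false; true] by exact: (@incomp_nth 1).
have i3 : incomp [:: false; true; false] [:: false; true; true] by exact: (@incomp_nth 2).
have [a aP] := swap_ex i1; have [b bP] := swap_ex i2; have [c cP] := swap_ex i3.
have QS := supported_subgroup [:: false].
have Qa : Q a by apply: (@swap_supported [:: false; false] [:: true]).
have Qb : Q b by apply: (@swap_supported [:: false] [:: true]).
have Qc : Q c by apply: (@swap_supported [:: true; false] [:: true; true]).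
exists (c * (b * a)); split; first by apply: (subgroupM QS Qc); exact: (subgroupM QS Qb).
have [au av an] := aP; have [bu bv bn] := bP; have [cu cv cn] := cP.
have pc u v x : prepend u (prepend v x) = prepend (u ++ v) x by rewrite prepend_cat.
have t0 x : actV (c * (b * a)) (prepend [:: false; false; true] x) =
    prepend [:: false; true; false] x.
  rewrite !actVM an; last 2 first.
  - by apply/begins_incomp; exact: (@incomp_nth 2).
  - by apply/begins_incomp; exact: (@incomp_nth 1).
  by rewrite -(pc [:: false; false] [:: true]) bu pc cv.
have t1 x : actV (c * (b * a)) (prepend [:: false; true] x) =
    prepend [:: false; true] (prepend [:: true] x).
  by rewrite !actVM av -(pc [:: false; false] [:: false]) bu !pc cu.
elim=> [|k IH] x; first by rewrite expg1 t0.
by rewrite expgS actVM IH prepend_cat t1 [RHS]prepend_cat -(prepend_cat [:: true]).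
Qed.

Lemma compress_ex : exists h, forall x, actV h (prepend [:: false] x) =
  prepend [:: false; false; true] x.
Proof.
have i1 : incomp [:: false] [:: true] by exact: (@incomp_nth 0).
have i2 : incomp [:: true] [:: false; false; true] by exact: (@incomp_nth 0).
have [a [a0 _ _]] := swap_ex i1; have [b [b1 _ _]] := swap_ex i2.
by exists (b * a) => x; rewrite actVM a0 b1.
Qed.

(** Transported by [insert], perfectness of V shows that [P] is its own commutator subgroup. The
    displacing elements appear inverted because [x ^ y] is [y^-1 * x * y]. *)
Lemma near_trivial_P : near_trivial R P.
Proof.
have PQ : P `<=` Q by exact: (@supported_cat [:: false]).
have [t [Qt tE]] := shift_ex; have [h hE] := compress_ex.
apply: (@near_trivialS _ _ _ (generated (commutators P))).
  move=> _ /supported_insert[g ->].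
  pose S := [set g | generated (commutators P) (insert [:: false; false; true] g)].
  have GP := generated_subgroup (commutators P).
  have ins1 : insert [:: false; false; true] 1 = 1.
    by apply: (@mulgI _ (insert [:: false; false; true] 1)); rewrite -insertM !mulg1.
  have insV a : insert [:: false; false; true] a^-1 = (insert [:: false; false; true] a)^-1.
    by apply: (@mulgI _ (insert [:: false; false; true] a)); rewrite -insertM !mulgV.
  have SS : is_subgroup S.
    by split=> [|a b Sa Sb]; rewrite /S /= ?ins1 ?insertM ?insV; [exact: GP.1|exact: GP.2].
  apply: (generated_min SS _ (thompsonV_perfect g)) => _ [a [b [_ _ ->]]].
  apply: generated_sub; exists (insert [:: false; false; true] a), (insert [:: false; false; true] b).
  split; [exact: insert_out|exact: insert_out|].
  by rewrite commgEl conjgE !insertM !insV.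
apply: (@near_trivial_displaced _ _ P Q t^-1 h^-1) => //.
- exact: supported_subgroup.
- exact: supported_subgroup.
- by apply: subgroupV Qt; exact: supported_subgroup.
- move=> k a b Pa Pb; rewrite expVgn.
  apply: commute_supported (supported_conj Pa (tE k)) Pb.
  exact: (@incomp_nth 1).
- by move=> a Qa; exact: supported_conj Qa hE.
Qed.

(** Conjugation moves the fixed brick to brick 1, which leaves the support inside brick 0; a second
    conjugation compresses this to 001. *)
Lemma near_trivial_fixes : near_trivial R [set f | exists w, fixes w f].
Proof.
apply: near_trivialJ near_trivial_P _ => f [w fw].
have [h hE] := compress_ex.
have i1 : incomp [:: false] [:: true] by exact: (@incomp_nth 0).
suff [g fg] : exists g, fixes [:: true] (f ^ g).
  exists ((f ^ g) ^ h^-1), (g * h^-1)^-1; rewrite -conjgM conjgK; split=> //.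
  rewrite conjgM; apply: supported_conj hE => x x0.
  have [b [y xE]] := cantor_split [::] x; rewrite prepend_nil in xE; rewrite xE in x0 *.
  by case: b {xE} x0 => [_|/negP[]]; [exact: fg|exact: begins_prepend].
wlog [c [w' wE]] : w fw / exists c w', w = c :: w'.
  move=> H; case: w fw => [|c w'] fw; last by apply: (H _ fw); exists c, w'.
  apply: (H [:: true]); last by exists true, [::].
  by move=> x; have := fw (prepend [:: true] x); rewrite !prepend_nil.
(* A word starting with [true] lies inside brick 1, so no swap takes it there directly; the route
   goes through brick 0. *)
case: c wE => wE.
  have i2 : incomp w [:: false] by rewrite wE; exact: (@incomp_nth 0).
  have [a [a0 _ _]] := swap_ex i2; have [b [b0 _ _]] := swap_ex i1.
  exists (b * a)^-1; apply: fixes_conj fw _ => x; by rewrite actVM a0 b0.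
have i2 : incomp w [:: true] by rewrite wE; exact: (@incomp_nth 0).
have [a [a0 _ _]] := swap_ex i2.
by exists a^-1; exact: fixes_conj fw a0.
Qed.

(** If [f] moves the brick of [w] off itself onto that of [t], let [s] swap only the first halves of
    these two bricks. Then [s] fixes the second half of [w], and [s^-1 * f] fixes the first half. *)
Lemma near_trivial_V : near_trivial R [set: VT].
Proof.
have nf := near_trivial_fixes.
apply: (near_trivialM nf nf) => f _.
have [f1|/existsNP[x fx]] := pselect (forall x, actV f x = x).
  have fE : fixes [::] f by move=> x; exact: f1.
  exists f, 1; split; [by exists [::]|by exists [::]|by rewrite mulg1].
have [n xn] : exists n, actV f x n != x n.
  by apply: contrapT => /forallNP E; apply: fx; apply/funext => n; apply/eqP/negPn/negP; exact: E.
have [N fN] := actV_local f.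
have [m nm [t0 tE0]] := actV_begins f x n.+1.
(* Both words are lengthened beyond position [n], where [x] and its image differ; this makes them
   incomparable. *)
have [t [nt tE]] : exists t, (n < size t)%N /\ exists2 w, (n < size w)%N &
    begins w x /\ forall y, actV f (prepend w y) = prepend t y.
  exists (t0 ++ mkseq (cantor_drop m x) n.+1); split.
    by rewrite size_cat size_mkseq addnS ltnS leq_addl.
  exists (mkseq x m ++ mkseq (cantor_drop m x) n.+1); first by rewrite size_cat !size_mkseq ltn_addr.
  split; last by move=> y; rewrite !prepend_cat tE0.
  apply/beginsP; exists (cantor_drop n.+1 (cantor_drop m x)).
  rewrite prepend_cat -[X in cantor_drop X (cantor_drop m x)](size_mkseq (cantor_drop m x) n.+1).
  rewrite prepend_drop; last by rewrite /begins size_mkseq.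
  rewrite -[X in cantor_drop X x](size_mkseq x m) prepend_drop//.
  by rewrite /begins size_mkseq.
have [w nw [wx wE]] := tE.
have wt : incomp w t.
  apply: (incomp_nth nw nt); have /beginsP[y xE] := wx.
  move: xn; rewrite {1}xE wE xE /prepend.
  by rewrite (set_nth_default false)// [X in _ != X](set_nth_default false)// eq_sym.
have wt0 : incomp (rcons w false) (rcons t false) by exact: incomp_rcons.
have sw1 : incomp (rcons w true) (rcons w false) by apply/incompC/incomp_rcons2.
have [s [sw st sn]] := swap_ex wt0.
exists s, (s^-1 * f); rewrite mulVKg; split=> //.
  exists (rcons w true) => y; apply: sn.
    by apply: begins_incomp; exact: incomp_rcons2.
  by apply: begins_incomp; apply/incomp_rcons/incompC.
exists (rcons w false) => y; rewrite actVM prepend_rcons wE -!prepend_rcons.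
by apply: (@actV_inj s); rewrite actVKV sw.
Qed.

End ThompsonVNearTrivial.

Local Close Scope group_scope.
Local Open Scope ring_scope.

(** * Elements of F as maps of the real line *)

Section IncreasingBijection.
Variables (R : realType) (p q : R -> R).
Hypotheses (pK : cancel p q) (qK : cancel q p).
Hypothesis p_lt : forall x y, x < y -> p x < p y.

Lemma increasing_ltE x y : (p x < p y) = (x < y).
Proof.
apply/idP/idP => [|/p_lt//]; apply: contraTT; rewrite -!leNgt le_eqVlt => /predU1P[->//|/p_lt/ltW//].
Qed.

Lemma increasing_leE x y : (p x <= p y) = (x <= y).
Proof. by rewrite !leNgt increasing_ltE. Qed.

Lemma inverse_lt x y : x < y -> q x < q y.
Proof. by move=> xy; rewrite -increasing_ltE !qK. Qed.

Lemma increasing_continuous : continuous p.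
Proof.
move=> x; apply/cvgrPdist_lt => e e0.
have xlt : q (p x - e) < x < q (p x + e).
  apply/andP; split; first by rewrite -[ltRHS](pK x); apply: inverse_lt; lra.
  by rewrite -[ltLHS](pK x); apply: inverse_lt; lra.
have : x \in `]q (p x - e), q (p x + e)[ by rewrite in_itv.
move=> /near_in_itvoo; apply: filterS => y; rewrite in_itv /= => /andP[/p_lt + /p_lt].
by rewrite !qK ltr_norml => h1 h2; apply/andP; split; lra.
Qed.

End IncreasingBijection.

Definition piecewise_dyadic (R : realType) (p : R -> R) : Prop :=
  exists2 B : seq R, (forall c, c \in B -> dyadic c) &
    forall a b, 0 <= a -> a < b -> b <= 1 -> (forall c, c \in B -> ~ (a < c < b)) ->
    exists m : int, forall x, a <= x <= b -> p x = p a + 2 ^ m * (x - a).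

Section ThompsonFAction.
Variable R : realType.
Local Notation UI := (unit_interval R).
Local Notation FT := (subgroup_type (thompsonF R)).
Implicit Types (f g h : FT) (x y : R).

Fact toI_subproof x : 0 <= x <= 1 -> x \in `[0%R : R, 1%R]%classic.
Proof. by rewrite inE /= in_itv. Qed.

Definition toI x : UI :=
  if pselect (0 <= x <= 1) is left H then exist _ x (toI_subproof H)
  else exist _ 0 (I01_0_subproof R).

Lemma toIK x : 0 <= x <= 1 -> I01_val (toI x) = x.
Proof. by move=> x01; rewrite /toI; case: pselect. Qed.

Lemma I01_valP (u : UI) : 0 <= I01_val u <= 1.
Proof. by have := set_valP u; rewrite /= in_itv. Qed.

Lemma I01_valK : cancel (@I01_val R) toI.
Proof. by move=> u; apply: I01_val_inj; rewrite toIK// I01_valP. Qed.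

(** Extension by the identity to the whole line frees the rules for products, inverses and order
    from side conditions. *)
Definition actF f x : R := if 0 <= x <= 1 then I01_val (homeo_fun (val f) (toI x)) else x.

Lemma actF_in f x : 0 <= x <= 1 -> actF f x = I01_val (homeo_fun (val f) (toI x)).
Proof. by rewrite /actF => ->. Qed.

Lemma actF_val f (u : UI) : actF f (I01_val u) = I01_val (homeo_fun (val f) u).
Proof. by rewrite actF_in ?I01_valP// I01_valK. Qed.

Lemma actF_itv f x : 0 <= x <= 1 -> 0 <= actF f x <= 1.
Proof. by move=> x01; rewrite actF_in// I01_valP. Qed.

Lemma actF1 x : actF 1%g x = x.
Proof. by rewrite /actF; case: ifP => // x01; rewrite toIK. Qed.

Lemma actFM f g x : actF (f * g)%g x = actF f (actF g x).
Proof.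
have [x01|x01] := boolP (0 <= x <= 1); last by rewrite /actF !(negbTE x01).
by rewrite [actF g x]actF_in// actF_val actF_in.
Qed.

Lemma actFK f x : actF f^-1%g (actF f x) = x.
Proof. by rewrite -actFM mulVg actF1. Qed.

Lemma actFKV f x : actF f (actF f^-1%g x) = x.
Proof. by rewrite -actFM mulgV actF1. Qed.

Lemma actF_ext f g : actF f =1 actF g -> f = g.
Proof.
move=> fg; apply: val_inj; apply: homeo_eq => u; apply: I01_val_inj.
by rewrite -!actF_val.
Qed.

Lemma thompsonFP f : thompsonF_set (val f : homeo UI).
Proof. exact: set_valP f. Qed.

Lemma actF_lt f x y : x < y -> actF f x < actF f y.
Proof.
move=> xy; have [fi _] := thompsonFP f.
have [x01|x01] := boolP (0 <= x <= 1); have [y01|y01] := boolP (0 <= y <= 1).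
- by rewrite !actF_in//; apply: fi; rewrite !toIK.
- have /andP[_ fx] := actF_itv f x01; rewrite [actF f y]/actF (negbTE y01).
  by apply: le_lt_trans fx _; move: x01 y01; rewrite negb_and -!ltNge => /andP[? ?] /orP[]; lra.
- have /andP[fy _] := actF_itv f y01; rewrite [actF f x]/actF (negbTE x01).
  by apply: lt_le_trans fy; move: x01 y01; rewrite negb_and -!ltNge => /orP[] ? /andP[]; lra.
- by rewrite /actF (negbTE x01) (negbTE y01).
Qed.

Lemma actF_ltE f x y : (actF f x < actF f y) = (x < y).
Proof. exact: (increasing_ltE (@actF_lt f)). Qed.

Lemma actF_leE f x y : (actF f x <= actF f y) = (x <= y).
Proof. by rewrite !leNgt actF_ltE. Qed.

Lemma actF_inj f : injective (actF f).
Proof. exact: can_inj (actFK f). Qed.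

Lemma actF_0 f : actF f 0 = 0.
Proof.
have h01 : 0 <= (0 : R) <= 1 by rewrite lexx ler01.
have /andP[f0 _] := actF_itv f h01.
have /andP[+ _] := actF_itv f^-1%g h01; rewrite -(actF_leE f) actFKV => h.
by apply/eqP; rewrite eq_le f0 h.
Qed.

Lemma actF_1 f : actF f 1 = 1.
Proof.
have h01 : 0 <= (1 : R) <= 1 by rewrite lexx ler01.
have /andP[_ f0] := actF_itv f h01.
have /andP[_ +] := actF_itv f^-1%g h01; rewrite -(actF_leE f) actFKV => h.
by apply/eqP; rewrite eq_le f0 h.
Qed.

Lemma actF_out f x : x <= 0 \/ 1 <= x -> actF f x = x.
Proof.
case; rewrite le_eqVlt => /predU1P[]; [by move=> ->; rewrite actF_0| |by move<-; rewrite actF_1|].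
  by move=> x0; rewrite /actF leNgt x0.
by move=> x1; rewrite /actF andbC leNgt x1.
Qed.

Lemma actF_piecewise f : piecewise_dyadic (actF f).
Proof.
have [_ [B [/finite_seqP[s Bs] Bd fB]]] := thompsonFP f.
exists [seq I01_val c | c <- s].
  by move=> _ /mapP[c cs ->]; apply: Bd; rewrite Bs.
move=> a b a0 ab b1 sab.
have a01 : 0 <= a <= 1 by rewrite a0 ltW// (lt_le_trans ab).
have b01 : 0 <= b <= 1 by rewrite b1 andbT ltW// (le_lt_trans a0).
have [||m mE] := fB (toI a) (toI b); first by rewrite !toIK.
  by move=> c; rewrite !toIK// => cab; rewrite Bs => cs; apply: sab cab; exact: map_f.
exists m => x /andP[ax xb]; have x01 : 0 <= x <= 1 by rewrite (le_trans a0)//= (le_trans xb).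
by have := mE (toI x); rewrite !toIK// ax xb => /(_ isT); rewrite -!actF_in.
Qed.

Lemma actF_dyadic f x : dyadic (actF f x) <-> dyadic x.
Proof.
have [x01|x01] := boolP (0 <= x <= 1); last by rewrite /actF (negbTE x01).
by rewrite actF_in//; have := thompsonF_dyadic (toI x) (thompsonFP f); rewrite toIK.
Qed.

Lemma thompsonF_build (p q : R -> R) : cancel p q -> cancel q p ->
  (forall x y, x < y -> p x < p y) -> (forall x, x <= 0 \/ 1 <= x -> p x = x) ->
  piecewise_dyadic p -> exists f : FT, actF f =1 p.
Proof.
move=> pK qK p_lt p_out [B Bd pB].
have qlt := inverse_lt qK p_lt.
have q_out x : x <= 0 \/ 1 <= x -> q x = x by move=> x01; rewrite -{1}(p_out x x01) pK.
have itv (r : R -> R) : (forall x y, x < y -> r x < r y) -> (forall x, x <= 0 \/ 1 <= x -> r x = x) ->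
    forall u : UI, 0 <= r (I01_val u) <= 1.
  move=> rlt rout u; have /andP[u0 u1] := I01_valP u; apply/andP; split.
    move: u0; rewrite le_eqVlt => /predU1P[<-|/rlt]; first by rewrite rout; [|left].
    by rewrite (rout 0); [exact: ltW|left].
  move: u1; rewrite le_eqVlt => /predU1P[->|/rlt]; first by rewrite rout; [|right].
  by rewrite (rout 1); [exact: ltW|right].
pose P u := toI (p (I01_val u)); pose Q u := toI (q (I01_val u)).
have PE u : I01_val (P u) = p (I01_val u) by rewrite toIK// itv.
have QE u : I01_val (Q u) = q (I01_val u) by rewrite toIK// itv.
have PK : cancel P Q by move=> u; apply: I01_val_inj; rewrite QE PE pK.
have QK : cancel Q P by move=> u; apply: I01_val_inj; rewrite PE QE qK.
have cont (r : R -> R) (S : UI -> UI) : continuous r -> (forall u, I01_val (S u) = r (I01_val u)) -> continuous S.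
  move=> rc SE; apply: (@continuous_comp_initial _ _ _ (@I01_val R)).
  rewrite (_ : _ \o _ = r \o @I01_val R); last by apply/funext => u /=; rewrite SE.
  by move=> u; apply: continuous_comp; [exact: initial_continuous|exact: rc].
have Pc : continuous P by apply: cont PE; exact: increasing_continuous pK qK p_lt.
have Qc : continuous Q by apply: cont QE; exact: increasing_continuous qK pK qlt.
pose h := Homeo PK QK Pc Qc.
have hF : h \in (thompsonF R : set _).
  rewrite inE; split; first by move=> u v uv /=; rewrite !PE; exact: p_lt.
  exists [set u | I01_val u \in B]; split.
  - apply/finite_seqP; exists [seq u <- map toI B | I01_val u \in B].
    apply/seteqP; split=> u /=; rewrite mem_filter; last by case/andP.
    by move=> uB; rewrite uB -[u]I01_valK map_f.
  - by move=> c /Bd.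
  - move=> a b ab nB.
    have /andP[a0 _] := I01_valP a; have /andP[_ b1] := I01_valP b.
    have [|m mE] := pB _ _ a0 ab b1.
      move=> c cB cab; have c01 : 0 <= c <= 1 by case/andP: cab; lra.
      by apply: (nB (toI c)); rewrite ?[[set _ | _] _]/= toIK.
    by exists m => x xab /=; rewrite !PE mE.
exists (exist _ h hF) => x; rewrite /actF; case: ifPn => x01.
  by have := PE (toI x); rewrite (toIK x01).
rewrite p_out//; move: x01; rewrite negb_and -!ltNge => /orP[/ltW|/ltW]; by [left|right].
Qed.

End ThompsonFAction.

Section ThompsonFElements.
Variable R : realType.
Local Notation FT := (subgroup_type (thompsonF R)).
Implicit Types (f g h k : FT) (x y a b : R).

Lemma dyadic_half : dyadic (1 / 2 : R).
Proof. by exists 1, 1%N; rewrite expr1. Qed.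

Lemma dyadic_int (z : int) : dyadic (z%:~R : R).
Proof. by exists z, 0%N; rewrite expr0 divr1. Qed.

Lemma dyadicX n : dyadic (2 ^- n : R).
Proof. by exists 1, n; rewrite mul1r. Qed.

Lemma dyadicMX n x : dyadic x -> dyadic (2 ^- n * x).
Proof. by move=> [k [m ->]]; exists k, (n + m)%N; rewrite exprD invfM mulrCA. Qed.

(** The standard generator that re-associates a three-fold subdivision: [[0, 1/2]], [[1/2, 3/4]],
    [[3/4, 1]] go affinely to [[0, 1/4]], [[1/4, 1/2]], [[1/2, 1]]. *)
Let assoc_fun x := if x <= 0 then x else if x <= 1 / 2 then x / 2 else
  if x <= 3 / 4 then x - 1 / 4 else if x <= 1 then 2 * x - 1 else x.
Let assoc_inv x := if x <= 0 then x else if x <= 1 / 4 then 2 * x else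
  if x <= 1 / 2 then x + 1 / 4 else if x <= 1 then (x + 1) / 2 else x.

Lemma assoc_fun_l x : 0 <= x -> x <= 1 / 2 -> assoc_fun x = x / 2.
Proof.
rewrite /assoc_fun; case: ifPn => [|_ _ ->//] h1 h2 _.
by have -> : x = 0 by [apply/eqP; rewrite eq_le h1]; rewrite mul0r.
Qed.

Lemma assoc_fun_m x : 1 / 2 <= x -> x <= 3 / 4 -> assoc_fun x = x - 1 / 4.
Proof.
rewrite /assoc_fun; case: ifPn => [|_]; first by lra.
by case: ifPn => [h1 h2 _|_ _ ->//]; lra.
Qed.

Lemma assoc_fun_r x : 3 / 4 <= x -> x <= 1 -> assoc_fun x = 2 * x - 1.
Proof.
rewrite /assoc_fun; case: ifPn => [|_]; first by lra.
case: ifPn => [|_]; first by lra.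
by case: ifPn => [h1 h2 _|_ _ ->//]; lra.
Qed.

Lemma assoc_inv_l x : 0 <= x -> x <= 1 / 4 -> assoc_inv x = 2 * x.
Proof.
rewrite /assoc_inv; case: ifPn => [|_ _ ->//] h1 h2 _.
by have -> : x = 0 by [apply/eqP; rewrite eq_le h1]; rewrite mulr0.
Qed.

Lemma assoc_inv_m x : 1 / 4 <= x -> x <= 1 / 2 -> assoc_inv x = x + 1 / 4.
Proof.
rewrite /assoc_inv; case: ifPn => [|_]; first by lra.
by case: ifPn => [h1 h2 _|_ _ ->//]; lra.
Qed.

Lemma assoc_inv_r x : 1 / 2 <= x -> x <= 1 -> assoc_inv x = (x + 1) / 2.
Proof.
rewrite /assoc_inv; case: ifPn => [|_]; first by lra.
case: ifPn => [|_]; first by lra.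
by case: ifPn => [h1 h2 _|_ _ ->//]; lra.
Qed.

Lemma assoc_fun_out x : x <= 0 \/ 1 <= x -> assoc_fun x = x.
Proof.
rewrite /assoc_fun => -[->//|x1]; do 3 (case: ifPn => [|_]; first by lra).
by case: ifPn => // h; lra.
Qed.

Lemma assoc_inv_out x : x <= 0 \/ 1 <= x -> assoc_inv x = x.
Proof.
rewrite /assoc_inv => -[->//|x1]; do 3 (case: ifPn => [|_]; first by lra).
by case: ifPn => // h; lra.
Qed.

Lemma four_pieces (s t x : R) : x <= 0 \/ 1 <= x \/ 0 <= x <= s \/ s <= x <= t \/ t <= x <= 1.
Proof.
have [|x0'] := leP x 0; first by left.
have [|x1] := leP 1 x; first by right; left.
have [xs|sx] := leP x s; first by right; right; left; rewrite ltW.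
have [xt|tx] := leP x t; first by right; right; right; left; rewrite ltW.
by right; right; right; right; rewrite !ltW.
Qed.

Lemma assoc_funK : cancel assoc_fun assoc_inv.
Proof.
move=> x; have [h|[h|[/andP[h1 h2]|[/andP[h1 h2]|/andP[h1 h2]]]]] := four_pieces (1 / 2) (3 / 4) x.
- by rewrite assoc_fun_out ?assoc_inv_out//; left.
- by rewrite assoc_fun_out ?assoc_inv_out//; right.
- by rewrite assoc_fun_l// assoc_inv_l; lra.
- by rewrite assoc_fun_m// assoc_inv_m; lra.
- by rewrite assoc_fun_r// assoc_inv_r; lra.
Qed.

Lemma assoc_invK : cancel assoc_inv assoc_fun.
Proof.
move=> x; have [h|[h|[/andP[h1 h2]|[/andP[h1 h2]|/andP[h1 h2]]]]] := four_pieces (1 / 4) (1 / 2) x.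
- by rewrite assoc_inv_out ?assoc_fun_out//; left.
- by rewrite assoc_inv_out ?assoc_fun_out//; right.
- by rewrite assoc_inv_l// assoc_fun_l; lra.
- by rewrite assoc_inv_m// assoc_fun_m; lra.
- by rewrite assoc_inv_r// assoc_fun_r; lra.
Qed.

Lemma assoc_fun_lt x y : x < y -> assoc_fun x < assoc_fun y.
Proof.
have wm u v : assoc_fun u <= assoc_fun v -> u < v -> assoc_fun u < assoc_fun v.
  by rewrite le_eqVlt => /predU1P[/(can_inj assoc_funK)->|//]; rewrite ltxx.
move=> xy; apply: wm (xy); have h0 := assoc_fun_out (or_introl (lexx 0)).
have h1 := assoc_fun_out (or_intror (lexx 1)).
have hl := @assoc_fun_l (1 / 2); have hm := @assoc_fun_m (3 / 4).
have [h|[h|[/andP[a1 a2]|[/andP[a1 a2]|/andP[a1 a2]]]]] := four_pieces (1 / 2) (3 / 4) x;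
have [k|[k|[/andP[b1 b2]|[/andP[b1 b2]|/andP[b1 b2]]]]] := four_pieces (1 / 2) (3 / 4) y;
rewrite ?(assoc_fun_l a1 a2) ?(assoc_fun_m a1 a2) ?(assoc_fun_r a1 a2) ?(assoc_fun_l b1 b2) ?(assoc_fun_m b1 b2) ?(assoc_fun_r b1 b2)
  ?(assoc_fun_out (or_introl h)) ?(assoc_fun_out (or_intror h)) ?(assoc_fun_out (or_introl k)) ?(assoc_fun_out (or_intror k)); lra.
Qed.

Lemma assocF_ex : exists f, actF f =1 assoc_fun.
Proof.
apply: (thompsonF_build assoc_funK assoc_invK assoc_fun_lt assoc_fun_out).
exists [:: 1 / 2; 3 / 4].
  move=> c; rewrite !inE => /orP[] /eqP ->; first exact: dyadic_half.
  by exists 3, 2%N; rewrite expr2; congr (_ / _); lra.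
move=> a b a0 ab b1 nB.
have out c : c \in [:: 1 / 2; 3 / 4] -> c <= a \/ b <= c.
  move=> cB; have [|h1] := leP c a; [by left|right].
  by have [//|h2] := leP b c; case: (nB c cB); rewrite h1 h2.
have [n1|n1] := out (1 / 2) (mem_head _ _); last first.
  exists (- 1) => x /andP[ax xb]; rewrite exprN1 !assoc_fun_l; lra.
have [n2|n2] := out (3 / 4) (mem_last (1 / 2) [:: 3 / 4]); last first.
  exists 0 => x /andP[ax xb]; rewrite expr0z !assoc_fun_m; lra.
exists 1 => x /andP[ax xb]; rewrite expr1z !assoc_fun_r; lra.
Qed.

Definition assocF : FT := sval (cid assocF_ex).

Lemma assocFE x : actF assocF x = assoc_fun x.
Proof. exact: svalP (cid assocF_ex) x. Qed.

Lemma assocF_l x : 0 <= x <= 1 / 2 -> actF assocF x = x / 2.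
Proof. by rewrite assocFE => /andP[]; exact: assoc_fun_l. Qed.

Lemma assocF_m x : 1 / 2 <= x <= 3 / 4 -> actF assocF x = x - 1 / 4.
Proof. by rewrite assocFE => /andP[]; exact: assoc_fun_m. Qed.

Lemma assocF_r x : 3 / 4 <= x <= 1 -> actF assocF x = 2 * x - 1.
Proof. by rewrite assocFE => /andP[]; exact: assoc_fun_r. Qed.

Lemma assocFV_l x : 0 <= x <= 1 / 4 -> actF assocF^-1%g x = 2 * x.
Proof.
by move=> /andP[? ?]; apply: (@actF_inj _ assocF); rewrite actFKV assocF_l; [|apply/andP; split]; lra.
Qed.

Lemma assocFV_m x : 1 / 4 <= x <= 1 / 2 -> actF assocF^-1%g x = x + 1 / 4.
Proof.
by move=> /andP[? ?]; apply: (@actF_inj _ assocF); rewrite actFKV assocF_m; [|apply/andP; split]; lra.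
Qed.

Lemma assocFV_r x : 1 / 2 <= x <= 1 -> actF assocF^-1%g x = (x + 1) / 2.
Proof.
by move=> /andP[? ?]; apply: (@actF_inj _ assocF); rewrite actFKV assocF_r; [|apply/andP; split]; lra.
Qed.

Lemma flip_ex f : exists g, forall x, actF g x = 1 - actF f (1 - x).
Proof.
pose p h x := 1 - actF h (1 - x).
have sb (z : R) : 1 - (1 - z) = z by ring.
have pK h h' : cancel (actF h) (actF h') -> cancel (p h) (p h').
  by move=> hK x; rewrite /p sb hK sb.
apply: (thompsonF_build (pK _ _ (actFK f)) (pK _ _ (actFKV f))).
- move=> x y xy; rewrite /p ltrD2l ltrN2 actF_ltE; lra.
- by move=> x x01; rewrite /p actF_out ?sb//; case: x01; [right|left]; lra.
- have [B Bd BP] := actF_piecewise f; exists [seq 1 - c | c <- B].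
    move=> _ /mapP[c /Bd dc ->]; apply: dyadicB dc; exact: (dyadic_int 1).
  move=> a b a0 ab b1 nB.
  have [|||c cB cab|m mE] := BP (1 - b) (1 - a); [lra|lra|lra| |].
    by apply: (nB (1 - c)); [exact: map_f|move/andP: cab => [? ?]; apply/andP; split; lra].
  exists m => x /andP[ax xb]; rewrite /p.
  have -> := mE (1 - x); last by apply/andP; split; lra.
  have -> := mE (1 - a); last by apply/andP; split; lra.
  by ring.
Qed.

(** Conjugation by the reflection of the interval, which is not itself in F. It reduces questions at
    the end 1 to questions at the end 0. *)
Definition flip f : FT := sval (cid (flip_ex f)).

Lemma flipE f x : actF (flip f) x = 1 - actF f (1 - x).
Proof. exact: svalP (cid (flip_ex f)) x. Qed.

Lemma flipM : {morph flip : f g / (f * g)%g}.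
Proof.
move=> f g; apply: actF_ext => x; rewrite actFM !flipE actFM.
by congr (1 - actF f _); ring.
Qed.

Lemma flipK : involutive flip.
Proof.
move=> f; apply: actF_ext => x; rewrite !flipE.
have sb (z : R) : 1 - (1 - z) = z by ring.
by rewrite !sb.
Qed.

Definition fits (u : R) n := [/\ dyadic u, 0 <= u & u + 2 ^- n <= 1].

Lemma pow2_gt0 n : 0 < 2 ^- n :> R.
Proof. by rewrite invr_gt0 exprn_gt0. Qed.

Lemma copy_ex u n f : fits u n ->
  exists g, forall x, actF g x = u + 2 ^- n * actF f (2 ^+ n * (x - u)).
Proof.
move=> [du u0 un]; have s0 := pow2_gt0 n; set s := 2 ^- n in un s0 *.
have sE : 2 ^+ n = s^-1 :> R by rewrite invrK.
have su : s \is a GRing.unit by rewrite unitfE gt_eqF.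
pose p h x := u + s * actF h (s^-1 * (x - u)).
have pK h h' : cancel (actF h) (actF h') -> cancel (p h) (p h').
  by move=> hK x; rewrite /p [u + _ - u]addrAC subrr add0r mulKr// hK mulVKr// addrC subrK.
have p_out h x : x <= u \/ u + s <= x -> p h x = x.
  move=> xo; rewrite /p actF_out ?mulVKr// ?[u + _]addrC ?subrK//.
  case: xo => xo; [left|right].
    by rewrite pmulr_rle0 ?invr_gt0// subr_le0.
  by rewrite mulrC ler_pdivlMr// mul1r lerBrDl.
rewrite sE; apply: (thompsonF_build (pK _ _ (actFK f)) (pK _ _ (actFKV f))).
- move=> x y xy; rewrite /p ltrD2l ltr_pM2l// actF_ltE ltr_pM2l ?invr_gt0//; lra.
- by move=> x [] ?; apply: p_out; [left|right]; lra.
- have [B Bd BP] := actF_piecewise f; exists (u :: u + s :: [seq u + s * c | c <- B]).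
    move=> c; rewrite !inE => /or3P[/eqP->//|/eqP->|/mapP[d /Bd dd ->]].
      by apply: dyadicD => //; exact: dyadicX.
    by apply: dyadicD => //; exact: dyadicMX.
  move=> a b a0 ab b1 nB.
  have n1 : u <= a \/ b <= u.
    have := nB u; rewrite !inE eqxx => /(_ isT) H.
    by have [|h1] := leP u a; [left|right; have [|h2] := leP b u => //; case: H; rewrite h1 h2].
  have n2 : u + s <= a \/ b <= u + s.
    have := nB (u + s); rewrite !inE eqxx orbT => /(_ isT) H.
    by have [|h1] := leP (u + s) a; [left|right; have [|h2] := leP b (u + s) => //; case: H; rewrite h1 h2].
  have triv : (forall x, a <= x <= b -> x <= u \/ u + s <= x) ->
      exists m : int, forall x, a <= x <= b -> p f x = p f a + 2 ^ m * (x - a).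
    move=> out; exists 0 => x xab; rewrite expr0z mul1r !p_out ?[a + _]addrC ?subrK//.
      by apply: out; rewrite lexx ltW.
    exact: out.
  case: n1 => n1; last by apply: triv => x /andP[_ xb]; left; lra.
  case: n2 => n2; first by apply: triv => x /andP[ax _]; right; lra.
  have sc x : s * (s^-1 * (x - u)) = x - u by rewrite mulVKr.
  have [|||c cB /andP[ac cb]|m mE] := BP (s^-1 * (a - u)) (s^-1 * (b - u)).
  - by apply: mulr_ge0; [rewrite invr_ge0 ltW|rewrite subr_ge0].
  - by rewrite ltr_pM2l ?invr_gt0// ltrD2r.
  - by rewrite mulrC ler_pdivrMr// mul1r lerBlDl.
  - apply: (nB (u + s * c)); first by rewrite !inE (map_f (fun c => u + s * c) cB) !orbT.
    move: ac cb; rewrite -(ltr_pM2l s0) sc -[c < _](ltr_pM2l s0) sc => ac cb.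
    by apply/andP; split; lra.
  exists m => x /andP[ax xb]; rewrite /p mE; last by rewrite !ler_pM2l ?invr_gt0// !lerD2r ax xb.
  by rewrite -mulrBr opprB addrA subrK mulrDr addrA; congr (_ + _); rewrite mulrCA mulVKr.
Qed.

(* Junk value [1] unless the brick [u, u + 2^-n] is contained in [0, 1]. *)
Definition copy u n f : FT :=
  if pselect (fits u n) is left H then sval (cid (copy_ex f H)) else 1%g.

Lemma copyE u n f x : fits u n -> actF (copy u n f) x = u + 2 ^- n * actF f (2 ^+ n * (x - u)).
Proof. by rewrite /copy; case: pselect => // H _; exact: svalP (cid (copy_ex f H)) x. Qed.

Lemma copyM u n : {morph copy u n : f g / (f * g)%g}.
Proof.
move=> f g; have [H|H] := pselect (fits u n); last by rewrite /copy; case: pselect; rewrite ?mulg1.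
apply: actF_ext => x; rewrite actFM !copyE// actFM; congr (_ + _ * actF f _).
by rewrite [u + _ - u]addrAC subrr add0r mulVKf// expf_neq0// pnatr_eq0.
Qed.

Definition suppF a b f := forall x, x <= a \/ b <= x -> actF f x = x.

Lemma suppF_subgroup a b : is_subgroup (suppF a b).
Proof.
split=> [x _|f g fab gab x xab]; first exact: actF1.
by rewrite actFM -{1}(gab x xab) actFK fab.
Qed.

Lemma suppFW a b a' b' f : a' <= a -> b <= b' -> suppF a b f -> suppF a' b' f.
Proof. by move=> aa bb fab x [xa|xb]; apply: fab; [left; apply: le_trans aa|right; apply: le_trans xb]. Qed.

Lemma suppF_itv a b f x : suppF a b f -> a <= x <= b -> a <= actF f x <= b.
Proof.
move=> fab /andP[ax xb].
rewrite -{1}(fab a (or_introl (lexx _))) -{1}(fab b (or_intror (lexx _))).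
by rewrite !actF_leE ax xb.
Qed.

Lemma suppF_conj a b f h : suppF a b f -> suppF (actF h a) (actF h b) (f ^ h^-1)%g.
Proof.
move=> fab x xab; rewrite conjgE invgK !actFM fab ?actFKV//.
by case: xab => xab; [left|right]; rewrite -(actF_leE h) actFKV.
Qed.

Lemma commute_suppF a b c d f g : b <= c -> suppF a b f -> suppF c d g -> commute f g.
Proof.
move=> bc fab gcd; apply: actF_ext => x; rewrite !actFM.
have [xb|bx] := leP x b.
  rewrite (gcd x); last by left; apply: le_trans bc.
  rewrite gcd//; left; apply: le_trans bc.
  by have [ax|xa] := leP a x; [have /andP[] := suppF_itv fab (introT andP (conj ax xb))|rewrite fab//; left; exact: ltW].
rewrite (fab x); last by right; exact: ltW.
rewrite fab//; right.
have [xc|cx] := leP x c; first by rewrite gcd; [exact: ltW|left].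
by apply: le_trans bc _; rewrite -(gcd c (or_introl (lexx _))) actF_leE ltW.
Qed.

Lemma suppF_copy u n f : fits u n -> suppF u (u + 2 ^- n) (copy u n f).
Proof.
move=> H x xo; rewrite copyE//; have s0 := pow2_gt0 n.
have e0 : (2 : R) ^+ n != 0 by rewrite expf_neq0// pnatr_eq0.
rewrite actF_out ?mulKf// ?[u + _]addrC ?subrK//.
case: xo => xo; [left|right].
  by rewrite pmulr_rle0 ?exprn_gt0// subr_le0.
by rewrite -[X in X <= _](mulfV e0) ler_pM2l ?exprn_gt0// lerBrDl.
Qed.

End ThompsonFElements.

(** * Slopes at the end points and compactly supported elements *)

Section Germs.
Variable R : realType.
Local Notation FT := (subgroup_type (thompsonF R)).
Local Notation assocF := (assocF R).
Implicit Types (f g h k : FT) (x y a b : R) (m n : int).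

Definition germ0 f m := exists2 d, 0 < d & forall x, 0 <= x <= d -> actF f x = 2 ^ m * x.

Lemma pow2z_gt0 m : 0 < (2 : R) ^ m.
Proof. by rewrite exprz_gt0. Qed.

Lemma germ0_ex f : exists m, germ0 f m.
Proof.
have [B _ BP] := actF_piecewise f.
have [d [d0 d1 dB]] : exists d : R, [/\ 0 < d, d <= 1 & forall c, c \in B -> ~ (0 < c < d)].
  elim: B {BP} => [|c B [d [d0 d1 dB]]]; first by exists 1; split.
  have [c0|c0] := leP c 0.
    exists d; split=> // e; rewrite inE => /predU1P[->|]; last exact: dB.
    by move=> /andP[]; lra.
  exists (Num.min c d); rewrite lt_min ge_min d0 c0 d1 orbT; split=> // e.
  rewrite inE lt_min => /predU1P[->|/dB eB] /and3P[e0 ec ed]; first by rewrite ltxx in ec.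
  by apply: eB; rewrite e0 ed.
have [m mE] := BP 0 d (lexx _) d0 d1 dB; exists m; exists d => // x xd.
by rewrite mE// actF_0 add0r subr0.
Qed.

Lemma germ0_uniq f m n : germ0 f m -> germ0 f n -> m = n.
Proof.
move=> [d d0 dE] [e e0 eE].
pose x := Num.min d e; have x0 : 0 < x by rewrite lt_min d0.
have : (2 : R) ^ m * x = 2 ^ n * x.
  by rewrite -dE ?eE// ltW//= ge_min lexx ?orbT.
by move/(mulIf (lt0r_neq0 x0)) => /ieexprIz; apply; lra.
Qed.

Lemma germ0M f g m n : germ0 f m -> germ0 g n -> germ0 (f * g)%g (m + n).
Proof.
move=> [d d0 dE] [e e0 eE]; have p0 := pow2z_gt0 n.
exists (Num.min e (d / 2 ^ n)); first by rewrite lt_min e0 divr_gt0.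
move=> x; rewrite le_min => /and3P[x0 xe xd]; rewrite actFM eE ?x0// dE; last first.
  by rewrite mulr_ge0 ?(ltW p0)//= mulrC -ler_pdivlMr.
by rewrite mulrA -expfzDr// pnatr_eq0.
Qed.

Lemma germ01 : germ0 1%g 0.
Proof. by exists 1 => // x _; rewrite actF1 expr0z mul1r. Qed.

Lemma germ0V f m : germ0 f m -> germ0 f^-1%g (- m).
Proof.
move=> fm; have [n fn] := germ0_ex f^-1%g.
have := germ0_uniq (germ0M fm fn); rewrite mulgV => /(_ _ germ01) /eqP.
by rewrite addr_eq0 => /eqP->; rewrite opprK.
Qed.

Lemma germ0X f m (k : nat) : germ0 f m -> germ0 (f ^+ k)%g (m *+ k).
Proof.
move=> fm; elim: k => [|k IH]; first by rewrite mulr0n; exact: germ01.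
by rewrite expgS mulrS; exact: germ0M.
Qed.

Definition germ1 f m := germ0 (flip f) m.

Lemma flip1 : flip 1%g = 1%g :> FT.
Proof. by apply: (@mulgI _ (flip 1%g)); rewrite -flipM !mulg1. Qed.

Lemma flipV f : flip f^-1%g = (flip f)^-1%g.
Proof. by apply: (@mulgI _ (flip f)); rewrite -flipM !mulgV flip1. Qed.

Lemma suppF_flip a b f : suppF a b f -> suppF (1 - b) (1 - a) (flip f).
Proof.
move=> fab x xab; have sb : 1 - (1 - x) = x by ring.
by rewrite flipE fab ?sb//; case: xab; [right|left]; lra.
Qed.

Lemma germ0_supp a b f : 0 < a -> suppF a b f -> germ0 f 0.
Proof. by move=> a0 fab; exists a => // x /andP[_ xa]; rewrite fab ?expr0z ?mul1r//; left. Qed.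

(** The elements with compact support in the open interval, equivalently those of slope 1 at both
    ends. This group will turn out to be F' ([derived_inK]). *)
Definition inK : set FT := [set f | exists a b, [/\ 0 < a, b < 1 & suppF a b f]].

Lemma inK_germ f : inK f <-> germ0 f 0 /\ germ1 f 0.
Proof.
split=> [[a [b [a0 b1 fab]]]|[[a a0 fa] [b b0 fb]]].
  split; first exact: germ0_supp fab.
  by apply: germ0_supp (suppF_flip fab); lra.
exists a, (1 - b); split=> //; first lra.
move=> x [xa|xb].
  have [x0|x0] := leP 0 x; last by rewrite actF_out//; left; exact: ltW.
  by rewrite fa ?expr0z ?mul1r// x0.
have [x1|x1] := leP x 1; last by rewrite actF_out//; right; exact: ltW.
have := fb (1 - x); rewrite flipE expr0z mul1r.
have -> : 1 - (1 - x) = x by ring.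
have xx : 0 <= 1 - x <= b by apply/andP; split; lra.
move=> /(_ xx); lra.
Qed.

Lemma inK_subgroup : is_subgroup inK.
Proof.
split; first by exists (1/2), (1/2); split; [lra|lra|move=> x _; exact: actF1].
move=> f g /inK_germ[f0 f1] /inK_germ[g0 g1]; apply/inK_germ; split.
  by have := germ0M f0 (germ0V g0); rewrite subr0.
by have := germ0M f1 (germ0V g1); rewrite -flipV -flipM subr0.
Qed.

Lemma inK_conj f h : inK f -> inK (f ^ h)%g.
Proof.
move=> [a [b [a0 b1 fab]]]; rewrite -[h]invgK.
exists (actF h^-1%g a), (actF h^-1%g b); split; last exact: suppF_conj.
  by rewrite -(actF_0 h^-1%g) actF_ltE.
by rewrite -(actF_1 h^-1%g) actF_ltE.
Qed.

Lemma fits_left (n : nat) : fits (0 : R) n.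
Proof.
split; first exact: dyadic0; first by [].
by rewrite add0r invf_le1 ?exprn_gt0// exprn_ege1// ler1n.
Qed.

Lemma pow2_lt a : 0 < a -> exists n : nat, 2 ^- n < a.
Proof.
move=> a0; exists (Num.bound a^-1).
rewrite -[ltRHS]invrK ltf_pV2 ?posrE ?invr_gt0 ?exprn_gt0//.
apply: lt_trans (archi_boundP (ltW _)) _; first by rewrite invr_gt0.
by rewrite -natrX ltr_nat ltn_expl.
Qed.

Lemma germ0_assocFV : germ0 assocF^-1%g 1.
Proof. by exists (1 / 4); [lra|move=> x xx; rewrite assocFV_l// expr1z]. Qed.

Lemma germ0_copy (n : nat) f m : germ0 f m -> germ0 (copy 0 n f) m.
Proof.
move=> [d d0 dE]; have e0 : 0 < (2 : R) ^+ n by rewrite exprn_gt0.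
exists (d / 2 ^+ n); first by rewrite divr_gt0.
move=> x /andP[x0 xd]; rewrite copyE; last exact: fits_left.
rewrite add0r subr0 dE; last by rewrite mulr_ge0 ?(ltW e0)//= mulrC -ler_pdivlMr.
by rewrite mulrCA mulKf// gt_eqF.
Qed.

Lemma germ0_pow_ex (m : int) : exists g, germ0 g m.
Proof.
case: m => n; first by exists (assocF^-1 ^+ n)%g; have := germ0X n germ0_assocFV; rewrite -mulr_natr mul1r natz.
exists ((assocF^-1 ^+ n.+1)^-1)%g; rewrite NegzE; apply: germ0V.
by have := germ0X n.+1 germ0_assocFV; rewrite -mulr_natr mul1r natz.
Qed.

Lemma local_germ0 a m : 0 < a -> exists2 g, germ0 g m & suppF 0 a g.
Proof.
move=> /pow2_lt[n na]; have [g gm] := germ0_pow_ex m.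
exists (copy 0 n g); first exact: germ0_copy.
have := suppF_copy g (fits_left n); rewrite add0r; apply: suppFW => //; exact: ltW.
Qed.

(** Dividing by elements with the same end slopes as [f], supported to the left of [a] and to the
    right of [b], trivialises the germs without touching [[a, b]]. *)
Lemma truncate f a b : 0 < a -> b < 1 ->
  exists2 k, inK k & forall x, a <= x <= b -> actF k x = actF f x.
Proof.
move=> a0 b1.
wlog ab : a b a0 b1 / a <= b => [H|].
  have [ab|ba] := leP a b; first exact: H.
  exists 1%g; first exact: (subgroup1 inK_subgroup).
  by move=> x /andP[]; lra.
have [m fm] := germ0_ex f; have [n fn] := germ0_ex (flip f).
have [g gm ga] := local_germ0 m a0.
have b0 : 0 < 1 - b by lra.
have [h hn hb] := local_germ0 n b0.
have hb' := suppF_flip hb; rewrite opprB addrC subrK subr0 in hb'.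
have fga := suppF_flip ga; rewrite subr0 in fga.
exists (f * g^-1 * (flip h)^-1)%g.
  apply/inK_germ; split.
    have h0 : germ0 (flip h) 0 by apply: germ0_supp hb'; lra.
    by have := germ0M (germ0M fm (germ0V gm)) (germ0V h0); rewrite subrr subr0.
  have g0 : germ0 (flip g) 0 by apply: germ0_supp fga; lra.
  rewrite /germ1 !flipM !flipV flipK.
  by have := germ0M (germ0M fn (germ0V g0)) (germ0V hn); rewrite subr0 subrr.
move=> x /andP[ax xb]; rewrite !actFM.
have -> : actF (flip h)^-1%g x = x.
  by have := subgroupV (@suppF_subgroup R b 1) hb'; apply; left.
by have := subgroupV (@suppF_subgroup R 0 a) ga => ->//; right.
Qed.

Lemma pow2S (n : nat) : 2 ^- n.+1 = 2 ^- n / 2 :> R.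
Proof. by rewrite exprS invfM mulrC. Qed.

Lemma pow2_le1 (n : nat) : 2 ^- n <= 1 :> R.
Proof. by rewrite invf_le1 ?exprn_gt0// exprn_ege1// ler1n. Qed.

Lemma actFS f (n : nat) x : actF (f ^+ n.+1)%g x = actF (f ^+ n)%g (actF f x).
Proof. by rewrite expgSr actFM. Qed.

(** The inverse of [assocF] doubles on [[0, 1/4]], so [n] steps bring [2 ^- n / 4] to [1/4]; three
    more lead through [1/2] and [3/4] to [7/8]. *)
Lemma assocFV_push a : 0 < a -> exists i, 7 / 8 <= actF (assocF^-1 ^+ i)%g a.
Proof.
move=> a0; have [n na] := pow2_lt a0; have s0 := @pow2_gt0 R n; have s1 := pow2_le1 n.
have pushn : actF (assocF^-1 ^+ n)%g (2 ^- n / 4) = 1 / 4.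
  elim: n {na s0 s1} => [|n IH]; first by rewrite expg0 actF1 expr0 invr1.
  have s0 := @pow2_gt0 R n; have s1 := pow2_le1 n.
  rewrite actFS pow2S assocFV_l; last by apply/andP; split; lra.
  by rewrite -IH; congr actF; lra.
exists (3 + n)%N; rewrite expgnDr actFM.
have : 1 / 4 <= actF (assocF^-1 ^+ n)%g a by rewrite -pushn actF_leE; lra.
rewrite -(actF_leE (assocF^-1 ^+ 3)%g); apply: le_trans.
have w1 : actF assocF^-1%g (1 / 4) = 1 / 2 by rewrite assocFV_l; lra.
have w2 : actF assocF^-1%g (1 / 2) = 3 / 4 by rewrite assocFV_m; lra.
have w3 : actF assocF^-1%g (3 / 4) = 7 / 8 by rewrite assocFV_r; lra.
by rewrite !actFS expg0 actF1 w1 w2 w3.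
Qed.

Lemma push_left a : 0 < a -> exists2 h, 7 / 16 <= actF h a & suppF 0 (1 / 2) h.
Proof.
move=> a0; have a2 : 0 < 2 * a by lra.
have [i ih] := assocFV_push a2; exists (copy 0 1 (assocF^-1 ^+ i)%g).
  by rewrite copyE ?expr1 ?add0r ?subr0; [lra|exact: fits_left].
by apply: suppFW (suppF_copy (assocF^-1 ^+ i)%g (fits_left 1)); rewrite ?add0r ?expr1; lra.
Qed.

(** The two halves are treated separately, by a push in the left half and a mirrored push in the
    right half, so the point [1/2] stays fixed. The numbers [7/16] and [9/16] are [7/8] scaled to a
    half and its mirror image. Truncation then makes the support compact. *)
Lemma compress a b : 0 < a -> a <= b -> b < 1 ->
  exists h, [/\ inK h, 7 / 16 <= actF h a & actF h b <= 9 / 16].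
Proof.
move=> a0 ab b1; have b0 : 0 < 1 - b by lra.
have [h ha hs] := push_left a0; have [g gb gs] := push_left b0.
have fs := suppF_flip gs; rewrite subr0 in fs.
have fb : actF (flip g) b <= 9 / 16 by rewrite flipE; lra.
have h2 : actF h (1 / 2) = 1 / 2 by apply: hs; right.
have f2 : actF (flip g) (1 / 2) = 1 / 2 by apply: fs; left; lra.
have [fa fb'] : 7 / 16 <= actF (flip g * h)%g a /\ actF (flip g * h)%g b <= 9 / 16.
  rewrite !actFM; split.
    have [le|/ltW le] := leP (actF h a) (1 / 2); first by rewrite fs//; left; lra.
    have : 1 / 2 <= actF (flip g) (actF h a) by rewrite -[X in X <= _]f2 actF_leE.
    lra.
  have [le|/ltW le] := leP (1 / 2) b; first by rewrite (hs b)//; right.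
  have hb : actF h b <= 1 / 2 by rewrite -[X in _ <= X]h2 actF_leE.
  have : actF (flip g) (actF h b) <= 1 / 2 by rewrite -[X in _ <= X]f2 actF_leE.
  lra.
have [k kK kE] := truncate (flip g * h)%g (a := a) (b := b) a0 b1.
by exists k; rewrite !kE ?lexx ?ab.
Qed.

End Germs.

(** * The class of an element in the abelianization of [inK] *)

Section Perfect.
Variable R : realType.
Local Notation FT := (subgroup_type (thompsonF R)).
Local Notation assocF := (assocF R).
Local Notation inK := (@inK R).
Implicit Types (f g h k : FT) (x y a b : R).

Definition derivedK : set FT := generated (commutators inK).

Lemma derivedK_subgroup : is_subgroup derivedK. Proof. exact: generated_subgroup. Qed.

Lemma derivedK_conj f h : derivedK f -> derivedK (f ^ h)%g.
Proof.
move=> /(generated_min (S := [set f | derivedK (f ^ h)%g])); apply.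
  by split=> [|x y Sx Sy]; rewrite /= ?conj1g ?conjMg ?conjVg; [exact: derivedK_subgroup.1|exact: derivedK_subgroup.2].
move=> _ [a [b [aK bK ->]]] /=; rewrite conjRg; apply: generated_sub.
by exists (a ^ h)%g, (b ^ h)%g; split=> //; exact: inK_conj.
Qed.

Lemma conj_agree a b f h k : suppF a b f -> a <= b ->
  (forall x, a <= x <= b -> actF h x = actF k x) -> (f ^ h^-1 = f ^ k^-1)%g.
Proof.
move=> fab ab hk; apply: actF_ext => z.
have ha : actF h a = actF k a by apply: hk; rewrite lexx.
have hb : actF h b = actF k b by apply: hk; rewrite lexx ab.
have hs := suppF_conj (h := h) fab; have ks := suppF_conj (h := k) fab.
have [za|az] := leP z (actF h a).
  by rewrite hs ?ks//; left; rewrite // -ha.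
have [bz|zb] := leP (actF h b) z.
  by rewrite hs ?ks//; right; rewrite // -hb.
have [x xE] : exists x, actF h x = z by exists (actF h^-1%g z); rewrite actFKV.
have xab : a <= x <= b by rewrite -(actF_leE h a) -(actF_leE h x) xE !ltW.
rewrite -xE !conjgE !invgK !actFM actFK (hk x xab) actFK hk//.
exact: suppF_itv.
Qed.

Lemma inK_le f : inK f -> exists a b, [/\ 0 < a, a <= b, b < 1 & suppF a b f].
Proof.
move=> [a [b [a0 b1 fab]]]; exists (Num.min a (1 / 2)), (Num.max b (1 / 2)); split.
- by rewrite lt_min a0; lra.
- by apply: (@le_trans _ _ (1 / 2)); rewrite ?ge_min ?le_max ?lexx orbT.
- by rewrite gt_max b1; lra.
- apply: suppFW fab; first by rewrite ge_min lexx.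
  by rewrite le_max lexx.
Qed.

(** A conjugate of [f] depends only on the conjugator on the support of [f], so an arbitrary [h] may
    be replaced by a compactly supported one. Hence F acts trivially on the abelianization of
    [inK]. *)
Lemma commg_inK f h : inK f -> derivedK [~ f, h]%g.
Proof.
move=> fK; have [a [b [a0 ab b1 fab]]] := inK_le fK.
have [k kK kE] := truncate h^-1%g a0 b1.
have -> : [~ f, h]%g = [~ f, k^-1]%g.
  rewrite !commgEl -[h in LHS]invgK; congr (_ * _)%g.
  by apply: conj_agree fab ab _ => x xab; rewrite kE.
apply: generated_sub; exists f, k^-1%g; split=> //; exact: (subgroupV (@inK_subgroup R)).
Qed.

(** Congruence modulo [derivedK]: on [inK], equality of classes in the abelianization. *)
Definition eqK f g := derivedK (f^-1 * g)%g.

Lemma eqK_sym f g : eqK f g -> eqK g f.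
Proof. by move/(subgroupV derivedK_subgroup); rewrite invgM invgK. Qed.

Lemma eqK_trans g f h : eqK f g -> eqK g h -> eqK f h.
Proof. by move=> fg gh; have := subgroupM derivedK_subgroup fg gh; rewrite mulgA mulgK. Qed.

Lemma eqK_conj f h : inK f -> eqK f (f ^ h)%g.
Proof. by move=> fK; exact: commg_inK. Qed.

Lemma eqK_derivedK f g : eqK f g -> derivedK f -> derivedK g.
Proof. by move=> fg fK; have := subgroupM derivedK_subgroup fK fg; rewrite mulVKg. Qed.

Lemma copy_conj u n a b f h : fits u n -> suppF a b f -> a <= b ->
  (forall x, a <= x <= b -> actF h x = u + 2 ^- n * x) -> copy u n f = (f ^ h^-1)%g.
Proof.
move=> un fab ab hE; apply: actF_ext => z; rewrite copyE//.
have e0 : (2 : R) ^+ n != 0 by rewrite expf_neq0// pnatr_eq0.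
have e1 : 0 < (2 : R) ^+ n by rewrite exprn_gt0.
pose w := 2 ^+ n * (z - u); have zE : z = u + 2 ^- n * w.
  by rewrite /w mulKf// addrC subrK.
rewrite -/w.
have hs := suppF_conj (h := h) fab.
have mono v v' : v <= v' -> u + 2 ^- n * v <= u + 2 ^- n * v'.
  by move=> vv; rewrite lerD2l ler_pM2l// invr_gt0.
have [wa|/ltW aw] := leP w a.
  by rewrite fab -?zE; [rewrite hs//; left; rewrite hE ?lexx// zE mono|left].
have [bw|/ltW wb] := leP b w.
  by rewrite fab -?zE; [rewrite hs//; right; rewrite hE ?lexx ?ab// zE mono|right].
have zh : z = actF h w by rewrite hE ?aw// {1}zE.
rewrite conjgE invgK !actFM zh actFK hE//; apply: suppF_itv => //; by rewrite aw.
Qed.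

Definition iL f := copy 0 1 f.
Definition iR f := copy (1 / 2) 1 f.

Lemma fits_right : fits (1 / 2 : R) 1.
Proof. by split; [exact: dyadic_half|lra|rewrite expr1; lra]. Qed.

Lemma iLE f x : actF (iL f) x = actF f (2 * x) / 2.
Proof. by rewrite copyE; [rewrite expr1 add0r subr0 mulrC|exact: fits_left]. Qed.

Lemma iRE f x : actF (iR f) x = 1 / 2 + actF f (2 * x - 1) / 2.
Proof.
rewrite copyE; last exact: fits_right.
have -> : 2 ^+ 1 * (x - 1 / 2) = 2 * x - 1 by rewrite expr1; lra.
by rewrite expr1 [2^-1 * _]mulrC.
Qed.

(** No element of F halves the entire interval, since 1 is fixed. Halving on a sufficiently long
    initial part is enough to conjugate a compactly supported element to its copy in the left
    half. *)
Lemma halve_ex (n : nat) : exists h, forall x, 0 <= x <= 1 - 2 ^- n.+1 -> actF h x = x / 2.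
Proof.
elim: n => [|n [h hE]]; first by exists assocF => x; rewrite expr1 => /andP[? ?]; apply: assocF_l; apply/andP; split; lra.
exists (assocF * iR h)%g => x /andP[x0 x1]; rewrite actFM iRE; rewrite pow2S in x1.
have s0 := @pow2_gt0 R n.+1.
have [xh|/ltW hx] := leP x (1 / 2).
  have -> : actF h (2 * x - 1) = 2 * x - 1 by apply: actF_out; left; lra.
  by rewrite assocF_l; [lra|apply/andP; split; lra].
rewrite hE; last by apply/andP; split; lra.
by rewrite assocF_m; [lra|apply/andP; split; lra].
Qed.

Lemma halve_right_ex (n : nat) : exists h, forall x, 2 ^- n.+1 <= x <= 1 -> actF h x = 1 / 2 + x / 2.
Proof.
elim: n => [|n [h hE]].
  by exists assocF^-1%g => x; rewrite expr1 => /andP[? ?]; rewrite assocFV_r; [lra|apply/andP; split; lra].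
exists (assocF^-1 * iL h)%g => x /andP[x0 x1]; rewrite actFM iLE; rewrite pow2S in x0.
have s0 := @pow2_gt0 R n.+1.
have [xh|/ltW hx] := leP x (1 / 2); last first.
  have -> : actF h (2 * x) = 2 * x by apply: actF_out; right; lra.
  by rewrite assocFV_r; [lra|apply/andP; split; lra].
rewrite hE; last by apply/andP; split; lra.
by rewrite assocFV_m; [lra|apply/andP; split; lra].
Qed.

Lemma eqK_iL f : inK f -> eqK f (iL f).
Proof.
move=> fK; have [a [b [a0 ab b1 fab]]] := inK_le fK.
have b0 : 0 < 1 - b by lra.
have [n nb] := pow2_lt b0; have [h hE] := halve_ex n.
rewrite /iL (@copy_conj 0 1 a b f h) //; [exact: eqK_conj|exact: fits_left|].
move=> x /andP[ax xb]; rewrite add0r expr1 mulrC; apply: hE.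
by have s0 := @pow2_gt0 R n; rewrite pow2S; apply/andP; split; lra.
Qed.

Lemma eqK_iR f : inK f -> eqK f (iR f).
Proof.
move=> fK; have [a [b [a0 ab b1 fab]]] := inK_le fK.
have [n na] := pow2_lt a0; have [h hE] := halve_right_ex n.
rewrite /iR (@copy_conj (1 / 2) 1 a b f h) //; [exact: eqK_conj|exact: fits_right|].
move=> x /andP[ax xb]; rewrite expr1 [2^-1 * x]mulrC; apply: hE.
by have s0 := @pow2_gt0 R n; rewrite pow2S; apply/andP; split; lra.
Qed.

Lemma iL_supp a b f : suppF a b f -> suppF (a / 2) (b / 2) (iL f).
Proof.
move=> fab x xab; rewrite iLE fab; first lra.
by case: xab; [left|right]; lra.
Qed.

Lemma iR_supp a b f : suppF a b f -> suppF ((a + 1) / 2) ((b + 1) / 2) (iR f).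
Proof.
move=> fab x xab; rewrite iRE fab; first lra.
by case: xab; [left|right]; lra.
Qed.

Lemma suppF01 f : suppF 0 1 f. Proof. by move=> x; exact: actF_out. Qed.

Lemma inK_LR f : inK (iL (iR f)).
Proof. by have := iL_supp (iR_supp (suppF01 f)) => H; exists ((0 + 1) / 2 / 2), ((1 + 1) / 2 / 2); split=> //; lra. Qed.

Lemma inK_RL f : inK (iR (iL f)).
Proof. by have := iR_supp (iL_supp (suppF01 f)) => H; exists ((0 / 2 + 1) / 2), ((1 / 2 + 1) / 2); split=> //; lra. Qed.

(** The two copies live on [[1/4, 1/2]] and [[1/2, 3/4]]; [assocF] translates the second interval
    onto the first. *)
Lemma eqK_LR_RL f : eqK (iL (iR f)) (iR (iL f)).
Proof.
have -> : iL (iR f) = (iR (iL f) ^ assocF^-1)%g; last by apply: eqK_sym; apply: eqK_conj; exact: inK_RL.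
have H1 := iL_supp (iR_supp (suppF01 f)).
have H2 := suppF_conj (h := assocF) (iR_supp (iL_supp (suppF01 f))).
rewrite !assocF_m in H2; try by apply/andP; split; lra.
apply: actF_ext => z.
have [z1|/ltW z1] := leP z (1 / 4).
  by rewrite H1 ?H2//; left; lra.
have [z2|/ltW z2] := leP (1 / 2) z.
  by rewrite H1 ?H2//; right; lra.
rewrite conjgE invgK !actFM assocFV_m; last by apply/andP; split.
rewrite iLE !iRE iLE.
have -> : 2 * (2 * (z + 1 / 4) - 1) = 2 * (2 * z) - 1 by lra.
have /andP[f0 f1] : 0 <= actF f (2 * (2 * z) - 1) <= 1 by apply: actF_itv; apply/andP; split; lra.
by rewrite assocF_m; [lra|apply/andP; split; lra].
Qed.

(** An arbitrary element of F has no class in the abelianization of [inK], but its copy on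
    [[1/4, 1/2]] has. This is the set where that class vanishes; it is a group stable under [iL] and
    [iR]. *)
Definition derivedLR : set FT := [set f | derivedK (iL (iR f))].

Lemma copy1 u n : copy u n 1%g = 1%g :> FT.
Proof. by apply: (@mulgI _ (copy u n 1%g)); rewrite -copyM !mulg1. Qed.

Lemma copyV u n f : copy u n f^-1%g = (copy u n f)^-1%g.
Proof. by apply: (@mulgI _ (copy u n f)); rewrite -copyM !mulgV copy1. Qed.

Lemma derivedLR_subgroup : is_subgroup derivedLR.
Proof.
split=> [|f g fN gN]; rewrite /derivedLR /= /iL /iR ?copy1 ?copyM ?copyV; first exact: derivedK_subgroup.1.
exact: derivedK_subgroup.2.
Qed.

Lemma derivedLR_iL f : derivedLR f -> derivedLR (iL f).
Proof.
apply: eqK_derivedK; apply: eqK_trans (eqK_LR_RL f) _; exact: eqK_iL (inK_RL f).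
Qed.

Lemma derivedLR_iR f : derivedLR f -> derivedLR (iR f).
Proof.
apply: eqK_derivedK; exact: eqK_trans (eqK_iR (inK_LR f)) (eqK_sym (eqK_LR_RL (iR f))).
Qed.

(* The pentagon relation, which says [2 a = 3 a] for the class [a] of [assocF]
   in the abelianization of [inK]. *)
Lemma pentagon : (assocF * assocF = iL assocF * assocF * iR assocF)%g.
Proof.
apply: actF_ext => z; rewrite !actFM.
have [z0|/ltW z0] := leP z 0; first by rewrite iLE iRE !(@actF_out _ assocF); lra.
have [z1|/ltW z1] := leP 1 z; first by rewrite iLE iRE !(@actF_out _ assocF); lra.
have [z2|/ltW z2] := leP z (1 / 2).
  have -> : actF (iR assocF) z = z by rewrite iRE actF_out; lra.
  rewrite (@assocF_l _ z); last by apply/andP; split.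
  rewrite iLE (_ : 2 * (z / 2) = z); last lra.
  by rewrite !assocF_l; [lra|apply/andP; split; lra..].
rewrite iRE iLE.
have [z3|/ltW z3] := leP z (3 / 4).
  rewrite (@assocF_m _ z); last by apply/andP; split.
  rewrite (@assocF_l _ (z - 1 / 4)); last by apply/andP; split; lra.
  rewrite (@assocF_l _ (2 * z - 1)); last by apply/andP; split; lra.
  rewrite (@assocF_m _ (1 / 2 + _)); last by apply/andP; split; lra.
  by rewrite assocF_m; [lra|apply/andP; split; lra].
rewrite (@assocF_r _ z); last by apply/andP; split.
have [z4|/ltW z4] := leP z (7 / 8).
  rewrite !(@assocF_m _ (2 * z - 1)); last by apply/andP; split; lra.
  rewrite (@assocF_m _ (1 / 2 + _)); last by apply/andP; split; lra.
  by rewrite assocF_r; [lra|apply/andP; split; lra].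
rewrite !(@assocF_r _ (2 * z - 1)); last by apply/andP; split; lra.
rewrite (@assocF_r _ (1 / 2 + _)); last by apply/andP; split; lra.
by rewrite actF_out; lra.
Qed.

Lemma derivedLR_assocF : derivedLR assocF.
Proof.
have e1 := eqK_trans (eqK_LR_RL assocF) (eqK_iL (inK_RL assocF)).
have e2 := eqK_trans (eqK_iR (inK_LR assocF)) (eqK_sym (eqK_LR_RL (iR assocF))).
have := congr1 (fun f => iL (iR f)) pentagon.
rewrite /derivedLR /= /iL /iR !copyM -/(iR _) -/(iL _).
move: e1 e2; rewrite /eqK /iL /iR.
set q := copy 0 1 (copy (1 / 2) 1 assocF); set p1 := copy 0 1 (copy (1 / 2) 1 (copy 0 1 _)).
set p2 := copy 0 1 (copy (1 / 2) 1 (copy (1 / 2) 1 _)).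
move=> k1 k2 qE.
(* The pentagon reads [q * q = p1 * q * p2] with [p1] and [p2] congruent to [q]; this expresses [q]
   through [q^-1 * p1] and [q^-1 * p2], which lie in [derivedK]. *)
have e : (((q^-1 * p1) ^ q) * q * (q^-1 * p2) = 1)%g.
  by rewrite conjgE !mulgA mulgK -!mulgA [(p1 * _)%g]mulgA -qE mulKg mulVg.
have -> : q = (((q^-1 * p1) ^ q)^-1 * (q^-1 * p2)^-1)%g.
  apply: (@mulgI _ ((q^-1 * p1) ^ q)%g); apply: (@mulIg _ (q^-1 * p2)%g).
  by rewrite e mulVKg mulVg.
apply: (subgroupM derivedK_subgroup); apply: (subgroupV derivedK_subgroup) => //.
exact: derivedK_conj.
Qed.

(** The tree whose left and right subtrees have charts [p] and [q], where [p] uses up the first [l]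
    leaves. *)
Definition joinF l (p q : R -> R) x := if x <= l then p x / 2 else (1 + q (x - l)) / 2.

(** The chart of the right comb with [n + 1] leaves, which serves as normal form for all
    subdivisions. *)
Fixpoint vine n x := if n is n'.+1 then joinF 1 id (vine n') x else x.

Lemma vine_itv n x : 0 <= x <= n.+1%:R -> 0 <= vine n x <= 1.
Proof.
elim: n x => [//|n IH] x; rewrite [vine _ _]/= /joinF -natr1 => /andP[x0 x1].
case: ifPn => [x2|]; first by apply/andP; split; lra.
rewrite -ltNge => x2; have [|] := andP (IH (x - 1) _); last by move=> ? ?; apply/andP; split; lra.
by apply/andP; split; lra.
Qed.

(** Induction on the left comb: [iR h] splits the rest of the long comb, and [assocF] moves its
    first leaf from a bracketing with the whole rest into the left factor. *)
Lemma vine_glue l m : exists2 h, derivedLR h & forall x, 0 <= x <= (l + m).+2%:R ->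
  joinF l.+1%:R (vine l) (vine m) x = actF h (vine (l + m).+1 x).
Proof.
elim: l => [|l [h hN hE]].
  by exists 1%g; [exact: subgroup1 derivedLR_subgroup|move=> x _; rewrite actF1].
exists (assocF * iR h)%g.
  by apply: (subgroupM derivedLR_subgroup); [exact: derivedLR_assocF|exact: derivedLR_iR].
move=> x xlm; rewrite actFM addSn [vine _.+2 x]/= -[joinF 1 id _ x]/(joinF 1 id (vine (l + m).+1) x).
move: xlm; rewrite addSn -(natr1 (l + m).+2) => /andP[x0 xlm].
rewrite /joinF -[l.+2%:R]natr1 -[vine l.+1 x]/(joinF 1 id (vine l) x) /joinF.
have l0 : 0 < l.+1%:R :> R by rewrite ltr0n.
have [x1|x1] := leP x 1.
  rewrite ifT; last lra.
  rewrite iRE [actF h _]actF_out; last by left; lra.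
  by rewrite assocF_l; [lra|apply/andP; split; lra].
rewrite iRE (_ : 2 * ((1 + vine (l + m).+1 (x - 1)) / 2) - 1 = vine (l + m).+1 (x - 1)); last lra.
rewrite -hE; last by apply/andP; split; lra.
rewrite /joinF (_ : (x - 1 <= l.+1%:R) = (x <= l.+1%:R + 1)); last by rewrite lerBlDr.
case: ifPn => x2.
  have /andP[? ?] : 0 <= vine l (x - 1) <= 1 by apply: vine_itv; apply/andP; split; lra.
  by rewrite assocF_m; [lra|apply/andP; split; lra].
rewrite -ltNge in x2; rewrite (_ : x - (l.+1%:R + 1) = x - 1 - l.+1%:R); last lra.
have /andP[? ?] : 0 <= vine m (x - 1 - l.+1%:R) <= 1.
  by apply: vine_itv; rewrite -natr1 in xlm *; move: xlm l0; rewrite -addSn natrD => *; apply/andP; split; lra.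
by rewrite assocF_r; [lra|apply/andP; split; lra].
Qed.

End Perfect.

(** * Dyadic subdivisions and perfectness of F' *)

Section Charts.
Variable R : realType.
Local Notation FT := (subgroup_type (thompsonF R)).
Local Notation assocF := (assocF R).
Local Notation inK := (@inK R).
Local Notation derivedLR := (@derivedLR R).
Local Notation vine := (@vine R).
Implicit Types (f g h k : FT) (x y a b : R) (P Q : R -> R).

(* [Q] maps the [n] unit intervals of [0, n] affinely onto the consecutive
   pieces of a partition of [0, 1] into standard dyadic intervals. *)
Definition dyadic_chart (n : nat) Q := [/\ Q 0 = 0, Q n%:R = 1 &
  forall i, (i < n)%N -> exists (d : nat) (p : int),
    forall x, i%:R <= x <= i.+1%:R -> Q x = 2 ^- d * (p%:~R + x)].

Lemma chart_step n Q i : dyadic_chart n Q -> (i < n)%N ->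
  exists d : nat, Q i.+1%:R = Q i%:R + 2 ^- d.
Proof.
move=> [_ _ Qi] /Qi[d [p pE]]; exists d.
by rewrite !pE ?lexx ?ler_nat ?leqnSn// -(natr1 i) addrA mulrDr mulr1.
Qed.

Lemma chart_lt n Q i j : dyadic_chart n Q -> (i < j)%N -> (j <= n)%N -> Q i%:R < Q j%:R.
Proof.
move=> Qn; elim: j => // j IH ij jn; have [d ->] := chart_step Qn jn.
have s0 := @pow2_gt0 R d.
move: ij; rewrite ltnS leq_eqVlt => /predU1P[->|ij]; first lra.
by have := IH ij (ltnW jn); lra.
Qed.

Lemma chart_le n Q i j : dyadic_chart n Q -> (i <= j)%N -> (j <= n)%N -> Q i%:R <= Q j%:R.
Proof.
by move=> Qn; rewrite leq_eqVlt => /predU1P[->//|ij] jn; apply: ltW; apply: chart_lt Qn ij jn.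
Qed.

Lemma chart_ge0 n Q i : dyadic_chart n Q -> (i <= n)%N -> 0 <= Q i%:R.
Proof.
by move=> Qn ni; have [Q0 _ _] := Qn; have := @chart_le n Q 0 i Qn isT ni; rewrite mulr0n Q0.
Qed.

(** A standard dyadic interval other than the whole one cannot have [1/2] in its interior, so the
    first division point that reaches [1/2] equals it. As both halves contain pieces, [l] is at most
    [n]. *)
Lemma chart_half n Q : dyadic_chart n.+2 Q -> exists2 l, (l <= n)%N & Q l.+1%:R = 1 / 2.
Proof.
move=> Qn; have [Q0 Q1 Qi] := Qn.
have ex : exists i, 1 / 2 <= Q i%:R by exists n.+2; rewrite Q1; lra.
case: (ex_minnP ex) => -[|l] lh lmin; first by rewrite Q0 in lh; lra.
have ln : (l < n.+2)%N by apply: lmin; rewrite Q1; lra.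
have l1 : Q l%:R < 1 / 2.
  by rewrite ltNge; apply/negP => /lmin; rewrite ltnn.
have [d [p pE]] := Qi l ln.
have dE : (2 : R) ^+ d * 2 ^- d = 1 by rewrite mulfV// expf_neq0// pnatr_eq0.
have s0 := @pow2_gt0 R d.
have El : Q l%:R = 2 ^- d * (p%:~R + l%:R) by apply: pE; rewrite lexx ler_nat leqnSn.
have Er : Q l.+1%:R = 2 ^- d * (p%:~R + l.+1%:R) by apply: pE; rewrite lexx ler_nat leqnSn.
pose q := p + l%:Z.
have qE : p%:~R + l%:R = q%:~R :> R by rewrite intrD.
have qE1 : p%:~R + l.+1%:R = (q + 1)%:~R :> R by rewrite !intrD -natr1 addrA.
rewrite qE in El; rewrite qE1 in Er.
(* A piece of length 1 is the whole interval, impossible with at least two pieces; for shorter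
   pieces the claim is the integrality step from [q < 2 ^+ d] to [q + 1 <= 2 ^+ d]. *)
case: d pE dE s0 El Er => [|d] pE dE s0 El Er.
  rewrite expr0 invr1 !mul1r in El Er.
  have q0 : q = 0.
    have : 0 <= Q l%:R by apply: chart_ge0 Qn _; exact: ltnW.
    have : (q%:~R : R) < 1%:~R by rewrite -El mulr1z; lra.
    by rewrite El ler0z ltr_int; lia.
  have l0 : l = 0%N.
    case: (posnP l) => // l0; have := chart_lt Qn l0 (ltnW ln).
    by rewrite mulr0n Q0 El q0 ltxx.
  have := @chart_lt _ _ l.+1 n.+2 Qn; rewrite Q1 Er q0 add0r mulr1z ltxx l0.
  by move=> /(_ isT (leqnn _)).
have e0 : 0 < (2 : R) ^+ d by rewrite exprn_gt0.
have eV : (2 : R) ^- d * 2 ^+ d = 1 by rewrite mulVf// gt_eqF.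
have qd : q + 1 <= (2 ^+ d : int).
  have : (q%:~R : R) < (2 ^+ d : int)%:~R.
    rewrite rmorphXn /=; move: l1; rewrite El exprS invfM; move: dE; rewrite exprS invfM.
    by move=> dE l1; rewrite -(ltr_pM2l (pow2_gt0 R d)) eV; lra.
  by rewrite ltr_int; lia.
have lh' : Q l.+1%:R <= 1 / 2.
  rewrite Er exprS invfM; move: qd; rewrite -(ler_int R) rmorphXn /= => qd.
  have : 2 ^- d * (q + 1)%:~R <= 2 ^- d * 2 ^+ d :> R by rewrite ler_pM2l// pow2_gt0.
  rewrite eV; lra.
exists l; last by apply/eqP; rewrite eq_le lh lh'.
rewrite leqNgt; apply/negP => nl; have lE : l = n.+1 by lia.
by move: lh'; rewrite lE Q1; lra.
Qed.

Lemma chart_left l n Q : dyadic_chart n.+2 Q -> (l <= n)%N -> Q l.+1%:R = 1 / 2 ->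
  dyadic_chart l.+1 (fun x => 2 * Q x).
Proof.
move=> Qn ln Ql; have [Q0 Q1 Qi] := Qn; split; [by rewrite Q0 mulr0|by rewrite Ql; lra|].
move=> i il; have iln : (i < n.+2)%N by lia.
have [d [p pE]] := Qi i iln.
have : 0 <= Q i%:R by apply: chart_ge0 Qn _; lia.
have : Q i.+1%:R <= 1 / 2 by rewrite -Ql; apply: chart_le Qn _ _ => //; lia.
rewrite !pE ?lexx ?ler_nat ?leqnSn// -(natr1 i) addrA => h1 h0.
case: d pE h1 h0 => [|d] pE h1 h0.
  by rewrite expr0 invr1 in h1 h0; lra.
exists d, p => x; rewrite natr1 => /pE ->; rewrite exprS invfM; lra.
Qed.

Lemma chart_right l n Q : dyadic_chart n.+2 Q -> (l <= n)%N -> Q l.+1%:R = 1 / 2 ->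
  dyadic_chart (n - l).+1 (fun x => 2 * Q (x + l.+1%:R) - 1).
Proof.
move=> Qn ln Ql; have [Q0 Q1 Qi] := Qn; split.
- by rewrite add0r Ql; lra.
- rewrite -natrD (_ : _ + _ = n.+2)%N; last lia.
  by rewrite Q1; lra.
move=> i il; have iln : (i + l.+1 < n.+2)%N by lia.
have [d [p pE]] := Qi _ iln.
have : 1 / 2 <= Q (i + l.+1)%:R by rewrite -Ql; apply: chart_le Qn _ _ => //; lia.
have : Q (i + l.+1).+1%:R <= 1.
  by have := @chart_le _ _ (i + l.+1).+1 n.+2 Qn; rewrite Q1; apply; lia.
rewrite !pE ?lexx ?ler_nat ?leqnSn// -(natr1 (i + _)) addrA => h1 h0.
case: d pE h1 h0 => [|d] pE h1 h0.
  by rewrite expr0 invr1 in h1 h0; lra.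
exists d, (p + l.+1%:Z - 2 ^+ d) => x /andP[ix xi].
rewrite pE; last by rewrite natrD -(natr1 (_ + _)) natrD; move: xi; rewrite -(natr1 i) => xi; apply/andP; split; lra.
rewrite !intrD rmorphN rmorphXn /= exprS invfM.
have -> : (l.+1%:Z)%:~R = l.+1%:R :> R by [].
have dE : (2 : R) ^- d * 2 ^+ d = 1 by rewrite mulVf// expf_neq0// pnatr_eq0.
rewrite [in RHS](_ : p%:~R + l.+1%:R - 2 ^+ d + x = (p%:~R + (x + l.+1%:R)) - 2 ^+ d); last by ring.
by rewrite [RHS]mulrBr dE; lra.
Qed.

(** Split at [1/2] and treat both halves by induction. The product first re-brackets the comb into
    two combs by [k], then corrects each half. *)
Lemma chart_vine n Q : dyadic_chart n.+1 Q ->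
  exists2 g, derivedLR g & forall x, 0 <= x <= n.+1%:R -> Q x = actF g (vine n x).
Proof.
have [m] := ubnP n; elim: m n Q => // m IH [|n] Q nm Qn.
  exists 1%g; first exact: subgroup1 (@derivedLR_subgroup R).
  have [Q0 Q1 Qi] := Qn; have [d [p pE]] := Qi 0%N isT.
  have p0 : p%:~R = 0 :> R.
    have := pE 0; rewrite lexx ler01 Q0 addr0 => /(_ isT)/esym/eqP.
    by rewrite mulf_eq0 gt_eqF ?pow2_gt0//= => /eqP.
  have d1 : (2 : R) ^- d = 1.
    by have := pE 1; rewrite lexx ler01 Q1 p0 add0r mulr1 => /(_ isT).
  by move=> x /pE ->; rewrite d1 p0 add0r mul1r actF1.
have [l ln Ql] := chart_half Qn.
have [|g gN gE] := IH _ _ _ (chart_left Qn ln Ql); first lia.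
have [|h hN hE] := IH _ _ _ (chart_right Qn ln Ql); first lia.
have [k kN kE] := vine_glue R l (n - l).
exists (iL g * iR h * k)%g.
  apply: (subgroupM (@derivedLR_subgroup R)) => //; apply: (subgroupM (@derivedLR_subgroup R)).
    exact: derivedLR_iL.
  exact: derivedLR_iR.
move=> x xn; rewrite subnKC// in kE; rewrite !actFM -kE// /joinF.
have [xl|lx] := leP x l.+1%:R.
  have := gE x; rewrite xl andbT => /(_ (andP xn).1) gx.
  have /andP[v0 v1] : 0 <= vine l x <= 1 by apply: vine_itv; rewrite xl; case/andP: xn => ->.
  rewrite iRE [actF h _]actF_out; last by left; lra.
  rewrite iLE (_ : 2 * (_ + _) = vine l x); last lra.
  by rewrite -gx; lra.
have xE : x - l.+1%:R + l.+1%:R = x by rewrite subrK.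
have xb : 0 <= x - l.+1%:R <= (n - l).+1%:R.
  rewrite -subSn// -[(n.+1 - l)%N]subSS natrB ?ltnS ?(leq_trans ln)//; case/andP: xn => _ xn.
  by apply/andP; split; lra.
have hx := hE _ xb; rewrite xE in hx.
have /andP[v0 v1] := vine_itv xb.
rewrite iRE (_ : 2 * _ - 1 = vine (n - l) (x - l.+1%:R)); last lra.
have := actF_itv h (vine_itv xb); rewrite -hx => /andP[a0 a1].
by rewrite iLE actF_out; [lra|right; lra].
Qed.


Lemma common_denominator (B : seq R) : (forall c, c \in B -> dyadic c) ->
  exists N : nat, forall c, c \in B -> exists z : int, c = z%:~R / 2 ^+ N.
Proof.
elim: B => [|b B IH] Bd; first by exists 0%N.
have [c cB|N NB] := IH; first by apply: Bd; rewrite inE cB orbT.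
have [z [n bE]] := Bd b (mem_head _ _).
have up (c : R) (y : int) (i j : nat) : c = y%:~R / 2 ^+ i -> exists z : int, c = z%:~R / 2 ^+ (i + j).
  move=> ->; exists (y * 2 ^+ j); rewrite intrM rmorphXn /= exprD invfM mulrACA.
  by rewrite mulfV ?mulr1// expf_neq0// pnatr_eq0.
exists (n + N)%N => c; rewrite inE => /predU1P[->|/NB[y yE]]; first exact: up bE.
by rewrite addnC; exact: up yE.
Qed.

Lemma eventually_all (P : nat -> nat -> Prop) (K : nat) :
  (forall i, (i < K)%N -> exists M, forall N, (M <= N)%N -> P i N) ->
  exists M, forall N i, (M <= N)%N -> (i < K)%N -> P i N.
Proof.
elim: K => [|K IH] PK; first by exists 0%N.
have [i iK|M MP] := IH; first exact/PK/ltnW.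
have [M' MP'] := PK K (ltnSn K).
exists (maxn M M') => N i; rewrite geq_max ltnS [(i <= K)%N]leq_eqVlt => /andP[MN MN'].
by case/predU1P=> [->|iK]; [exact: MP'|exact: MP].
Qed.

(* After [N0] halvings [f] is affine on every standard dyadic interval, and
   after sufficiently many further ones their images are standard as well. *)
Lemma chart_ex f : exists N : nat, dyadic_chart (2 ^ N) (fun y => actF f (y / 2 ^+ N)).
Proof.
have [B Bd BP] := actF_piecewise f; have [N0 BN] := common_denominator Bd.
have e0 (n : nat) : 0 < (2 : R) ^+ n by rewrite exprn_gt0.
pose P i N := (N0 <= N)%N -> exists (d : nat) (p : int), forall x, i%:R / 2 ^+ N0 <= x <= i.+1%:R / 2 ^+ N0 ->
  actF f x = 2 ^- d * (p%:~R + 2 ^+ N * x).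
have [i iN0|M MP] := @eventually_all P (2 ^ N0).
  have ii : i%:R / 2 ^+ N0 < i.+1%:R / 2 ^+ N0 :> R by rewrite ltr_pM2r ?invr_gt0// ltr_nat.
  have [||c cB /andP[ic ci]|m mE] := BP (i%:R / 2 ^+ N0) (i.+1%:R / 2 ^+ N0) _ ii.
  - by rewrite divr_ge0 ?ler0n// ltW.
  - by rewrite ler_pdivrMr// mul1r -natrX ler_nat.
  - have [z cE] := BN c cB; move: ic ci; rewrite cE !ltr_pM2r ?invr_gt0//.
    by rewrite -[i%:R]/((i%:Z)%:~R) -[i.+1%:R]/((i.+1%:Z)%:~R) !ltr_int; lia.
  have [z [e fE]] : dyadic (actF f (i%:R / 2 ^+ N0)).
    by apply/actF_dyadic; exists i%:Z, N0.
  (* Slope [2 ^ m] turns length [2 ^- N] into [2 ^- d] with [d = N - m]. The bound on [N] makes [d]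
     a natural number with [e <= d], so the images also start at multiples of [2 ^- d]. *)
  exists (`|m| + e)%N => N MN N0N; pose d := `|N%:Z - m|%N.
  have dE : d%:Z = N%:Z - m by rewrite /d; lia.
  exists d, (z * 2 ^+ (d - e) - i%:Z * 2 ^+ (N - N0)) => x xi; rewrite mE// fE.
  have -> : (2 : R) ^ m = 2 ^- d * 2 ^+ N.
    rewrite exprnN -[2 ^+ N]/(2 ^ N%:Z) -expfzDr ?pnatr_eq0//; congr (_ ^ _); lia.
  have ed : (e <= d)%N by lia.
  rewrite rmorphB !rmorphM !rmorphXn /=.
  have -> : z%:~R / 2 ^+ e = 2 ^- d * (z%:~R * 2 ^+ (d - e)) :> R.
    rewrite -[in 2 ^- d](subnK ed) exprD invfM [z%:~R * 2 ^+ _]mulrC mulrACA mulVf ?gt_eqF//.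
    by rewrite mul1r mulrC.
  have -> : (i%:Z)%:~R * 2 ^+ (N - N0) = 2 ^+ N * (i%:R / 2 ^+ N0) :> R.
    rewrite -[in 2 ^+ N](subnK N0N) exprD -mulrA mulrC; congr (_ * _).
    by rewrite mulrC divfK// gt_eqF.
  by ring.
exists (maxn M N0); set N := maxn M N0.
have MN : (M <= N)%N by rewrite leq_maxl.
have N0N : (N0 <= N)%N by rewrite leq_maxr.
split; first by rewrite mul0r actF_0.
  by rewrite natrX mulfV ?actF_1// gt_eqF.
move=> j jN.
have NE : (2 ^ N = 2 ^ (N - N0) * 2 ^ N0)%N by rewrite -expnD subnK.
have iN : (j %/ 2 ^ (N - N0) < 2 ^ N0)%N by rewrite ltn_divLR ?expn_gt0// mulnC -NE.
have [d [p pE]] := MP _ _ MN iN N0N; exists d, p => x /andP[jx xj].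
rewrite pE; last first.
  have NR : (2 : R) ^+ N = 2 ^+ (N - N0) * 2 ^+ N0 by rewrite -exprD subnK.
  rewrite NR invfM mulrA !ler_pM2r ?invr_gt0// ler_pdivlMr// ler_pdivrMr//.
  rewrite -natrX -!natrM; apply/andP; split.
    by apply: le_trans jx; rewrite ler_nat leq_divM.
  apply: le_trans xj _; rewrite ler_nat.
  by rewrite ltn_ceil// expn_gt0.
by rewrite mulrCA mulfV ?mulr1// gt_eqF.
Qed.

(** A fine subdivision and its image under [f] are both the same comb up to elements of [derivedLR];
    [f] is the quotient of these two. *)
Lemma derivedLR_all f : derivedLR f.
Proof.
have [N fN] := chart_ex f; have e0 : 0 < (2 : R) ^+ N by rewrite exprn_gt0.
have idN : dyadic_chart (2 ^ N) (fun y : R => y / 2 ^+ N).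
  split; [by rewrite mul0r|by rewrite natrX mulfV// gt_eqF|].
  by move=> i _; exists N, 0 => x _; rewrite add0r mulrC.
have n0 : (0 < 2 ^ N)%N by rewrite expn_gt0.
rewrite -(prednK n0) in fN idN.
have [g gN gE] := chart_vine fN; have [h hN hE] := chart_vine idN.
rewrite prednK// natrX in gE hE.
have -> : f = (g * h^-1)%g; last exact: (@derivedLR_subgroup R).2.
apply: actF_ext => z.
have [z0|/ltW z0] := leP z 0; first by rewrite !actF_out//; left.
have [z1|/ltW z1] := leP 1 z; first by rewrite !actF_out//; right.
have zN : 0 <= 2 ^+ N * z <= 2 ^+ N by rewrite mulr_ge0 ?(ltW e0)//= ler_piMr// ltW.
have zE : 2 ^+ N * z / 2 ^+ N = z by rewrite mulrAC mulfV ?mul1r// gt_eqF.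
have := hE _ zN; rewrite zE => /(congr1 (actF h^-1%g)); rewrite actFK actFM => ->.
by have /= := gE _ zN; rewrite zE.
Qed.

(** A compactly supported [f] has the same class as its copy [iL (iR f)], and that class vanishes by
    [derivedLR_all]. *)
Lemma inK_perfect f : inK f -> derivedK f.
Proof.
move=> fK; apply: eqK_derivedK (derivedLR_all f); apply: eqK_sym.
apply: eqK_trans (eqK_iR fK) _; apply: eqK_iL.
have [a [b [a0 b1 fab]]] := fK; exists ((a + 1) / 2), ((b + 1) / 2).
by split; [lra|lra|exact: iR_supp].
Qed.

End Charts.

Lemma generated_commutatorsJ (G : groupType) (S T : set G) (h x : G) :
  (forall s, S s -> T (s ^ h)%g) -> generated (commutators S) x ->
  generated (commutators T) (x ^ h)%g.
Proof.
move=> ST; apply: (generated_min (S := [set x | generated (commutators T) (x ^ h)%g])).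
  have [T1 TM] := generated_subgroup (commutators T).
  by split=> [|y z Ty Tz]; rewrite /= ?conj1g ?conjMg ?conjVg; [exact: T1|exact: TM].
move=> _ [a [b [aS bS ->]]] /=; rewrite conjRg; apply: generated_sub.
by exists (a ^ h)%g, (b ^ h)%g; split=> //; exact: ST.
Qed.

(** * Near-triviality of F' *)

Section DerivedF.
Variable R : realType.
Local Notation FT := (subgroup_type (thompsonF R)).
Local Notation DF := (subgroup_type (derived_subgroup FT)).
Local Notation assocF := (assocF R).
Local Notation inK := (@inK R).
Implicit Types (f g h k : FT) (x y a b : R) (c d : DF).

Lemma inK_commg f g : inK [~ f, g]%g.
Proof.
have [[m fm] [m' fm']] := (germ0_ex f, germ0_ex (flip f)).
have [[n gn] [n' gn']] := (germ0_ex g, germ0_ex (flip g)).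
have comm (i j : int) : - i + (- j + i + j) = 0 by ring.
rewrite commgEl conjgE; apply/inK_germ; split.
  have := germ0M (germ0V fm) (germ0M (germ0M (germ0V gn) fm) gn).
  by rewrite (comm m n).
have := germ0M (germ0V fm') (germ0M (germ0M (germ0V gn') fm') gn').
by rewrite /germ1 !flipM !flipV (comm m' n').
Qed.

Lemma derived_inK f : subgroup_set (derived_subgroup FT) f <-> inK f.
Proof.
split.
  apply: generated_min; first exact: inK_subgroup.
  by move=> _ [g [h ->]]; exact: inK_commg.
move=> /inK_perfect; apply: generatedS => _ [g [h [_ _ ->]]]; by exists g, h.
Qed.

Definition incl d : FT := val d.

Lemma inclM : {morph incl : c d / (c * d)%g}. Proof. by []. Qed.

Lemma incl_inj : injective incl. Proof. exact: val_inj. Qed.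

Lemma incl1 : incl 1%g = 1%g.
Proof. by apply: (@mulgI _ (incl 1%g)); rewrite -inclM !mulg1. Qed.

Lemma inclV d : incl d^-1%g = (incl d)^-1%g.
Proof. by apply: (@mulgI _ (incl d)); rewrite -inclM !mulgV incl1. Qed.

Lemma inclJ c d : incl (c ^ d)%g = (incl c ^ incl d)%g.
Proof. by rewrite !conjgE !inclM inclV. Qed.

Lemma inclR c d : incl [~ c, d]%g = [~ incl c, incl d]%g.
Proof. by rewrite !commgEl inclM inclV inclJ. Qed.

Lemma inclX d n : incl (d ^+ n)%g = (incl d ^+ n)%g.
Proof. by elim: n => [|n IH]; rewrite ?incl1// !expgS inclM IH. Qed.

Lemma DF_inK d : inK (incl d).
Proof. by apply/derived_inK; have := valP d; rewrite inE. Qed.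

Lemma inK_DF f : inK f -> exists d, incl d = f.
Proof. by move=> /derived_inK fD; exists (exist _ f (mem_set fD)). Qed.

Definition suppD a b : set DF := [set d | suppF a b (incl d)].

Lemma suppD_subgroup a b : is_subgroup (suppD a b).
Proof.
have [S1 SF] := @suppF_subgroup R a b.
by split=> [|c d cab dab]; rewrite /suppD /= ?incl1 ?inclM ?inclV; [exact: S1|exact: SF].
Qed.

(** By perfectness, an element of F' is a finite product of commutators of elements of F', whose
    supports lie in a common [[a, b]]. The passage through [incl] is needed because [derivedK] is a
    subset of F. *)
Lemma DF_commutators d : exists a b, [/\ 0 < a, b < 1 & generated (commutators (suppD a b)) d].
Proof.
pose A d := exists a b, [/\ 0 < a, b < 1 & generated (commutators (suppD a b)) d].
suff /(_ _ (inK_perfect (DF_inK d))) : @derivedK R `<=` [set f | exists2 c, incl c = f & A c].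
  by move=> [c /incl_inj <-].
have up a b a' b' c : a' <= a -> b <= b' -> generated (commutators (suppD a b)) c ->
    generated (commutators (suppD a' b')) c.
  move=> aa bb; apply: generatedS => _ [x [y [xab yab ->]]].
  by exists x, y; split=> //; apply: suppFW aa bb _.
apply: generated_min.
  split; first by exists 1%g; [exact: incl1|]; exists (1 / 2), (1 / 2); split; [lra|lra|exact: (generated_subgroup _).1].
  move=> _ _ [c <- [a [b [a0 b1 cab]]]] [e <- [a' [b' [a0' b1' eab]]]].
  exists (c / e)%g; [by rewrite inclM inclV|]; exists (Num.min a a'), (Num.max b b'); split.
  - by rewrite lt_min a0.
  - by rewrite gt_max b1.
  apply: (generated_subgroup _).2.
    by apply: up cab; rewrite ?ge_min ?le_max lexx.
  by apply: up eab; rewrite ?ge_min ?le_max lexx orbT.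
move=> _ [f [g [fK gK ->]]].
have [x xE] := inK_DF fK; have [y yE] := inK_DF gK.
have [a [b [a0 b1 fab]]] := fK; have [a' [b' [a0' b1' gab]]] := gK.
exists [~ x, y]%g; first by rewrite inclR xE yE.
exists (Num.min a a'), (Num.max b b'); split.
- by rewrite lt_min a0.
- by rewrite gt_max b1.
apply: generated_sub; exists x, y; split=> //; rewrite /suppD /= ?xE ?yE.
  by apply: suppFW fab; rewrite ?ge_min ?le_max lexx.
by apply: suppFW gab; rewrite ?ge_min ?le_max lexx orbT.
Qed.

Lemma compressD a b : 0 < a -> b < 1 ->
  exists h : DF, forall d, suppD a b d -> suppD (7 / 16) (9 / 16) (d ^ h)%g.
Proof.
(* Enlarging the interval to contain [1/2] ensures [a' <= b'], which [compress] requires. *)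
move=> a0 b1; pose a' := Num.min a (1 / 2); pose b' := Num.max b (1 / 2).
have a'0 : 0 < a' by rewrite lt_min a0; lra.
have b'1 : b' < 1 by rewrite gt_max b1; lra.
have ab' : a' <= b' by apply: (@le_trans _ _ (1 / 2)); rewrite ?ge_min ?le_max lexx orbT.
have [h [hK ha hb]] := compress a'0 ab' b'1; have [c cE] := inK_DF hK.
exists c^-1%g => d dab; apply: (suppFW ha hb).
have : suppF a' b' (incl d) by apply: suppFW dab; rewrite ?ge_min ?le_max lexx.
by rewrite /suppD /= inclJ inclV cE; exact: suppF_conj.
Qed.

(* [assocF^-1] moves [7/16] to [11/16], so the powers of its truncation [k]
   displace the interval [7/16, 9/16] from itself. *)
Lemma near_trivial_DF : near_trivial R [set: DF].
Proof.
have a7 : 0 < 7 / 16 :> R by lra.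
have b7 : 7 / 16 < 1 :> R by lra.
have [k kK kE] := truncate assocF^-1%g a7 b7.
have [s sE] := inK_DF kK; have [a [b [a0 b1 kab]]] := kK.
(* The interval for [Q] covers both [[7/16, 9/16]] and the support of [k]. *)
have [||h hP] := @compressD (Num.min a (7 / 16)) (Num.max b (9 / 16)).
- by rewrite lt_min a0.
- by rewrite gt_max b1; lra.
have sn n : 9 / 16 <= actF (k ^+ n.+1)%g (7 / 16).
  have k7 : actF k (7 / 16) = 11 / 16.
    by rewrite kE ?lexx// assocFV_m; [lra|apply/andP; split; lra].
  suff : 11 / 16 <= actF (k ^+ n.+1)%g (7 / 16) by lra.
  elim: n => [|n IH]; first by rewrite expg1 k7.
  by rewrite expgS actFM -[X in X <= _]k7 actF_leE; lra.
have nt : near_trivial R (generated (commutators (suppD (7 / 16) (9 / 16)))).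
  apply: (@near_trivial_displaced _ _ _ (suppD (Num.min a (7 / 16)) (Num.max b (9 / 16))) s^-1%g h).
  - exact: suppD_subgroup.
  - exact: suppD_subgroup.
  - by move=> d; apply: suppFW; rewrite ?ge_min ?le_max lexx orbT.
  - apply: (subgroupV (suppD_subgroup _ _)); rewrite /suppD /= sE.
    by apply: suppFW kab; rewrite ?ge_min ?le_max lexx.
  - move=> n x y xP yP; apply: incl_inj.
    have xs := suppF_conj (h := (k ^+ n.+1)%g) xP;     rewrite [LHS]inclM [RHS]inclM inclJ inclX inclV sE expVgn.
    apply/commute_sym; apply: commute_suppF yP xs; exact: sn.
  - exact: hP.
apply: near_trivialJ nt _ => d _.
have [a' [b' [a0' b1' dg]]] := DF_commutators d.
have [h' h'P] := compressD a0' b1'.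
exists (d ^ h')%g, h'^-1%g; rewrite conjgK; split=> //.
exact: generated_commutatorsJ dg.
Qed.

Lemma near_trivial_inK : near_trivial R inK.
Proof.
apply: near_trivialS (near_trivial_image inclM near_trivial_DF).
by move=> f /inK_DF[d <-]; exists d.
Qed.

End DerivedF.

(** * The abelianization of F *)

Section StableF.
Variables (R : realType) (omega : set_system nat).
Local Notation FT := (subgroup_type (thompsonF R)).
Implicit Types (f g : FT).

(** The binary logarithms of the slopes at 0 and at 1, which identify the abelianization of F with
    Z^2. *)
Definition end_slopes f : int * int :=
  (sval (cid (germ0_ex f)), sval (cid (germ0_ex (flip f)))).

Lemma end_slopesP f m n : germ0 f m -> germ1 f n -> end_slopes f = (m, n).
Proof.
move=> fm fn; rewrite /end_slopes; case: cid => m' fm'; case: cid => n' fn' /=.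
by rewrite (germ0_uniq fm' fm) (germ0_uniq fn' fn).
Qed.

Lemma end_slopes_germ f : germ0 f (end_slopes f).1 /\ germ1 f (end_slopes f).2.
Proof. by split; rewrite /=; [exact: svalP (cid (germ0_ex f))|exact: svalP (cid (germ0_ex (flip f)))]. Qed.

Lemma end_slopesM f g : end_slopes (f * g)%g = end_slopes f + end_slopes g.
Proof.
have [f0 f1] := end_slopes_germ f; have [g0 g1] := end_slopes_germ g.
rewrite (@end_slopesP _ ((end_slopes f).1 + (end_slopes g).1) ((end_slopes f).2 + (end_slopes g).2)) //.
  exact: germ0M.
by rewrite /germ1 flipM; exact: germ0M.
Qed.

Lemma end_slopes_surj (a : int * int) : exists f, end_slopes f = a.
Proof.
case: a => m n; have h0 : 0 < 1 / 2 :> R by lra.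
have [g gm gs] := local_germ0 m h0; have [h hn hs] := local_germ0 n h0.
exists (g * flip h)%g; apply: end_slopesP.
  rewrite -[m]addr0; apply: germ0M => //.
  by have := suppF_flip hs; apply: germ0_supp; lra.
rewrite /germ1 flipM flipK -[n]add0r; apply: germ0M => //.
by have := suppF_flip gs; apply: germ0_supp; lra.
Qed.

End StableF.

(** * Near-triviality of T *)

Section ThompsonTElements.
Variable R : realType.
Local Notation FT := (subgroup_type (thompsonF R)).
Local Notation TT := (subgroup_type (thompsonT R)).
Local Notation CT := (circle R).
Implicit Types (f g : FT) (s t : TT) (x y a b : R) (phi psi : R -> R) (z : CT).

Definition actT t z : CT := homeo_fun (val t) z.

Lemma actTM s t z : actT (s * t)%g z = actT s (actT t z).
Proof. by []. Qed.

Lemma actT_ext s t : actT s =1 actT t -> s = t.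
Proof. by move=> st; apply: val_inj; apply: homeo_eq. Qed.

Lemma actT1 z : actT 1%g z = z.
Proof. by []. Qed.

Lemma actTK t : cancel (actT t) (actT t^-1%g).
Proof. by move=> z; rewrite -actTM mulVg. Qed.

Lemma actTKV t : cancel (actT t^-1%g) (actT t).
Proof. by move=> z; rewrite -actTM mulgV. Qed.

Definition lifts t phi := forall x, actT t (circle_proj x) = circle_proj (phi x).

Lemma liftsM s t phi psi : lifts s phi -> lifts t psi -> lifts (s * t)%g (phi \o psi).
Proof. by move=> sp tp x; rewrite actTM tp sp. Qed.

Lemma lifts_ext s t phi psi : lifts s phi -> lifts t psi ->
  (forall z, exists2 x, circle_proj x = z & circle_proj (phi x) = circle_proj (psi x)) -> s = t.
Proof. by move=> sp tp pp; apply: actT_ext => z; have [x <- e] := pp z; rewrite sp tp. Qed.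

Lemma thompsonTP t : thompsonT_set (val t).
Proof. by have := valP t; rewrite inE. Qed.

Lemma circle_projD x (n : int) : circle_proj (x + n%:~R) = circle_proj x.
Proof. by apply/circle_projP; exists n. Qed.

Lemma circle_rep a z : exists2 x, a <= x < a + 1 & circle_proj x = z.
Proof.
have [y yz] := circle_proj_surj z; pose n := Num.floor (y - a).
exists (y - n%:~R); last by rewrite -yz -(circle_projD (y - _) n) subrK.
have := floor_itv (y - a); rewrite -/n intrD mulr1z => /andP[? ?].
by apply/andP; split; lra.
Qed.

Section Build.
Variables phi psi : R -> R.
Hypotheses (phiK : cancel phi psi) (psiK : cancel psi phi).
Hypothesis phi1 : forall x, phi (x + 1) = phi x + 1.
Hypothesis phi_lt : forall x y, x < y -> phi x < phi y.

Lemma shift_int x (n : int) : phi (x + n%:~R) = phi x + n%:~R.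
Proof.
have pos (k : nat) y : phi (y + k%:R) = phi y + k%:R.
  by elim: k => [|k IH]; rewrite ?addr0// -natr1 !addrA phi1 IH.
case: n => k; first exact: pos.
by rewrite NegzE rmorphN /= -[in RHS](subrK (k.+1%:R) x) pos addrK.
Qed.

Lemma descend_ex : exists2 h : CT -> CT, continuous h & forall x, h (circle_proj x) = circle_proj (phi x).
Proof.
pose rep z := sval (cid (circle_proj_surj z)).
have repK z : circle_proj (rep z) = z := svalP (cid (circle_proj_surj z)).
have hE x : circle_proj (phi (rep (circle_proj x))) = circle_proj (phi x).
  have /circle_projP[n ->] := repK (circle_proj x).
  by rewrite shift_int circle_projD.
exists (fun z => circle_proj (phi (rep z))) => //.
apply/quotient_continuous.
rewrite (_ : _ \o _ = @circle_proj R \o phi); last by apply/funext => x; exact: hE.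
move=> x; apply: continuous_comp; first exact: increasing_continuous phiK psiK phi_lt _.
exact: pi_continuous.
Qed.

End Build.

Lemma thompsonT_build phi psi : cancel phi psi -> cancel psi phi ->
  (forall x, phi (x + 1) = phi x + 1) -> (forall x y, x < y -> phi x < phi y) ->
  (forall x, dyadic (phi x) <-> dyadic x) -> circle_PL_dyadic phi ->
  exists t, lifts t phi.
Proof.
move=> phiK psiK phi1 phi_lt phid PL.
have psi1 x : psi (x + 1) = psi x + 1 by rewrite -[in LHS](psiK x) -phi1 phiK.
have psi_lt := inverse_lt psiK phi_lt.
have [h hc hE] := descend_ex phiK psiK phi1 phi_lt.
have [k kc kE] := descend_ex psiK phiK psi1 psi_lt.
have hK : cancel h k.
  by move=> z; have [x <-] := circle_proj_surj z; rewrite hE kE phiK.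
have kK : cancel k h.
  by move=> z; have [x <-] := circle_proj_surj z; rewrite kE hE psiK.
pose H := Homeo hK kK hc kc.
have HT : H \in (thompsonT R : set _).
  rewrite inE; split; last by exists phi => //; split=> // x; rewrite /H /= hE.
  apply/seteqP; split=> z /=.
    by move=> [_ [x dx <-] <-]; exists (phi x); [exact/phid|rewrite /H /= hE].
  move=> [x dx <-]; exists (circle_proj (psi x)); last by rewrite /H /= hE psiK.
  by exists (psi x) => //; apply/phid; rewrite psiK.
by exists (exist _ H HT) => x; exact: hE.
Qed.

Lemma rot_ex a : exists t, dyadic a -> lifts t (+%R a).
Proof.
have [da|nda] := pselect (dyadic a); last by exists 1%g.
have [||x|x y|x||t] := @thompsonT_build (+%R a) (+%R (- a)); last by exists t.
- exact: addKr.
- exact: addNKr.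
- by rewrite addrA.
- by rewrite ltrD2l.
- split=> [/(dyadicB)/(_ da)|]; last exact: dyadicD.
  by rewrite addrAC subrr add0r.
- exists set0; split=> // u v _ _; exists 0 => x _; rewrite expr0z mul1r; lra.
Qed.

Definition rot a : TT := sval (cid (rot_ex a)).

Lemma rotE a : dyadic a -> lifts (rot a) (+%R a).
Proof. exact: svalP (cid (rot_ex a)). Qed.

Definition periodize f x : R := actF f (x - (Num.floor x)%:~R) + (Num.floor x)%:~R.

Lemma periodize_itv f (n : int) x : n%:~R <= x <= n%:~R + 1 ->
  periodize f x = actF f (x - n%:~R) + n%:~R.
Proof.
move=> /andP[nx]; rewrite le_eqVlt => /predU1P[->|xn]; rewrite /periodize.
  have -> : n%:~R + 1 - n%:~R = 1 :> R by ring.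
  by rewrite -[1 in LHS]mulr1z -intrD intrKfloor subrr actF_0 intrD mulr1z actF_1; ring.
by rewrite (@floor_def _ x n)// intrD mulr1z nx.
Qed.

Lemma floor_lin x : exists2 n : int, n = Num.floor x & n%:~R <= x < n%:~R + 1.
Proof. by exists (Num.floor x) => //; have := floor_itv x; rewrite intrD mulr1z. Qed.

Lemma periodize_floor f x : Num.floor (periodize f x) = Num.floor x.
Proof.
have [n nE /andP[n0 n1]] := floor_lin x; rewrite /periodize -nE; apply: floor_def.
rewrite intrD mulr1z -lerBlDr subrr -(actF_0 f) actF_leE subr_ge0 n0 /=.
by rewrite addrC ltrD2l -[ltRHS](actF_1 f) actF_ltE; lra.
Qed.

Lemma periodizeM f g x : periodize (f * g)%g x = periodize f (periodize g x).
Proof.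
rewrite {2}/periodize periodize_floor /periodize actFM; congr (actF f _ + _); ring.
Qed.

Lemma periodize1 x : periodize 1%g x = x.
Proof. by rewrite /periodize actF1 subrK. Qed.

Lemma iota_ex f : exists t, lifts t (periodize f).
Proof.
apply: (@thompsonT_build _ (periodize f^-1%g)).
- by move=> x; rewrite -periodizeM mulVg periodize1.
- by move=> x; rewrite -periodizeM mulgV periodize1.
- move=> x; rewrite /periodize floorDrz ?int_num1// floor1 intrD mulr1z.
  by rewrite addrA; congr (actF f _ + _ + 1); ring.
- move=> x y xy; have [n nE /andP[n0 n1]] := floor_lin x; have [m mE /andP[m0 m1]] := floor_lin y.
  rewrite /periodize -nE -mE.
  have [nm|nm] := eqVneq n m; first by rewrite nm ltrD2r actF_ltE; lra.
  have nm1 : n + 1 <= m.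
    have : (n%:~R : R) < (m + 1)%:~R by rewrite intrD mulr1z; lra.
    by rewrite ltr_int; lia.
  have : (n + 1)%:~R <= m%:~R :> R by rewrite ler_int.
  rewrite intrD mulr1z => nm2.
  have : actF f (x - n%:~R) < 1 by rewrite -[ltRHS](actF_1 f) actF_ltE; lra.
  have : 0 <= actF f (y - m%:~R) by rewrite -[X in X <= _](actF_0 f) actF_leE; lra.
  lra.
- move=> x; rewrite /periodize; set n := Num.floor x; split.
    move=> /(dyadicB)/(_ (dyadic_int R n)); rewrite addrK => /actF_dyadic.
    by move=> /dyadicD/(_ (dyadic_int R n)); rewrite subrK.
  move=> dx; apply: dyadicD; last exact: dyadic_int.
  by apply/actF_dyadic; apply: dyadicB => //; exact: dyadic_int.
have [B Bd BP] := actF_piecewise f.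
(* The point 0 is added since the slopes of [f] at the two ends, which meet at the integers, may
   differ. *)
exists (@circle_proj R @` [set x | x \in 0 :: B]); split.
- exact/finite_image/finite_seq.
- move=> _ [x xB <-]; exists x => //; move: xB; rewrite /= inE => /predU1P[->|/Bd//]; exact: dyadic0.
- move=> a b ab nB; have [n nE /andP[n0 n1]] := floor_lin a.
  have bn : b <= n%:~R + 1.
    rewrite leNgt; apply/negP => nb; apply: (nB (n%:~R + 1)); first by rewrite n1 nb.
    exists 0; first by rewrite /= mem_head.
    by rewrite -[1]mulr1z -intrD -[(n + 1)%:~R]add0r circle_projD.
  have [||||m mE] := BP (a - n%:~R) (b - n%:~R); [lra|lra|lra| |].
    move=> c cB /andP[ac cb]; apply: (nB (c + n%:~R)); first by apply/andP; split; lra.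
    by exists c; [rewrite /= inE cB orbT|rewrite circle_projD].
  exists m => x /andP[ax xb]; rewrite !(@periodize_itv f n).
  + rewrite mE; last by apply/andP; split; lra.
    by ring.
  + by apply/andP; split; lra.
  + by apply/andP; split; lra.
Qed.

Definition iota f : TT := sval (cid (iota_ex f)).

Lemma iotaE f : lifts (iota f) (periodize f).
Proof. exact: svalP (cid (iota_ex f)). Qed.

Lemma iotaM : {morph iota : f g / (f * g)%g}.
Proof.
move=> f g; apply: lifts_ext (iotaE _) (liftsM (iotaE f) (iotaE g)) _ => z.
by have [x xz] := circle_proj_surj z; exists x; rewrite ?periodizeM.
Qed.

Lemma periodize_copy u n f x : fits u n -> u <= x <= u + 1 ->
  periodize (copy u n f) x = u + 2 ^- n * actF f (2 ^+ n * (x - u)).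
Proof.
move=> un /andP[ux xu]; have [_ u0 u1] := un; have s0 := @pow2_gt0 R n.
have cs := suppF_copy f un.
have [x1|/ltW x1] := leP x 1.
  by rewrite (@periodize_itv _ 0) ?mulr0z ?subr0 ?addr0 ?copyE//; apply/andP; split; lra.
rewrite (@periodize_itv _ 1); last by rewrite mulr1z; apply/andP; split; lra.
rewrite mulr1z -copyE// !cs; [lra|right; lra|left; lra].
Qed.

(** Rotation by [a] carries the brick at [u] to the brick at [u + a]. Unlike conjugation in F, this
    can move a brick away from the end points. *)
Lemma iota_copy u n f a : fits u n -> fits (u + a) n -> dyadic a ->
  iota (copy u n f) = (iota (copy (u + a) n f) ^ rot a)%g.
Proof.
move=> un uan da; apply: (@mulgI _ (rot a)); rewrite conjgE mulVKg.
apply: lifts_ext (liftsM (rotE da) (iotaE _)) (liftsM (iotaE _) (rotE da)) _ => z.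
have [x /andP[ux xu] xz] := circle_rep u z; exists x => //=; congr circle_proj.
rewrite !periodize_copy//; [|apply/andP; split; lra..].
by rewrite addrA [a + u]addrC; congr (_ + _ * actF f (_ * _)); ring.
Qed.


Lemma near_trivial_iota_inK : near_trivial R (iota @` @inK R).
Proof. exact: near_trivial_image iotaM (near_trivial_inK R). Qed.

Lemma fits_middle : fits (1 / 4 : R) 1.
Proof. by split; [exists 1, 2%N; rewrite expr2; congr (_ / _); lra|lra|rewrite expr1; lra]. Qed.

Lemma dyadic_quarter : dyadic (1 / 4 : R). Proof. by have [] := fits_middle. Qed.

Lemma inK_middle f : inK (copy (1 / 4) 1 f).
Proof.
exists (1 / 4), (1 / 4 + 2 ^- 1); split; [lra|rewrite expr1; lra|].
exact: suppF_copy fits_middle.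
Qed.

(** A copy in [[0, 1/2]] may have nontrivial slope at 0 and so escape [inK]; rotated by [1/4] it is
    supported in [[1/4, 3/4]]. *)
Lemma near_trivial_iota_iL : near_trivial R (iota @` range (@iL R)).
Proof.
apply: near_trivialJ near_trivial_iota_inK _ => _ [_ [f _ <-] <-].
exists (iota (copy (1 / 4) 1 f)), (rot (1 / 4)); split.
  by exists (copy (1 / 4) 1 f) => //; exact: inK_middle.
rewrite /iL (@iota_copy 0 1 f (1 / 4)) ?add0r//; [exact: fits_left|exact: fits_middle|exact: dyadic_quarter].
Qed.

Lemma near_trivial_iota_iR : near_trivial R (iota @` range (@iR R)).
Proof.
apply: near_trivialJ near_trivial_iota_inK _ => _ [_ [f _ <-] <-].
have e : 1 / 2 + - (1 / 4) = 1 / 4 :> R by lra.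
exists (iota (copy (1 / 4) 1 f)), (rot (- (1 / 4))); split.
  by exists (copy (1 / 4) 1 f) => //; exact: inK_middle.
rewrite /iR (@iota_copy (1 / 2) 1 f (- (1 / 4))) ?e//.
- exact: fits_right.
- exact: fits_middle.
- exact/dyadicN/dyadic_quarter.
Qed.

Lemma flip_iL f : flip (iL f) = iR (flip f).
Proof.
apply: actF_ext => x; rewrite flipE iLE iRE flipE.
have -> : 2 * (1 - x) = 1 - (2 * x - 1) by ring.
lra.
Qed.

(** Factors with the right slopes are chosen, [iL g] for the end 0 and [iR h] for the end 1; what
    remains has trivial germs. *)
Lemma inK_iL_iR f : exists k g h, [/\ inK k & f = (k * iL g * iR h)%g].
Proof.
have [m fm] := germ0_ex f; have [n fn] := germ0_ex (flip f).
have [g gm] := germ0_pow_ex R m; have [h hn] := germ0_pow_ex R n.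
exists (f * (iR (flip h))^-1 * (iL g)^-1)%g, g, (flip h); split; last by rewrite !mulgVK.
have iLm := germ0_copy 1 gm; have iLn := germ0_copy 1 hn.
have s0 : germ0 (iR (flip h)) 0.
  by apply: germ0_supp (iR_supp (suppF01 (flip h))); lra.
have s1 : germ1 (iL g) 0.
  by apply: germ0_supp (suppF_flip (iL_supp (suppF01 g))); lra.
apply/inK_germ; split.
  have := germ0M (germ0M fm (germ0V s0)) (germ0V iLm).
  by rewrite oppr0 addr0 subrr.
rewrite /germ1 !flipM !flipV -flip_iL flipK.
have := germ0M (germ0M fn (germ0V iLn)) (germ0V s1).
by rewrite subrr subr0.
Qed.

Lemma near_trivial_iota : near_trivial R (range iota).
Proof.
pose KL : set TT := [set (s * t)%g | s in iota @` @inK R & t in iota @` range (@iL R)].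
have ntKL : near_trivial R KL.
  apply: near_trivialM near_trivial_iota_inK near_trivial_iota_iL _.
  by move=> _ [s sK [t tL <-]]; exists s, t.
apply: near_trivialM ntKL near_trivial_iota_iR _ => _ [f _ <-].
have [k [g [h [kK ->]]]] := inK_iL_iR f.
exists (iota k * iota (iL g))%g, (iota (iR h)); split; last by rewrite !iotaM.
  exists (iota k); first by exists k.
  by exists (iota (iL g)) => //; exists (iL g) => //; exists g.
by exists (iR h) => //; exists h.
Qed.

(** Induction on the exponent of the denominator. [assocF] or its inverse brings [1/2] to the
    midpoint of the half containing [a], and a copy of the element for the doubled problem
    finishes. *)
Lemma half_transitive a : dyadic a -> 0 < a < 1 -> exists f, actF f (1 / 2) = a.
Proof.
move=> [k [n ->]]; elim: n k => [|n IH] k.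
  by rewrite expr0 divr1 ltr0z -[1]mulr1z ltr_int; lia.
have e0 : 0 < (2 : R) ^+ n.+1 by rewrite exprn_gt0.
pose a' : R := k%:~R / 2 ^+ n.+1; rewrite -/a' => /andP[k0 k1].
have aE : 2 * a' = k%:~R / 2 ^+ n by rewrite /a' exprS invfM mulrCA mulVKf ?pnatr_eq0.
have [ah|ah|->] := ltgtP a' (1 / 2); last by exists 1%g; rewrite actF1.
  have [|f fE] := IH k; first by rewrite -aE; apply/andP; split; lra.
  exists (iL f * assocF R)%g; rewrite actFM assocF_l; last by apply/andP; split; lra.
  by rewrite iLE (_ : 2 * (1 / 2 / 2) = 1 / 2) ?fE -?aE; lra.
have aE' : 2 * a' - 1 = (k - 2 ^+ n)%:~R / 2 ^+ n.
  by rewrite aE intrB rmorphXn /= mulrBl mulfV// expf_neq0// pnatr_eq0.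
have [|f fE] := IH (k - 2 ^+ n); first by rewrite -aE'; apply/andP; split; lra.
exists (iR f * (assocF R)^-1)%g; rewrite actFM assocFV_r; last by apply/andP; split; lra.
by rewrite iRE (_ : 2 * _ - 1 = 1 / 2) ?fE -?aE'; lra.
Qed.

(** Shifted by an integer so as to fix 0, the lift restricts to an increasing bijection of [[0, 1]],
    which is an element of F; periodizing it recovers [t]. *)
Lemma stabilizer_iota t : actT t (circle_proj 0) = circle_proj 0 -> range iota t.
Proof.
move=> t0; have [tD [phi' tphi [B [finB dB fB]]]] := thompsonTP t.
have [tp' _ phi'_lt] := tphi.
have [n nE] : exists n : int, phi' 0 = n%:~R.
  have : circle_proj (phi' 0) = circle_proj 0 by rewrite tp'.
  by move=> /circle_projP[n ->]; exists n; rewrite add0r.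
pose phi x := phi' x - n%:~R.
have phi0 : phi 0 = 0 by rewrite /phi nE subrr.
have phi1 : phi 1 = 1.
  by have [_ /(_ 0) + _] := tphi; rewrite add0r nE /phi => ->; ring.
pose psi x := lift_inv tphi (x + n%:~R).
have phiK x : psi (phi x) = x.
  by apply: (Defs.lift_inj tphi); rewrite lift_invK subrK.
have psiK x : phi (psi x) = x by rewrite /phi lift_invK addrK.
have phi_lt x y : x < y -> phi x < phi y by move=> /phi'_lt; rewrite /phi; lra.
have phi_itv x : 0 <= x <= 1 -> 0 <= phi x <= 1.
  move=> /andP[x0 x1]; rewrite -{1}phi0 -[X in _ <= _ <= X]phi1.
  by rewrite !(increasing_leE phi_lt) x0.
have psi_itv x : 0 <= x <= 1 -> 0 <= psi x <= 1.
  by move=> /andP[x0 x1]; apply/andP; split; rewrite -(increasing_leE phi_lt) psiK ?phi0 ?phi1.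
pose p (r : R -> R) x := if 0 <= x <= 1 then r x else x.
have pK (r r' : R -> R) : (forall x, r' (r x) = x) -> (forall x, 0 <= x <= 1 -> 0 <= r x <= 1) ->
    cancel (p r) (p r').
  move=> rK r01 x; rewrite /p; case: (boolP (0 <= x <= 1)) => x01; first by rewrite r01// rK.
  by rewrite (negbTE x01).
have [|||f fE] := thompsonF_build (pK _ _ phiK phi_itv) (pK _ _ psiK psi_itv).
- move=> x y xy; rewrite /p; case: (boolP (0 <= x <= 1)) => x01; case: (boolP (0 <= y <= 1)) => y01.
  + exact: phi_lt.
  + have /andP[_ h] := phi_itv _ x01; case/andP: x01 => x0 x1.
    by apply: le_lt_trans h _; move: y01; rewrite negb_and -!ltNge => /orP[]; lra.
  + have /andP[h _] := phi_itv _ y01; case/andP: y01 => y0 y1.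
    by apply: lt_le_trans h; move: x01; rewrite negb_and -!ltNge => /orP[]; lra.
  + by [].
- move=> x x01; rewrite /p; case: ifPn => // /andP[x0 x1].
  case: x01 => h; first by have -> : x = 0 by lra.
  by have -> : x = 1 by lra.
- pose rep z := sval (cid2 (circle_rep 0 z)).
  have repP z : 0 <= rep z < 0 + 1 := s2valP (cid2 (circle_rep 0 z)).
  have repK z : circle_proj (rep z) = z := s2valP' (cid2 (circle_rep 0 z)).
  have /finite_seqP[s sE] := finB; exists (map rep s).
    move=> _ /mapP[z zs ->]; have Bz : B z by rewrite sE.
    have [y dy yz] := dB z Bz.
    have /circle_projP[j ->] : circle_proj (rep z) = circle_proj y by rewrite repK.
    by apply: dyadicD dy _; exact: dyadic_int.
  move=> a b a0 ab b1 nB; have [c /andP[ac cb] Bc|m mE] := fB a b ab.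
    apply: (nB c); last by rewrite ac.
    have -> : c = rep (circle_proj c).
      have /circle_projP[j cE] := repK (circle_proj c).
      have /andP[r0 r1] := repP (circle_proj c).
      suff j0 : j = 0 by rewrite cE j0 mulr0z addr0.
      have : (j%:~R : R) < 1%:~R by rewrite mulr1z; lra.
      have : (-1)%:~R < (j%:~R : R) by rewrite mulrN1z; lra.
      by rewrite !ltr_int; lia.
    by apply: map_f; rewrite sE in Bc.
  exists m => x /andP[ax xb].
  rewrite /p !ifT; [|apply/andP; split; lra..].
  by rewrite /phi mE ?ax//; ring.
have tL : lifts t phi' by move=> x; rewrite tp'.
exists f => //; apply: lifts_ext (iotaE f) tL _ => z.
have [x /andP[x0]] := circle_rep 0 z; rewrite add0r => x1 xz; exists x => //.
rewrite (@periodize_itv _ 0); last by rewrite mulr0z add0r x0 ltW.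
rewrite mulr0z subr0 addr0 fE /p x0 ltW// /phi -[in RHS](subrK n%:~R (phi' x)).
by rewrite circle_projD.
Qed.

Definition moves_half : set TT := [set t | actT t (circle_proj 0) <> circle_proj (1 / 2)].

Lemma actT_iota f x : 0 <= x <= 1 -> actT (iota f) (circle_proj x) = circle_proj (actF f x).
Proof.
move=> x01; rewrite iotaE (@periodize_itv _ 0) ?mulr0z ?subr0 ?addr0//.
by rewrite add0r.
Qed.

Lemma actT_dyadic t x : dyadic x -> exists2 q, dyadic q & 0 <= q < 1 /\ actT t (circle_proj x) = circle_proj q.
Proof.
move=> dx; have [tD _] := thompsonTP t.
have : dyadic_circle (actT t (circle_proj x)) by rewrite -tD; exists (circle_proj x) => //; exists x.
move=> [y dy <-]; have [q q01 qy] := circle_rep 0 (circle_proj y).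
rewrite add0r in q01; have /circle_projP[n qE] := qy.
by exists q; [rewrite qE; apply: dyadicD dy _; exact: dyadic_int|rewrite qy].
Qed.

Lemma circle_proj_inj x y : 0 <= x < 1 -> 0 <= y < 1 -> circle_proj x = circle_proj y -> x = y.
Proof.
move=> /andP[x0 x1] /andP[y0 y1] /circle_projP[n nE].
suff n0 : n = 0 by rewrite nE n0 mulr0z addr0.
have : (n%:~R : R) < 1%:~R by rewrite mulr1z; lra.
have : (-1)%:~R < (n%:~R : R) by rewrite mulrN1z; lra.
by rewrite !ltr_int; lia.
Qed.

(* Any such [t] is a product of an element of the stabilizer of [1/2], which is
   conjugate to the image of F, and one of the stabilizer of [0]. *)
Lemma near_trivial_moves_half : near_trivial R moves_half.
Proof.
have near_conj : near_trivial R [set (t ^ (rot (1 / 2))^-1)%g | t in range iota].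
  by apply: near_trivialJ near_trivial_iota _ => _ [t tr <-]; exists t, (rot (1 / 2))^-1%g.
apply: near_trivialM near_conj near_trivial_iota _ => t th.
have [q dq [/andP[q0 q1] tq]] := actT_dyadic t (dyadic0 R).
have qh : q <> 1 / 2 by move=> qE; apply: th; rewrite tq qE.
have r_half := rotE (dyadic_half R).
(* [q'] is [q - 1/2] modulo 1. It is nonzero precisely because [q] is not [1/2], so an element of F
   can take [1/2] to it. *)
have [q' dq' [q'01 [n q'E]]] : exists2 q', dyadic q' & 0 < q' < 1 /\ exists n : int, 1 / 2 + q' = q + n%:~R.
  have [h|h] := ltP q (1 / 2).
    exists (q + 1 / 2); first by apply: dyadicD dq _; exact: dyadic_half.
    by split; [apply/andP; split; lra|exists 1; rewrite mulr1z; lra].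
  exists (q - 1 / 2); first by apply: dyadicB dq _; exact: dyadic_half.
  by split; [apply/andP; split; [|lra]|exists 0; rewrite mulr0z; lra]; move/eqP: qh; lra.
have [f fE] := half_transitive dq' q'01.
pose w := (iota f ^ (rot (1 / 2))^-1)%g.
have wE : actT w (circle_proj 0) = circle_proj q.
  rewrite /w conjgE invgK !actTM.
  have -> : actT (rot (1 / 2))^-1%g (circle_proj 0) = circle_proj (1 / 2).
    apply: (can_inj (actTK (rot (1 / 2)))); rewrite actTKV r_half.
    by apply/esym/circle_projP; exists 1; rewrite mulr1z; lra.
  rewrite actT_iota ?fE ?r_half; last by apply/andP; split; lra.
  by rewrite q'E circle_projD.
exists w, (w^-1 * t)%g; split; last by rewrite mulVKg.
  by exists (iota f) => //; exists f.
by apply: stabilizer_iota; rewrite actTM tq -wE actTK.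
Qed.

(** If [t] takes 0 to [1/2], then following it by the rotation by [1/4] gives [3/4] instead, and the
    inverse rotation also sends 0 to [3/4]. *)
Lemma near_trivial_T : near_trivial R [set: TT].
Proof.
have d4 := dyadic_quarter.
have rqE : actT (rot (1 / 4)) (circle_proj (1 / 2)) = circle_proj (3 / 4).
  by rewrite (rotE d4); congr circle_proj; lra.
have ne x y : 0 <= x < 1 -> 0 <= y < 1 -> x <> y -> circle_proj x <> circle_proj y.
  by move=> x01 y01 xy /(circle_proj_inj x01 y01).
apply: near_trivialM near_trivial_moves_half near_trivial_moves_half _ => t _.
have [th|th] := pselect (moves_half t).
  exists t, 1%g; rewrite mulg1; split=> //; rewrite /moves_half /= actT1.
  by apply: ne; [apply/andP; split; lra..|lra].
exists (rot (1 / 4))^-1%g, (rot (1 / 4) * t)%g; split; last by rewrite mulKg.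
  rewrite /moves_half /= => e.
  have := congr1 (actT (rot (1 / 4))) e; rewrite actTKV rqE.
  by apply: ne; [apply/andP; split; lra..|lra].
rewrite /moves_half /= actTM => e.
have tE : actT t (circle_proj 0) = circle_proj (1 / 2) by apply: contrapT.
move: e; rewrite tE rqE; apply: ne; [apply/andP; split; lra..|lra].
Qed.

End ThompsonTElements.

Local Close Scope ring_scope.
Local Close Scope classical_set_scope.

Theorem theorem1p2 (R : realType) (omega : set_system nat)
    (omega_ultra : UltraFilter omega) (omega_np : nonprincipal omega)
    (family : set (normed_unitary_group R)) :
  [/\ uniformly_stable_linear omega family (subgroup_type (thompsonF R)),
      uniformly_stable_linear omega family
        (subgroup_type (derived_subgroup (subgroup_type (thompsonF R)))),
      uniformly_stable_linear omega family (subgroup_type (thompsonT R)) &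
      uniformly_stable_linear omega family (subgroup_type thompsonV)].
Proof.
split.
- apply: (abelianization_stable omega_ultra omega_np (near_trivial_inK R) (@end_slopesM R) (@end_slopes_surj R)) => f f0.
  by apply/inK_germ; have := end_slopes_germ f; rewrite f0.
- exact: near_trivial_stable (near_trivial_DF R).
- exact: near_trivial_stable (near_trivial_T R).
- exact: near_trivial_stable (near_trivial_V R).
Qed.
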